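(* (i) (Unbiased risk estimate.) For any $\xi\in L^2(\Omega\times[0,T],\mathbb{P}_u\otimes\mu)$ such that $\xi_t\in\mathrm{Dom}(D)$, $t\in[0,T]$, and $(D_t\xi_t)_{t\in[0,T]}\in L^1(\Omega\times[0,T],\mathbb{P}_u\otimes\mu)$, we have $$\mathbb{E}_u\left[\|X+\xi-u\|^2_{L^2([0,T],d\mu)}\right]=\mathrm{R}(\gamma,\mu,\hat u)+\|\xi\|^2_{L^2(\Omega\times[0,T],\mathbb{P}_u\otimes\mu)}+2\,\mathbb{E}_u\left[\int_0^TD_t\xi_t\,\mu(dt)\right].$$ (ii) (Stein-type estimator.) For any $\mathbb{P}$-a.s. positive random variable $F\in\mathrm{Dom}(D)$ such that $D_tF\in\mathrm{Dom}(D)$, $t\in[0,T]$, and $(D_tD_tF)_{t\in[0,T]}\in L^1(\Omega\times[0,T],\mathbb{P}_u\otimes\mu)$, we have $$\mathbb{E}_u\left[\|X+D\log F-u\|^2_{L^2([0,T],d\mu)}\right]=\mathrm{R}(\gamma,\mu,\hat u)-\mathbb{E}_u\left[\|D\log F\|^2_{L^2([0,T],d\mu)}\right]+2\,\mathbb{E}_u\left[\frac{\Delta F}{F}\right]=\mathrm{R}(\gamma,\mu,\hat u)+4\,\mathbb{E}_u\left[\frac{\Delta\sqrt F}{\sqrt F}\right].$$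
   Context: Let $T>0$ and let $\mu$ be a finite Borel measure on $[0,T]$. $X=(X_t)_{t\in[0,T]}$ is a real-valued centered Gaussian process (the canonical process) on a probability space $(\Omega,\mathcal{F},\mathbb{P})$, with $\mathcal{F}$ generated by $X$, and with covariance $$\gamma(s,t)=\mathbb{E}[X_sX_t]=\int_0^{s\wedge t}K(t,r)K(s,r)\,dr,\qquad s,t\in[0,T],$$ where $K(\cdot,\cdot)$ is a deterministic kernel such that $(Kh)(t):=\int_0^tK(t,s)\dot h(s)\,ds$ is differentiable in $t\in[0,T]$. Hilbert space $H$. $H$ is the real separable Hilbert space generated by the functions $\chi_t(s)=\min(s,t)$, $s,t\in[0,T]$, with scalar product determined by $\langle\chi_t,\chi_s\rangle_H=\gamma(s,t)$. Put $\langle h,g\rangle:=\langle\dot h,\dot g\rangle_{L^2([0,T],dt)}$, let $K^*$ be the adjoint of $K$ with respect to $\langle\cdot,\cdot\rangle$ and $\Gamma=KK^*$; then $\langle h,g\rangle_H=\langle K^*h,K^*g\rangle=\langle h,\Gamma g\rangle$ and $\Gamma h(t)=\langle\chi_t,h\rangle_H$, $t\in[0,T]$, $h\in H$. Drift. $u=(u_t)_{t\in[0,T]}$ is an adapted process $u_t=\int_0^t\dot u_s\,ds$ with $\dot u\in L^2(\Omega\times[0,T])$, and $\mathbb{P}_u$ is the translation of $\mathbb{P}$ on $\Omega$ by $u$, under which $X_t=u_t+X^u_t$ with $(X^u_t)_{t\in[0,T]}$ a centered Gaussian process with covariance $\gamma$; $\mathbb{E}_u$ is the expectation under $\mathbb{P}_u$.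 Denote by $X^u(h)$, $h\in H$, the isonormal Gaussian process (linear isometry $H\to L^2(\Omega,\mathbb{P}_u)$) with $X^u(\chi_t)=X^u_t$. Risk of $\hat u=X$: $\mathrm{R}(\gamma,\mu,\hat u):=\mathbb{E}_u[\|X-u\|^2_{L^2([0,T],d\mu)}]=\int_0^T\gamma(t,t)\,\mu(dt)$. Malliavin derivative. Fix a total subset $(h_n)_{n\ge1}$ of $H$ and let $\mathcal{S}$ be the space of cylindrical functionals $F=f_n(X^u(h_1),\ldots,X^u(h_n))$, with $n\ge1$ and $f_n$ an infinitely differentiable rapidly decreasing function on $\mathbb{R}^n$. For such $F$, $$D_tF=\sum_{i=1}^n\Gamma h_i(t)\,\partial_if_n(X^u(h_1),\ldots,X^u(h_n)),\qquad t\in[0,T].$$ Equivalently $D_tF=\langle\chi_t,\nabla F\rangle_H$ with $\nabla F=\sum_i\partial_if_n(X^u(h_1),\ldots,X^u(h_n))\,h_i$ the usual $H$-valued Malliavin derivative. $D$ is closable and $\mathrm{Dom}(D)$ is its closed domain, i.e. the closure of $\mathcal{S}$ for the norm $(\mathbb{E}_u[F^2]+\mathbb{E}_u[\|\nabla F\|_H^2])^{1/2}$, with $D_tF=\langle\chi_t,\nabla F\rangle_H$ for $F\in\mathrm{Dom}(D)$. $D\log F$ denotes the process $D_t\log F=D_tF/F$, $t\in[0,T]$. Laplacian. $\Delta F=\int_0^TD_tD_tF\,\mu(dt)$, where $D_tD_tF$ means $D_t$ applied to the random variable $D_tF$ (same $t$). For $\sqrt F$, derivatives are understood by the chain rule,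 $D_t\sqrt F=\frac{D_tF}{2\sqrt F}$ and $D_tD_t\sqrt F=\frac{D_tD_tF}{2\sqrt F}-\frac{|D_tF|^2}{4F^{3/2}}$, and $\Delta\sqrt F=\int_0^TD_tD_t\sqrt F\,\mu(dt)$.
   Formalization: In (ii), D log F in L²(Ω×[0,T], P_u⊗μ) and ΔF/F in L¹(P_u) are also assumed, and F is taken P_u-a.s. positive; without integrability (ii) fails, e.g. F = Z² with Z standard normal and μ a Dirac mass. *)

(* Defs.v *)
From HB Require Import structures.
From mathcomp Require Import all_boot all_order all_algebra.
From mathcomp Require Import all_classical all_reals all_analysis.

Set Implicit Arguments.
Unset Strict Implicit.
Unset Printing Implicit Defensive.

Import Order.TTheory GRing.Theory Num.Theory.
Import numFieldNormedType.Exports.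

Local Open Scope classical_set_scope.
Local Open Scope ring_scope.

(* Processes are families [X : R -> Omega -> R]; only times t in [0, T] matter.
   A measure on [0, T] is given by a measure on R, used on [0, T] only. *)

Definition sq_integrable d (S : measurableType d) (R : realType)
    (m : {measure set S -> \bar R}) (D : set S) (f : S -> R) : Prop :=
  measurable_fun D f /\ m.-integrable D (EFin \o (fun x => f x ^+ 2)).

Definition sqnorm_L2 (R : realType)
    (mu : {measure set (measurableTypeR R) -> \bar R}) (T : R) (f : R -> R)
    : \bar R :=
  (\int[mu]_(t in `[0%R, T]) (f t ^+ 2)%:E)%E.

Definition joint d (Omega : measurableType d) (R : realType)
    (X : R -> Omega -> R) : Omega * measurableTypeR R -> R :=
  fun z => X z.2 z.1.

Definition strip d (Omega : measurableType d) (R : realType) (T : R)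
    : set (Omega * measurableTypeR R) := setT `*` `[0, T].

Section kernel.
Context {R : realType}.
Implicit Types (K : R -> R -> R) (T : R).

Definition kernel_cov K (s t : R) : R :=
  \int[lebesgue_measure]_(r in `[0%R, Num.min s t]) (K t r * K s r).

Definition kernel_op K (dh : R -> R) (t : R) : R :=
  \int[lebesgue_measure]_(s in `[0%R, t]) (K t s * dh s).

(* Square integrability of K(t, .) is what makes gamma(t, t) finite.
   Differentiability is required at almost every t only: for K = 1 the function
   [kernel_op K dh] is a primitive of [dh], and nothing more can be asked. *)
Definition drift_kernel T K : Prop :=
  [/\ measurable_fun [set: measurableTypeR R * measurableTypeR R]
        (fun p => K p.1 p.2),
      forall t : R, t \in `[0, T] ->
        sq_integrable lebesgue_measure `[0, t] (K t)
    & forall dh : R -> R, sq_integrable lebesgue_measure `[0, T] dh ->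
        {ae lebesgue_measure, forall t : R, t \in `[0, T] ->
           derivable (kernel_op K dh : R^o -> R^o) t 1}].

End kernel.

Section processes.
Context d (Omega : measurableType d) {R : realType}.
Implicit Types (P : probability Omega R) (X : R -> Omega -> R) (T : R).

(* [normal_prob 0 s] is the normal law only for s != 0, hence the separate
   degenerate case. *)
Definition centered_gaussian_rv P (Y : Omega -> R) : Prop :=
  measurable_fun setT Y /\
  ({ae P, forall w, Y w = 0} \/
   exists2 s : R, 0 < s &
     forall B : set R, measurable B -> P (Y @^-1` B) = normal_prob 0 s B).

Definition centered_gaussian_process P T X (gamma : R -> R -> R) : Prop :=
  (forall n (t a : 'I_n -> R), (forall i, t i \in `[0, T]) ->
     centered_gaussian_rv P (fun w => \sum_i a i * X (t i) w)) /\
  (forall s t : R, s \in `[0, T] -> t \in `[0, T] ->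
     ('E_P[fun w => (X s w * X t w)%R])%E = (gamma s t)%:E).

(* sigma(X_s, 0 <= s <= t) *)
Definition history X (t : R) : set (set Omega) :=
  <<s [set A | exists (s : R) (B : set R),
         [/\ s \in `[0, t], measurable B & A = X s @^-1` B]] >>.

Definition adapted T X (u : R -> Omega -> R) : Prop :=
  forall (t : R) (B : set R), t \in `[0, T] -> measurable B ->
    history X t (u t @^-1` B).

Definition drift (du : R -> Omega -> R) (t : R) (w : Omega) : R :=
  \int[lebesgue_measure]_(s in `[0%R, t]) du s w.

End processes.

Section hilbert.
Context {R : realType} (H : completeNormedModType R).
Implicit Types (ip : H -> H -> R) (A : set H).

(* Positive definiteness follows from the last clause. *)
Definition hilbert_product ip : Prop :=
  [/\ forall g h, ip g h = ip h g,
      forall (a : R) f g h, ip (a *: f + g) h = a * ip f h + ip g h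
    & forall h, ip h h = `|h| ^+ 2].

Definition total_set A : Prop :=
  closure [set v : H | exists n (a : 'I_n -> R) (x : 'I_n -> H),
             (forall i, A (x i)) /\ v = \sum_i a i *: x i] = setT.

(* H is the Hilbert space generated by the chi_t with Gram kernel gamma; these
   properties determine (H, chi) up to isometry. *)
Definition generated_by T ip (chi : R -> H) (gamma : R -> R -> R) : Prop :=
  [/\ hilbert_product ip,
      forall s t : R, s \in `[0, T] -> t \in `[0, T] ->
        ip (chi t) (chi s) = gamma s t
    & total_set (chi @` `[0, T])].

Definition isonormal d (Omega : measurableType d) (P : probability Omega R)
    ip (W : H -> Omega -> R) : Prop :=
  [/\ forall h, centered_gaussian_rv P (W h),
      forall (a : R) g h, {ae P, forall w, W (a *: g + h) w = a * W g w + W h w}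
    & forall g h, ('E_P[fun w => (W g w * W h w)%R])%E = (ip g h)%:E].

End hilbert.

Section schwartz.
Context {R : realType} (n : nat).
Implicit Types f : 'rV[R]_n.+1 -> R^o.

Definition partial (i : 'I_n.+1) f : 'rV[R]_n.+1 -> R^o :=
  fun x => 'D_(delta_mx 0 i) f x.

Definition partials (s : seq 'I_n.+1) f : 'rV[R]_n.+1 -> R^o :=
  foldr partial f s.

(* Differentiability of all iterated partial derivatives amounts to C^infty. *)
Definition schwartz f : Prop :=
  forall s : seq 'I_n.+1,
    (forall x, differentiable (partials s f) x) /\
    (forall k : nat, exists C : R,
       forall x, `|x| ^+ k * `|partials s f x| <= C).

End schwartz.

Section malliavin.
Context d (Omega : measurableType d) {R : realType} (P : probability Omega R).
Context (H : completeNormedModType R) (ip : H -> H -> R) (chi : R -> H).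
Context (W : H -> Omega -> R) (h : nat -> H).

(* [h k] stands for the (k+1)-th vector of the total sequence. *)
Definition coords (n : nat) (w : Omega) : 'rV[R]_n.+1 :=
  \row_(i < n.+1) W (h i) w.

(* F is cylindrical and G is its H-valued gradient. *)
Definition cylindrical (F : Omega -> R) (G : Omega -> H) : Prop :=
  exists n (f : 'rV[R]_n.+1 -> R^o),
    [/\ schwartz f,
        F = (fun w => f (coords n w))
      & G = (fun w => \sum_(i < n.+1) partial i f (coords n w) *: h i)].

Definition borel_valued (G : Omega -> H) : Prop :=
  forall A : set H, open A -> measurable (G @^-1` A).

(* F \in Dom(D) with gradient G: the graph of the closure of the operator above
   in L^2(Omega) x L^2(Omega; H). *)
Definition gradient (F : Omega -> R) (G : Omega -> H) : Prop :=
  [/\ measurable_fun setT F, borel_valued G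
    & exists (Fn : nat -> Omega -> R) (Gn : nat -> Omega -> H),
      [/\ forall k, cylindrical (Fn k) (Gn k),
          (fun k => \int[P]_w ((Fn k w - F w) ^+ 2)%:E)%E @ \oo --> 0%E
        & (fun k => \int[P]_w (`|Gn k w - G w| ^+ 2)%:E)%E @ \oo --> 0%E]].

(* F \in Dom(D) and Z is a version of D_t F. *)
Definition malliavin (t : R) (F Z : Omega -> R) : Prop :=
  exists2 G, gradient F G & {ae P, forall w, Z w = ip (chi t) (G w)}.

End malliavin.

Section stein.
Context d (Omega : measurableType d) {R : realType}.
Context (mu : {measure set (measurableTypeR R) -> \bar R}) (T : R).
Implicit Types (F : Omega -> R) (DF DDF xi : R -> Omega -> R).

Definition risk (gamma : R -> R -> R) : \bar R :=
  (\int[mu]_(t in `[0%R, T]) (gamma t t)%:E)%E.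

Definition Dlog F DF (t : R) (w : Omega) : R := DF t w / F w.

(* Laplacian of a functional whose second derivatives D_t D_t are [DDF]. *)
Definition laplacian DDF (w : Omega) : R := \int[mu]_(t in `[0%R, T]) DDF t w.

(* D_t D_t (sqrt F) by the chain rule. *)
Definition DDsqrt F DF DDF (t : R) (w : Omega) : R :=
  DDF t w / (2 * Num.sqrt (F w)) - `|DF t w| ^+ 2 / (4 * F w `^ (3 / 2)).

End stein.

(* Main.v *)
Require Import Defs.
From HB Require Import structures.
From mathcomp Require Import all_boot all_order all_algebra.
From mathcomp Require Import all_classical all_reals all_analysis.
From mathcomp Require Import measurable_realfun.
From mathcomp Require Import ring lra.

Set Implicit Arguments.
Unset Strict Implicit.
Unset Printing Implicit Defensive.

Import Order.TTheory GRing.Theory Num.Theory.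
Import numFieldNormedType.Exports.

Local Open Scope classical_set_scope.
Local Open Scope ring_scope.

(** Write N = X - u for the noise, a centered Gaussian process with covariance
    gamma under the shifted probability, so that its squared norm in L^2(mu) has
    expectation R(gamma, mu, X). Expanding the square of N + xi, the estimate reduces
    to the cross term E[int N_t xi_t mu(dt)], and Gaussian integration by parts gives
    E[N_t Y] = E[W(chi_t) Y] = E[<chi_t, grad Y>] = E[D_t Y] at each time t
    ([malliavin_ibp1], [noise_ibp]). If the risk is infinite, so are both sides
    ([sqr_norm_expansion]).

    For Stein's estimator xi = D log F the cross term should be
    E[D_t(D_t F / F)] = E[D_t D_t F / F - |D_t F / F|^2], but D_t F / F is not known
    to be in the domain of D. The reciprocal is therefore regularised into
    F / (F^2 + e), and the integration by parts is proved for products A phi(B) with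
    A, B in the domain and phi smooth and bounded ([malliavin_ibp]). Letting e go
    to 0 under the integral sign is legitimate because F times the regularised
    reciprocal is bounded by 1, and so is F^2 times its derivative ([noise_Dlog]).
    The form with sqrt F follows from the chain rule ([stein_risk_sqrt]).

    The integration by parts formula itself is proved first for functionals
    f(W(h_0), ..., W(h_n)) with f smooth and bounded ([gaussian_ibp]): each W(h_i) is a
    multiple of W(g) plus a residue uncorrelated with W(g), and the residues are
    jointly independent of W(g), so that the formula follows from Stein's identity
    E[z F(z)] = s^2 E[F'(z)] for one normal variable ([stein_normal]). Independence
    ([decoupling]) has to be deduced from the fact that linear combinations are
    normal, that is, from the Cramer-Wold theorem ([Cramer_Wold]). The latter is
    obtained by inverting Fourier transforms one coordinate at a time: smoothing by
    a small normal law expresses the weighted law of a random variable through its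
    Fourier transform ([fourier_smoothing], [fourier_unique_cell]), and functions of
    several coordinates are discretised in one of them ([step_approx]). The Fourier
    transform of the normal law is in turn a consequence of Stein's identity
    ([normal_fourier]). Functionals in the domain are then reached by limits in L^2
    ([Rint_cvg_prod]). *)

(** * Integrals of real functions *)

Section real_integrals.
Context d (S : measurableType d) (R : realType).
Variables (m : {measure set S -> \bar R}) (D : set S).
Hypothesis mD : measurable D.
Implicit Types c f g : S -> R.

Lemma integrable_meas f : m.-integrable D (EFin \o f) -> measurable_fun D f.
Proof. by move=> /integrableP[/measurable_EFinP]. Qed.

Lemma Rint_ae_eq f g : measurable_fun D f -> measurable_fun D g ->
  {ae m, forall x, D x -> f x = g x} ->
  \int[m]_(x in D) f x = \int[m]_(x in D) g x.
Proof.
move=> mf mg fg; congr fine; apply: ae_eq_integral => //.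
- exact/measurable_EFinP.
- exact/measurable_EFinP.
- by apply: filterS fg => x fg Dx /=; rewrite fg.
Qed.

Lemma integrable_le f g : measurable_fun D f ->
  m.-integrable D (EFin \o g) -> (forall x, D x -> `|f x| <= g x) ->
  m.-integrable D (EFin \o f).
Proof.
move=> mf ig fg; apply: le_integrable ig => //; first exact/measurable_EFinP.
by move=> x Dx /=; rewrite lee_fin (le_trans (fg x Dx))// ler_norm.
Qed.

Lemma integrable_ae_eq f g : measurable_fun D g ->
  m.-integrable D (EFin \o f) -> {ae m, forall x, D x -> f x = g x} ->
  m.-integrable D (EFin \o g).
Proof.
move=> mg fi fg; have mf := integrable_meas fi.
have /integrableP[_ fi'] := fi.
apply/integrableP; split; first exact/measurable_EFinP.
rewrite -(@ae_eq_integral _ _ _ m D _ (abse \o (EFin \o f)))//.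
- by apply: measurableT_comp => //; exact/measurable_EFinP.
- by apply: measurableT_comp => //; exact/measurable_EFinP.
- by apply: filterS fg => x fg Dx /=; rewrite fg.
Qed.

Lemma integrableRD f g : m.-integrable D (EFin \o f) ->
  m.-integrable D (EFin \o g) -> m.-integrable D (EFin \o (fun x => f x + g x)).
Proof.
move=> fi gi; apply: (eq_integrable mD _ _ _ (integrableD mD fi gi)) => x _.
by rewrite /= EFinD.
Qed.

Lemma integrableRZ (k : R) f : m.-integrable D (EFin \o f) ->
  m.-integrable D (EFin \o (fun x => k * f x)).
Proof.
move=> fi; apply: (eq_integrable mD _ _ _ (integrableZl mD k fi)) => x _.
by rewrite /= EFinM.
Qed.

Lemma integrableRB f g : m.-integrable D (EFin \o f) ->
  m.-integrable D (EFin \o g) -> m.-integrable D (EFin \o (fun x => f x - g x)).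
Proof.
move=> fi gi; apply: (eq_integrable mD _ _ _ (integrableB mD fi gi)) => x _.
by rewrite /= EFinB.
Qed.

Lemma integrableR_abs f : m.-integrable D (EFin \o f) ->
  m.-integrable D (EFin \o (fun x => `|f x|)).
Proof. by move=> fi; apply: (eq_integrable mD _ _ _ (integrable_abse fi)). Qed.

Lemma integrableRM_bounded (M : R) c f : measurable_fun D c ->
  (forall x, D x -> `|c x| <= M) -> m.-integrable D (EFin \o f) ->
  m.-integrable D (EFin \o (fun x => c x * f x)).
Proof.
move=> mc cM fi; apply: (@integrable_le _ (fun x => M * `|f x|)).
- by apply: measurable_funM => //; exact: integrable_meas.
- exact/integrableRZ/integrableR_abs.
- by move=> x Dx; rewrite normrM ler_wpM2r// cM.
Qed.

Lemma RintZ (k : R) f : m.-integrable D (EFin \o f) ->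
  \int[m]_(x in D) (k * f x) = k * \int[m]_(x in D) f x.
Proof. by move=> fi; rewrite RintegralZl. Qed.

Lemma RintD f g : m.-integrable D (EFin \o f) -> m.-integrable D (EFin \o g) ->
  \int[m]_(x in D) (f x + g x) = \int[m]_(x in D) f x + \int[m]_(x in D) g x.
Proof. by move=> fi gi; rewrite RintegralD. Qed.

Lemma RintB f g : m.-integrable D (EFin \o f) -> m.-integrable D (EFin \o g) ->
  \int[m]_(x in D) (f x - g x) = \int[m]_(x in D) f x - \int[m]_(x in D) g x.
Proof. by move=> fi gi; rewrite RintegralB. Qed.

Lemma Rint_sum (I : Type) (s : seq I) (f : I -> S -> R) :
  (forall i, m.-integrable D (EFin \o f i)) ->
  m.-integrable D (EFin \o (fun x => \sum_(i <- s) f i x)) /\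
  \int[m]_(x in D) (\sum_(i <- s) f i x) = \sum_(i <- s) \int[m]_(x in D) f i x.
Proof.
move=> fi; elim: s => [|i s [si sE]].
  under eq_fun do rewrite big_nil.
  by split; [exact: integrable0|rewrite big_nil Rintegral_cst// mul0r].
under eq_fun do rewrite big_cons; split; first exact: integrableRD.
by rewrite RintD// big_cons sE.
Qed.

Lemma EFin_Rint f : m.-integrable D (EFin \o f) ->
  (\int[m]_(x in D) f x)%:E = (\int[m]_(x in D) (f x)%:E)%E.
Proof. by move=> fi; rewrite fineK// integrable_fin_num. Qed.

Lemma Rint_dominated (fn : nat -> S -> R) f g :
  (forall n, measurable_fun D (fn n)) -> measurable_fun D f ->
  m.-integrable D (EFin \o g) ->
  (forall n x, D x -> `|fn n x| <= g x) ->
  {ae m, forall x, D x -> fn n x @[n --> \oo] --> f x} ->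
  m.-integrable D (EFin \o f) /\
  (fun n => \int[m]_(x in D) fn n x) @ \oo --> \int[m]_(x in D) f x.
Proof.
move=> mfn mf gi fng fnf.
have e1 n : measurable_fun D (EFin \o fn n) by exact/measurable_EFinP.
have e2 : measurable_fun D (EFin \o f) by exact/measurable_EFinP.
have e3 : {ae m, forall x, D x -> (EFin \o fn n) x @[n --> \oo] --> (EFin \o f) x}.
  apply: filterS fnf => x fnf Dx; apply/fine_cvgP; split; first exact: nearW.
  exact: fnf.
have e4 : {ae m, forall x n, D x -> (`|(EFin \o fn n) x| <= (EFin \o g) x)%E}.
  by apply: aeW => x n Dx /=; rewrite lee_fin fng.
have [fi _ c] := dominated_convergence mD e1 e2 e3 gi e4.
split => //; apply: fine_cvg.
by rewrite EFin_Rint.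
Qed.

End real_integrals.

Section square_integrable.
Context d (S : measurableType d) (R : realType).
Variables (m : {measure set S -> \bar R}) (D : set S).
Hypothesis mD : measurable D.
Implicit Types c f g : S -> R.

Lemma sq_integrableM f g : sq_integrable m D f -> sq_integrable m D g ->
  m.-integrable D (EFin \o (fun x => f x * g x)).
Proof.
move=> [mf fi] [mg gi].
apply: (@integrable_le _ _ _ m D mD _ (fun x => f x ^+ 2 + g x ^+ 2)) => //.
- exact: measurable_funM.
- exact: integrableRD.
- move=> x _; rewrite normrM -(real_normK (num_real (f x))).
  rewrite -(real_normK (num_real (g x))).
  have := sqr_ge0 (`|f x| - `|g x|); have := normr_ge0 (f x).
  have := normr_ge0 (g x); nra.
Qed.

Lemma sq_integrableD f g : sq_integrable m D f -> sq_integrable m D g ->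
  sq_integrable m D (fun x => f x + g x).
Proof.
move=> sf sg; have fg := sq_integrableM sf sg.
case: sf sg => mf fi [mg gi]; split; first exact: measurable_funD.
have := integrableRD mD (integrableRD mD fi (integrableRZ mD 2 fg)) gi.
by apply: eq_integrable => // x _ /=; congr EFin; ring.
Qed.

Lemma sq_integrableM_bounded (M : R) c f : measurable_fun D c ->
  (forall x, D x -> `|c x| <= M) -> sq_integrable m D f ->
  sq_integrable m D (fun x => c x * f x).
Proof.
move=> mc cM [mf fi]; split; first exact: measurable_funM.
have := @integrableRM_bounded _ _ _ m D mD (M ^+ 2) (fun x => c x ^+ 2)
  (fun x => f x ^+ 2) (measurable_funX _ mc).
move=> /(_ _ fi); rewrite (_ : (fun x => c x ^+ 2 * f x ^+ 2) =
  (fun x => (c x * f x) ^+ 2)); last by apply/funext => x; rewrite exprMn.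
by apply => x Dx; rewrite normrX lerXn2r ?nnegrE ?cM// (le_trans _ (cM x Dx)).
Qed.

Lemma sq_integrableZ (k : R) f : sq_integrable m D f ->
  sq_integrable m D (fun x => k * f x).
Proof. exact: (@sq_integrableM_bounded `|k| (fun=> k)). Qed.

Lemma sq_integrableB f g : sq_integrable m D f -> sq_integrable m D g ->
  sq_integrable m D (fun x => f x - g x).
Proof.
move=> sf /(sq_integrableZ (-1)) sg.
by have := sq_integrableD sf sg; under eq_fun do rewrite mulN1r.
Qed.

Lemma Cauchy_Schwarz f g : sq_integrable m D f -> sq_integrable m D g ->
  (\int[m]_(x in D) (f x * g x)) ^+ 2 <=
  (\int[m]_(x in D) (f x ^+ 2)) * (\int[m]_(x in D) (g x ^+ 2)).
Proof.
move=> sf sg; have fg := sq_integrableM sf sg.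
case: sf sg => mf fi [mg gi].
set A := \int[m]_(x in D) (f x ^+ 2); set B := \int[m]_(x in D) (f x * g x).
set C := \int[m]_(x in D) (g x ^+ 2).
have P t : 0 <= A + t * B *+ 2 + t ^+ 2 * C.
  have -> : A + t * B *+ 2 + t ^+ 2 * C =
      \int[m]_(x in D) (f x ^+ 2 + (2 * t) * (f x * g x) + t ^+ 2 * g x ^+ 2).
    rewrite RintD ?RintD ?RintZ//; try exact: integrableRZ.
      by rewrite -/A -/B -/C; ring.
    by apply: integrableRD => //; exact: integrableRZ.
  apply: Rintegral_ge0 => x Dx.
  by rewrite (_ : _ + _ = (f x + t * g x) ^+ 2) ?sqr_ge0//; ring.
have C0 : 0 <= C by apply: Rintegral_ge0 => x _; exact: sqr_ge0.
have [C0'|Cpos] := eqVneq C 0.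
  (* C = 0: this value of t would make the quadratic polynomial equal to -1 *)
  have := P (- (A + 1) * B / B ^+ 2 / 2).
  have [->|B0] := eqVneq B 0; first by move=> _; rewrite expr0n /= C0' mulr0.
  rewrite C0'.
  have -> : A + - (A + 1) * B / B ^+ 2 / 2 * B *+ 2 +
     (- (A + 1) * B / B ^+ 2 / 2) ^+ 2 * 0 = -1 by field.
  by rewrite oppr_ge0 ler10.
have Cgt0 : 0 < C by rewrite lt_neqAle eq_sym Cpos.
have := P (- B / C).
have -> : A + - B / C * B *+ 2 + (- B / C) ^+ 2 * C = A - B ^+ 2 / C by field.
by rewrite subr_ge0 ler_pdivrMr.
Qed.

(** By Cauchy-Schwarz, a bounded weight times a product of two sequences that
    converge in L^2 converges in L^1. Every passage from smooth functionals to
    their closure has this form. *)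
Lemma Rint_cvg_prod (M : R) c (fn gn : nat -> S -> R) f g :
  measurable_fun D c -> (forall x, D x -> `|c x| <= M) ->
  (forall n, sq_integrable m D (fn n)) -> sq_integrable m D f ->
  (forall n, sq_integrable m D (gn n)) -> sq_integrable m D g ->
  (fun n => \int[m]_(x in D) ((fn n x - f x) ^+ 2)) @ \oo --> (0 : R) ->
  (fun n => \int[m]_(x in D) ((gn n x - g x) ^+ 2)) @ \oo --> (0 : R) ->
  (fun n => \int[m]_(x in D) (c x * fn n x * gn n x)) @ \oo -->
  \int[m]_(x in D) (c x * f x * g x).
Proof.
move=> mc cM sfn sf sgn sg cf cg.
have M0 x : D x -> 0 <= M by move=> /cM; exact: le_trans.
have bnd (u v : S -> R) : sq_integrable m D u -> sq_integrable m D v ->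
    `|\int[m]_(x in D) (c x * u x * v x)| <=
    M * Num.sqrt ((\int[m]_(x in D) (u x ^+ 2)) * \int[m]_(x in D) (v x ^+ 2)).
  move=> su sv.
  have [/eqP D0|/set0P[x0 /M0 Mge0]] := boolP (D == set0).
    have I0 (h : S -> R) : \int[m]_(x in D) h x = 0.
      by rewrite D0 Rintegral_set0.
    by rewrite !I0 mulr0 sqrtr0 mulr0 normr0.
  have scu := sq_integrableM_bounded mc cM su.
  have CS := Cauchy_Schwarz scu sv.
  rewrite -sqrtr_sqr (le_trans (ler_wsqrtr CS))//.
  rewrite -[M in leRHS]ger0_norm// -[`|M|]sqrtr_sqr -sqrtrM ?sqr_ge0//.
  apply: ler_wsqrtr; rewrite mulrA ler_wpM2r//.
    by apply: Rintegral_ge0 => x _; exact: sqr_ge0.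
  case: su scu => mu iu [_ icu].
  rewrite -RintZ//; apply: le_Rintegral => //; first exact: integrableRZ.
  move=> x Dx; rewrite exprMn ler_wpM2r ?sqr_ge0//.
  by rewrite -(real_normK (num_real (c x))) lerXn2r ?nnegrE ?cM.
have sdf n := sq_integrableB (sfn n) sf.
have sdg n := sq_integrableB (sgn n) sg.
apply/subr_cvg0.
have E n : \int[m]_(x in D) (c x * fn n x * gn n x) -
    \int[m]_(x in D) (c x * f x * g x) =
    \int[m]_(x in D) (c x * (fn n x - f x) * (gn n x - g x)) +
    \int[m]_(x in D) (c x * (fn n x - f x) * g x) +
    \int[m]_(x in D) (c x * f x * (gn n x - g x)).
  have Hi (u v : S -> R) : sq_integrable m D u -> sq_integrable m D v ->
      m.-integrable D (EFin \o (fun x => c x * u x * v x)).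
    by move=> su sv; exact: (sq_integrableM (sq_integrableM_bounded mc cM su) sv).
  rewrite -RintB ?Hi// -RintD ?Hi// -RintD ?Hi//; last first.
    by apply: integrableRD => //; exact: Hi.
  by apply: eq_Rintegral => x _; ring.
under eq_fun do rewrite E.
have Z (a b : nat -> R) (u v : nat -> S -> R) :
    (forall n, sq_integrable m D (u n)) -> (forall n, sq_integrable m D (v n)) ->
    (fun n => (\int[m]_(x in D) (u n x ^+ 2)) * \int[m]_(x in D) (v n x ^+ 2))
      @ \oo --> (0 : R) ->
    (fun n => \int[m]_(x in D) (c x * u n x * v n x)) @ \oo --> (0 : R).
  move=> su sv cuv; apply: norm_cvg0.
  have H : (fun n => M * Num.sqrt ((\int[m]_(x in D) (u n x ^+ 2)) *
      \int[m]_(x in D) (v n x ^+ 2))) @ \oo --> (0 : R).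
    rewrite -(mulr0 M); apply: cvgM; first exact: cvg_cst.
    rewrite -(@sqrtr0 R); apply: (cvg_comp _ _ cuv).
    exact: sqrt_continuous.
  apply: (squeeze_cvgr _ (cvg_cst 0) H).
  by apply: nearW => n; rewrite normr_ge0 bnd.
rewrite -[0]addr0 -[X in X + _]addr0.
apply: cvgD; first apply: cvgD.
- apply: Z => //; rewrite -(mulr0 0); exact: cvgM.
- apply: Z => //; rewrite -(mul0r (\int[m]_(x in D) (g x ^+ 2))).
  by apply: cvgM => //; exact: cvg_cst.
- apply: Z => //; rewrite -(mulr0 (\int[m]_(x in D) (f x ^+ 2))).
  by apply: cvgM => //; exact: cvg_cst.
Qed.

End square_integrable.

Section finite_measure_integrals.
Context d (S : measurableType d) (R : realType).
Variables (P : probability S R).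

Lemma integrable_bounded (M : R) (f : S -> R) : measurable_fun setT f ->
  (forall x, `|f x| <= M) -> P.-integrable setT (EFin \o f).
Proof.
move=> mf fM.
apply: (@integrable_le _ _ _ P setT measurableT f (fun=> M)) => //.
exact: finite_measure_integrable_cst.
Qed.

Lemma sq_integrable_bounded (M : R) (f : S -> R) : measurable_fun setT f ->
  (forall x, `|f x| <= M) -> sq_integrable P setT f.
Proof.
move=> mf fM; split => //; apply: (@integrable_bounded (M ^+ 2)).
  exact: measurable_funX.
by move=> x; rewrite normrX lerXn2r ?nnegrE// (le_trans _ (fM x)).
Qed.

Lemma sq_integrable_integrable (f : S -> R) : sq_integrable P setT f ->
  P.-integrable setT (EFin \o f).
Proof.
move=> sf; have s1 : sq_integrable P setT (fun=> 1 : R).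
  by apply: (@sq_integrable_bounded 1) => // x; rewrite normr1.
apply: (eq_integrable _ _ _ _ (sq_integrableM measurableT sf s1)) => //.
by move=> x _ /=; rewrite mulr1.
Qed.

Lemma Rint_cst (c : R) : \int[P]_x c = c.
Proof. by rewrite Rintegral_cst//= probability_setT mulr1. Qed.

End finite_measure_integrals.

(** * The normal law *)

Section normal_law.
Context {R : realType}.
Notation lebesgue := (@lebesgue_measure R).
Implicit Types (s x t : R) (f : R -> R).

(** The density is a Radon-Nikodym derivative, hence almost everywhere equal to
    the one for which the change of variables is known. *)
Lemma normal_change_of_variables s (f : R -> \bar R) : s != 0 ->
  (normal_prob 0 s).-integrable setT f ->
  (\int[normal_prob (0 : R) s]_x f x =
   \int[lebesgue]_x (f x * (normal_pdf 0 s x)%:E))%E.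
Proof.
move=> s0 fi; have mf := measurable_int _ fi.
rewrite -(Radon_Nikodym_change_of_variables (normal_prob_dominates 0 s))//=.
apply: ae_eq_integral => //.
- apply: emeasurable_funM => //; apply: (measurable_int lebesgue).
  by apply: Radon_Nikodym_integrable; exact: normal_prob_dominates.
- by apply: emeasurable_funM => //=; apply/measurable_EFinP; exact: measurable_normal_pdf.
- apply: ae_eqe_mul2l => /=.
  rewrite Radon_NikodymE//=; first exact: normal_prob_dominates.
  move=> abmu.
  case: cid => /= h [h1 h2 h3].
  apply: integral_ae_eq => //=.
  + by apply/measurable_EFinP; exact: measurable_normal_pdf.
  + by move=> E _ mE; rewrite -h3.
Qed.

(** Truncating f at n makes it integrable; monotone convergence does the rest. *)
Lemma ge0_normal_change_of_variables s f : s != 0 ->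
  measurable_fun setT f -> (forall x, 0 <= f x) ->
  (\int[normal_prob (0 : R) s]_x (f x)%:E =
   \int[lebesgue]_x (f x * normal_pdf 0 s x)%:E)%E.
Proof.
move=> s0 mf f0.
pose g (n : nat) x := Num.min (f x) n%:R.
have mg n : measurable_fun setT (g n) by exact: measurable_minr.
have g0 n x : 0 <= g n x by rewrite le_min f0 /=.
have gi n : (normal_prob 0 s).-integrable setT (EFin \o g n).
  apply: (@integrable_bounded _ _ _ (normal_prob 0 s) n%:R) => [|x].
    exact: mg.
  by rewrite ger0_norm// ge_min lexx orbT.
have ndg x : {homo g ^~ x : n m / (n <= m)%N >-> n <= m}.
  by move=> n m nm; rewrite /g le_min ge_min lexx /= ge_min ler_nat nm orbT.
have gf x : g n x @[n --> \oo] --> f x.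
  apply: (@cvg_near_cst _ _ _ _ _); near=> n; apply/min_idPl.
  by near: n; exact: nbhs_infty_ger.
have pdf0 x := normal_pdf_ge0 0 s x.
transitivity (limn (fun n => \int[normal_prob (0 : R) s]_x (g n x)%:E))%E.
  rewrite -monotone_convergence//=.
  - apply: eq_integral => x _; apply/esym/cvg_lim => //.
    by apply: cvg_EFin; [exact: nearW|exact: gf].
  - by move=> n; apply/measurable_EFinP; exact: mg.
  - by move=> n x _; rewrite lee_fin.
  - by move=> x _ n m nm; rewrite lee_fin; exact: ndg.
transitivity (limn (fun n => \int[lebesgue]_x (g n x * normal_pdf 0 s x)%:E))%E.
  congr (limn _); apply/funext => n.
  by rewrite (normal_change_of_variables s0 (gi n)).
rewrite -monotone_convergence//=.
- apply: eq_integral => x _; apply/cvg_lim => //.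
  apply: cvg_EFin; first exact: nearW.
  by apply: cvgM; [exact: gf|exact: cvg_cst].
- move=> n; apply/measurable_EFinP; apply: measurable_funM; first exact: mg.
  exact: measurable_normal_pdf.
- by move=> n x _; rewrite lee_fin mulr_ge0.
- by move=> x _ n m nm; rewrite lee_fin ler_wpM2r//; exact: ndg.
Unshelve. all: end_near. Qed.

Lemma integrable_normalP s f : s != 0 -> measurable_fun setT f ->
  lebesgue.-integrable setT (EFin \o (fun x => f x * normal_pdf 0 s x)) ->
  (normal_prob 0 s).-integrable setT (EFin \o f).
Proof.
move=> s0 mf /integrableP[_ fi]; apply/integrableP; split.
  exact/measurable_EFinP.
rewrite /= (ge0_normal_change_of_variables s0 (f := fun x => `|f x|))//; last first.
  exact: measurableT_comp.
apply: le_lt_trans fi; apply: ge0_le_integral => //=.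
- by move=> x _; rewrite lee_fin mulr_ge0 ?normal_pdf_ge0.
- apply/measurable_EFinP/measurable_funM; first exact: measurableT_comp.
  exact: measurable_normal_pdf.
- apply/measurable_EFinP/measurableT_comp => //; apply/measurable_funM => //.
  exact: measurable_normal_pdf.
- by move=> x _; rewrite lee_fin normrM [X in _ <= _ * X]ger0_norm ?normal_pdf_ge0.
Qed.

Lemma Rint_normal s f : s != 0 ->
  (normal_prob 0 s).-integrable setT (EFin \o f) ->
  \int[normal_prob (0 : R) s]_x f x = \int[lebesgue]_x (f x * normal_pdf 0 s x).
Proof.
by move=> s0 fi; congr fine; rewrite normal_change_of_variables.
Qed.

(** A normal density is one of twice the variance times a Gaussian factor. That
    factor absorbs polynomials, so that the moment bounds below follow from the
    total mass of a density being 1. *)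
Lemma normal_pdf_sqrt2 (m s x : R) : 0 < s ->
  normal_pdf m s x = Num.sqrt 2 * normal_pdf m (Num.sqrt 2 * s) x *
    expR (- ((x - m) / (2 * s)) ^+ 2).
Proof.
move=> s0; have s20 : Num.sqrt 2 * s != 0 :> R.
  by rewrite mulf_neq0 ?gt_eqF// sqrtr_gt0.
rewrite !normal_pdfE ?gt_eqF// /normal_peak /normal_fun.
rewrite exprMn sqr_sqrtr//.
rewrite (_ : 2 * s ^+ 2 * pi *+ 2 = 2 * (s ^+ 2 * pi *+ 2)); last by ring.
rewrite sqrtrM// invfM !mulrA divff ?mul1r; last by rewrite gt_eqF// sqrtr_gt0.
rewrite -mulrA -expRD; congr (_ * expR _).
  by field; rewrite gt_eqF.
by rewrite mulr_gt0// sqrtr_gt0.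
Qed.

Lemma le_expR_sqr (u : R) : `|u| <= expR (u ^+ 2).
Proof.
rewrite (le_trans _ (expR_ge1Dx _))// -(real_normK (num_real u)).
have := sqr_ge0 (`|u| - 1); have := normr_ge0 u; nra.
Qed.

Lemma sqr_le_expR_sqr (u : R) : u ^+ 2 <= expR (u ^+ 2).
Proof. by rewrite (le_trans _ (expR_ge1Dx _))// lerDr. Qed.

Lemma le_normal_pdf1 (m s x : R) : 0 < s ->
  `|x - m| * normal_pdf m s x <=
  (2 * s * Num.sqrt 2) * normal_pdf m (Num.sqrt 2 * s) x.
Proof.
move=> s0; rewrite normal_pdf_sqrt2//.
have h : `|x - m| * expR (- ((x - m) / (2 * s)) ^+ 2) <= 2 * s.
  rewrite expRN ler_pdivrMr ?expR_gt0// mulrC -ler_pdivrMr ?mulr_gt0//.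
  by rewrite (le_trans _ (le_expR_sqr _))// normrM normfV (gtr0_norm (_ : 0 < 2 * s)) ?mulr_gt0.
set a := `|_| in h *; set e := expR _ in h *.
set p := normal_pdf _ _ _.
rewrite (_ : a * _ = (Num.sqrt 2 * p) * (a * e)); last by ring.
rewrite (_ : 2 * s * _ * p = (Num.sqrt 2 * p) * (2 * s)); last by ring.
by rewrite ler_wpM2l// mulr_ge0 ?sqrtr_ge0 ?normal_pdf_ge0.
Qed.

Lemma le_normal_pdf2 (s x : R) : 0 < s ->
  x ^+ 2 * normal_pdf 0 s x <=
  (4 * s ^+ 2 * Num.sqrt 2) * normal_pdf 0 (Num.sqrt 2 * s) x.
Proof.
move=> s0; rewrite normal_pdf_sqrt2// subr0.
have h : x ^+ 2 * expR (- (x / (2 * s)) ^+ 2) <= 4 * s ^+ 2.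
  rewrite expRN ler_pdivrMr ?expR_gt0// mulrC -ler_pdivrMr ?mulr_gt0 ?exprn_gt0//.
  rewrite (le_trans _ (sqr_le_expR_sqr _))// expr_div_n.
  by rewrite (_ : (2 * s) ^+ 2 = 4 * s ^+ 2)//; ring.
set a := _ ^+ 2 in h *; set e := expR _ in h *.
set p := normal_pdf _ _ _.
rewrite (_ : a * _ = (Num.sqrt 2 * p) * (a * e)); last by ring.
rewrite (_ : 4 * _ * _ * p = (Num.sqrt 2 * p) * (4 * s ^+ 2)); last by ring.
by rewrite ler_wpM2l// mulr_ge0 ?sqrtr_ge0 ?normal_pdf_ge0.
Qed.

Lemma sq_integrable_normal s : 0 < s ->
  sq_integrable (normal_prob (0 : R) s) setT (fun x : R => x).
Proof.
move=> s0; split => //; apply: integrable_normalP.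
- by rewrite gt_eqF.
- exact: measurable_funX.
apply: (@integrable_le _ _ _ lebesgue setT _ _ (fun x =>
  (4 * s ^+ 2 * Num.sqrt 2) * normal_pdf 0 (Num.sqrt 2 * s) x)) => //.
- apply: measurable_funM; first exact: measurable_funX.
  exact: measurable_normal_pdf.
- apply: integrableRZ => //; exact: integrable_normal_pdf.
- by move=> x _; rewrite ger0_norm ?le_normal_pdf2// mulr_ge0 ?sqr_ge0 ?normal_pdf_ge0.
Qed.

End normal_law.

Section normal_stein.
Context {R : realType}.
Notation lebesgue := (@lebesgue_measure R).
Implicit Types (s x t : R) (F dF : R -> R).

Let is_derive_comp (f g : R -> R) x a b : is_derive (g x) 1 f a ->
  is_derive x 1 g b -> is_derive x 1 (fun y => f (g y)) (a * b).
Proof. exact: is_derive1_comp. Qed.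

Let is_derive_mul (f g : R -> R) x a b : is_derive x 1 f a ->
  is_derive x 1 g b -> is_derive x 1 (fun y => f y * g y) (a * g x + f x * b).
Proof.
move=> hf hg; apply: is_derive_eq (is_deriveM hf hg) _.
by rewrite /GRing.scale /=; ring.
Qed.

Lemma is_derive_normal_pdf s x : s != 0 ->
  is_derive x 1 (normal_pdf 0 s) (- (x / s ^+ 2) * normal_pdf 0 s x).
Proof.
move=> s0; rewrite normal_pdfE//.
have h : is_derive x 1 (fun y : R => - (y - 0) ^+ 2 / (s ^+ 2 *+ 2)) (- (x / s ^+ 2)).
  apply: is_derive_eq; rewrite /GRing.scale /=; field.
  exact: s0.
have := is_derive_comp (g := fun y : R => - (y - 0) ^+ 2 / (s ^+ 2 *+ 2)) (is_derive_expR _) h.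
move=> /(is_derive_mul (is_derive_cst (normal_peak s) x 1)) hm.
by apply: is_derive_eq hm _; rewrite /normal_fun /=; ring.
Qed.

Lemma is_derive_continuous F dF : (forall x, is_derive x 1 F (dF x)) -> continuous F.
Proof.
move=> dF' x; apply: differentiable_continuous; apply/derivable1_diffP.
by have [] := dF' x.
Qed.

Section stein_identity.
Variables (s C : R) (F dF : R -> R).
Hypotheses (s0 : 0 < s) (F' : forall x, is_derive x 1 F (dF x)).
Hypotheses (cdF : continuous dF) (FC : forall x, `|F x| <= C * (1 + `|x|)).
Hypothesis dFC : forall x, `|dF x| <= C.

Let sn0 : s != 0. Proof. by rewrite gt_eqF. Qed.
Let p := normal_pdf 0 s.
Let N : probability _ R := normal_prob 0 s.

Let mF : measurable_fun setT F.
Proof. exact: continuous_measurable_fun (is_derive_continuous F'). Qed.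

Let mdF : measurable_fun setT dF.
Proof. exact: continuous_measurable_fun. Qed.

Let sqF : sq_integrable N setT F.
Proof.
have sq1 : sq_integrable N setT (fun=> 1 : R).
  by apply: (@sq_integrable_bounded _ _ _ N 1) => // x; rewrite normr1.
have [_ xi] := sq_integrable_normal s0.
split; first exact: mF.
apply: (@integrable_le _ _ _ N setT measurableT _
  (fun x => C ^+ 2 * (2 * (1 ^+ 2 + x ^+ 2)))) => //.
- exact: measurable_funX.
- apply: integrableRZ => //; apply: integrableRZ => //.
  by apply: integrableRD => //; case: sq1.
- move=> x _; rewrite normrX.
  apply: (@le_trans _ _ ((C * (1 + `|x|)) ^+ 2)).
    by rewrite lerXn2r ?nnegrE// (le_trans _ (FC x)).
  rewrite exprMn ler_wpM2l ?sqr_ge0// -(real_normK (num_real x)).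
  have := sqr_ge0 (1 - `|x|); nra.
Qed.

Lemma integrable_stein :
  (normal_prob 0 s).-integrable setT (EFin \o (fun x => x * F x)).
Proof. exact: (@sq_integrableM _ _ _ N setT measurableT (fun x => x) F (sq_integrable_normal s0) sqF). Qed.

Let idF : N.-integrable setT (EFin \o dF).
Proof. exact: (@integrable_bounded _ _ _ N C dF mdF dFC). Qed.

Let C0 : 0 <= C. Proof. exact: le_trans (dFC 0). Qed.

(* the derivative of F * p *)
Let g x := dF x * p x - (s ^- 2) * ((x * F x) * p x).

Let Fp' x : is_derive x 1 (F \* p) (g x).
Proof.
apply: is_derive_eq (is_derive_mul (F' x) (is_derive_normal_pdf x sn0)) _.
by rewrite /g -/p; field.
Qed.

Let cg : continuous g.
Proof.
have cp : continuous p by exact: continuous_normal_pdf.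
have cF := is_derive_continuous F'.
move=> x; apply: cvgB; first by apply: cvgM; [exact: cdF|exact: cp].
apply: cvgM; first exact: cvg_cst.
by apply: cvgM; [apply: cvgM; [exact: cvg_id|exact: cF]|exact: cp].
Qed.

Let boundary x : 1 <= `|x| -> `|F x * p x| <= C * (2 * (4 * s ^+ 2 * Num.sqrt 2 *
  normal_peak (Num.sqrt 2 * s))) / `|x|.
Proof.
move=> x1; have x0 : 0 < `|x| by exact: lt_le_trans x1.
rewrite normrM (ger0_norm (normal_pdf_ge0 _ _ _)) ler_pdivlMr//.
apply: (@le_trans _ _ (C * (1 + `|x|) * p x * `|x|)).
  by rewrite ler_wpM2r// ler_wpM2r ?normal_pdf_ge0.
have p0 : 0 <= p x by exact: normal_pdf_ge0.
have h1 : (1 + `|x|) * p x * `|x| <= 2 * (x ^+ 2 * p x).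
  rewrite -(real_normK (num_real x)) [leRHS]mulrA mulrAC ler_wpM2r//.
  by rewrite expr2; nra.
rewrite (_ : _ * p x * `|x| = C * ((1 + `|x|) * p x * `|x|)); last by ring.
rewrite ler_wpM2l// (le_trans h1)// ler_wpM2l//.
rewrite (le_trans (le_normal_pdf2 _ s0))// ler_wpM2l//.
  by rewrite mulr_ge0 ?sqrtr_ge0// mulr_ge0 ?sqr_ge0.
by rewrite normal_pdf_ub// mulf_neq0// gt_eqF// sqrtr_gt0.
Qed.

Let ig : lebesgue.-integrable setT (EFin \o g).
Proof.
have ip : lebesgue.-integrable setT (EFin \o p) by exact: integrable_normal_pdf.
have mp : measurable_fun setT p by exact: measurable_normal_pdf.
apply: integrableRB => //.
  by apply: (@integrableRM_bounded _ _ _ lebesgue setT _ C).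
apply: integrableRZ => //.
pose q x := normal_pdf 0 (Num.sqrt 2 * s) x.
have iq : lebesgue.-integrable setT (EFin \o q) by exact: integrable_normal_pdf.
apply: (@integrable_le _ _ _ lebesgue setT _ _ (fun x =>
   C * (p x + (2 * (4 * s ^+ 2 * Num.sqrt 2)) * q x))) => //.
- by apply: measurable_funM => //; exact: measurable_funM.
- apply: integrableRZ => //; apply: integrableRD => //; exact: integrableRZ.
move=> x _; rewrite !normrM (ger0_norm (normal_pdf_ge0 _ _ _)).
have := le_normal_pdf2 x s0; have := normal_pdf_ge0 0 s x; rewrite -/p -/(q x) => p0 xp.
apply: (@le_trans _ _ (`|x| * (C * (1 + `|x|)) * p x)).
  by rewrite ler_wpM2r// ler_wpM2l.
rewrite (_ : `|x| * (C * _) * _ = C * (`|x| * (1 + `|x|) * p x)); last by ring.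
rewrite ler_wpM2l// (@le_trans _ _ (p x + 2 * (x ^+ 2 * p x)))//; last first.
  by rewrite lerD2l -mulrA ler_wpM2l.
rewrite (_ : p x + _ = (1 + 2 * x ^+ 2) * p x); last by ring.
rewrite ler_wpM2r// -(real_normK (num_real x)).
have := sqr_ge0 (1 - `|x|); have := normr_ge0 x; nra.
Qed.

Let int_g0 : \int[lebesgue]_x g x = 0.
Proof.
pose I n : set R := `[(- n.+1%:R : R), n.+1%:R]%classic.
have mg : measurable_fun setT g by exact: continuous_measurable_fun.
have d1 n : measurable_fun setT (fun x => g x * \1_(I n) x).
  by apply: measurable_funM => //; apply: measurable_indic; exact: measurable_itv.
have d2 : lebesgue.-integrable setT (EFin \o (fun x => `|g x|)).
  exact: integrableR_abs.
have d3 n x : setT x -> `|g x * \1_(I n) x| <= `|g x|.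
  move=> _; rewrite normrM ler_piMr// ger0_norm ?indicE//.
  by case: (_ \in _).
have d4 : {ae lebesgue, forall x, setT x -> g x * \1_(I n) x @[n --> \oo] --> g x}.
  apply: aeW => x _; apply: cvg_near_cst; near=> n.
  rewrite indicE mem_set ?mulr1// /I /= in_itv /= -ler_norml.
  have : `|x| <= n%:R by near: n; exact: nbhs_infty_ger.
  by move=> /le_trans; apply; rewrite ler_nat.
have [_ cv] := @Rint_dominated _ _ _ lebesgue setT measurableT _ _ _ d1 mg d2 d3 d4.
apply/esym; apply: (cvg_unique _ _ cv) => //.
have E n : \int[lebesgue]_x (g x * \1_(I n) x) =
    (F n.+1%:R * p n.+1%:R) - (F (- n.+1%:R) * p (- n.+1%:R)).
  transitivity (\int[lebesgue]_(x in I n) g x).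
    rewrite [RHS]Rintegral_mkcond; apply: eq_Rintegral => x _.
    rewrite patchE indicE; case: ifPn => //; first by rewrite mulr1.
    by rewrite mulr0.
  rewrite /Rintegral (@continuous_FTC2 _ g (F \* p))//.
  - by rewrite -subr_gt0 opprK addr_gt0.
  - exact: continuous_subspaceT.
  - have cFp := is_derive_continuous Fp'.
    split; last 2 first.
    + exact/cvg_at_right_filter/cFp.
    + exact/cvg_at_left_filter/cFp.
    + by move=> x _; have [] := Fp' x.
  - by move=> x _; rewrite derive1E; have [_ ->] := Fp' x.
rewrite /=; under eq_fun do rewrite E.
pose K := C * (2 * (4 * s ^+ 2 * Num.sqrt 2 * normal_peak (Num.sqrt 2 * s))).
have Kcv : (fun n : nat => K / n.+1%:R) @ \oo --> (0 : R).
  rewrite -(mulr0 K); apply: cvgM; first exact: cvg_cst.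
  exact: cvg_harmonic.
rewrite -[0]subr0; apply: cvgB; apply: norm_cvg0;
  apply: (squeeze_cvgr _ (cvg_cst 0) Kcv); apply: nearW => n;
  rewrite normr_ge0/=.
- by have := @boundary n.+1%:R; rewrite ger0_norm//; apply; rewrite ler1n.
- by have := @boundary (- n.+1%:R); rewrite normrN ger0_norm//; apply; rewrite ler1n.
Unshelve. all: end_near. Qed.

(** Since x p(x) = - s^2 p'(x) for the density p, this is integration by parts on
    [-n, n]; the boundary terms are O(1/n) because x^2 p(x) is bounded. *)
Lemma stein_normal : \int[normal_prob (0 : R) s]_x (x * F x) =
  s ^+ 2 * \int[normal_prob (0 : R) s]_x dF x.
Proof.
have xFi := integrable_stein.
rewrite !Rint_normal// -/p; apply/eqP; rewrite -subr_eq0 -opprB oppr_eq0; apply/eqP.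
have i1 : lebesgue.-integrable setT (EFin \o (fun x => dF x * p x)).
  by apply: (@integrableRM_bounded _ _ _ lebesgue setT _ C) => //; exact: integrable_normal_pdf.
have i2 : lebesgue.-integrable setT (EFin \o (fun x => x * F x * p x)).
  have := integrableRZ measurableT (s ^+ 2) (integrableRB measurableT i1 ig).
  by apply: eq_integrable => // x _ /=; congr EFin; rewrite /g; field.
rewrite -[RHS](mulr0 (s ^+ 2)) -int_g0 /g RintB//; last exact: integrableRZ.
by rewrite RintZ//; field.
Qed.

End stein_identity.

Lemma variance_normal s : 0 < s ->
  \int[normal_prob (0 : R) s]_x (x ^+ 2) = s ^+ 2.
Proof.
move=> s0; transitivity (\int[normal_prob (0 : R) s]_x (x * x)).
  by apply: eq_Rintegral => x _; rewrite expr2.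
rewrite (@stein_normal s 1 (fun x => x) (fun=> 1))//.
- by rewrite Rint_cst mulr1.
- by move=> x; exact: cvg_cst.
- by move=> x; rewrite mul1r lerDr.
- by move=> x; rewrite normr1.
Qed.

(** The quotient of y by the Gaussian has derivative 0. *)
Lemma linear_ode s (y : R -> R) :
  (forall t, is_derive t 1 y (- (s ^+ 2 * t) * y t)) ->
  forall t, y t = y 0 * expR (- (s ^+ 2 * t ^+ 2 / 2)).
Proof.
move=> y' t; pose z t := y t * expR (s ^+ 2 * t ^+ 2 / 2).
have z' (u : R) : is_derive u 1 z 0.
  have h : is_derive u 1 (fun t => s ^+ 2 * t ^+ 2 / 2) (s ^+ 2 * u).
    by apply: is_derive_eq; rewrite /GRing.scale /=; field.
  have he := is_derive_comp (g := fun t => s ^+ 2 * t ^+ 2 / 2) (is_derive_expR _) h.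
  by apply: is_derive_eq (is_derive_mul (y' u) he) _; ring.
have := is_derive_0_is_cst t 0 z'; rewrite /z expr0n /= mulr0 mul0r expR0 mulr1 => <-.
by rewrite -mulrA -expRD subrr expR0 mulr1.
Qed.

(** Differentiating in t under the integral sign brings out a factor x, which
    Stein's identity turns into - s^2 t times the transform itself: a linear
    differential equation. Cosine and sine are treated together as a pair of
    functions with tr'' = - tr. *)
Lemma normal_fourier s (tr dtr : R -> R) : 0 < s ->
  (forall x, is_derive x 1 tr (dtr x)) -> (forall x, is_derive x 1 dtr (- tr x)) ->
  (forall x, `|tr x| <= 1) -> (forall x, `|dtr x| <= 1) ->
  forall t, \int[normal_prob (0 : R) s]_x tr (t * x) =
    tr 0 * expR (- (s ^+ 2 * t ^+ 2 / 2)).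
Proof.
move=> s0 tr' dtr' tr1 dtr1.
have ctr := is_derive_continuous tr'; have cdtr := is_derive_continuous dtr'.
have mtr : measurable_fun setT tr by exact: continuous_measurable_fun.
have mdtr : measurable_fun setT dtr by exact: continuous_measurable_fun.
pose N : probability _ R := normal_prob 0 s.
pose y t := \int[N]_x tr (t * x).
have mul' (t x : R) : is_derive x 1 (fun x => t * x) t.
  by apply: is_derive_eq; rewrite /GRing.scale /=; ring.
have mul'' (t x : R) : is_derive t 1 (fun t => t * x) x.
  by apply: is_derive_eq; rewrite /GRing.scale /=; ring.
have mt (f : R -> R) t : measurable_fun setT f -> measurable_fun setT (fun x => f (t * x)).
  by move=> mf; apply: measurableT_comp => //; exact: mulrl_measurable.
have d1E t x : partial1of2 (fun t x => tr (t * x)) t x = x * dtr (t * x).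
  rewrite /partial1of2 derive1E.
  by have [_ ->] := is_derive_comp (g := fun t => t * x) (tr' (t * x)) (mul'' t x); rewrite mulrC.
have y' t : is_derive t 1 y (- (s ^+ 2 * t) * y t).
  have Hd : 'D_1 y t = - (s ^+ 2 * t) * y t /\ derivable y t 1.
    have I0 : `]t - 1, t + 1[%classic t.
      by rewrite /= in_itv /= ltrDl ltr01 ltrBlDr ltrDl ltr01.
    have I1 x : `]t - 1, t + 1[%classic x -> N.-integrable setT (EFin \o (fun z => tr (x * z))).
      by move=> _; apply: (@integrable_bounded _ _ _ N 1) => //; exact: mt.
    have I2 : forall x z, `]t - 1, t + 1[%classic x -> setT z -> derivable (fun x => tr (x * z)) x 1.
      by move=> x z _ _; have [] := is_derive_comp (g := fun t => t * z) (tr' (x * z)) (mul'' x z).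
    have I3 : N.-integrable setT (EFin \o (fun z => `|z|)).
      apply: integrableR_abs => //; apply: sq_integrable_integrable.
      exact: sq_integrable_normal.
    have I4 : forall x z, `]t - 1, t + 1[%classic x -> setT z ->
        `|partial1of2 (fun t x => tr (t * x)) x z| <= `|z|.
      by move=> x z _ _; rewrite d1E normrM ler_piMr.
    split; last first.
      exact: (@derivable_under_integral _ _ _ N _ _ measurableT t (t-1) (t+1) I0 I1 I2 (fun z => `|z|)).
    rewrite -derive1E (@differentiation_under_integral _ _ _ N _ _ measurableT t (t-1) (t+1) I0 I1 I2 (fun z => `|z|))//.
    under eq_Rintegral do rewrite d1E.
    have h1 x : is_derive x 1 (fun x => dtr (t * x)) (t * - tr (t * x)).
      rewrite mulrC; exact: (is_derive_comp (g := fun x => t * x) (dtr' _) (mul' t x)).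
    have h2 : continuous (fun x => t * - tr (t * x)).
      move=> x; apply: cvgM; first exact: cvg_cst.
      apply: cvgN; apply: (cvg_comp (fun x => t * x)); last exact: ctr.
      by apply: cvgM; [exact: cvg_cst|exact: cvg_id].
    have h3 x : `|dtr (t * x)| <= (1 + `|t|) * (1 + `|x|).
      rewrite (le_trans (dtr1 _))//.
      by have := normr_ge0 t; have := normr_ge0 x; nra.
    have h4 x : `|t * - tr (t * x)| <= 1 + `|t|.
      by rewrite normrM normrN (@le_trans _ _ `|t|) ?ler_piMr// lerDr.
    rewrite (stein_normal s0 h1 h2 h3 h4).
    transitivity (s ^+ 2 * \int[N]_x (- t * tr (t * x))).
      by congr (_ * _); apply: eq_Rintegral => x _; rewrite mulrN mulNr.
    by rewrite RintZ//; [rewrite /y; ring|exact: (I1 t)].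
  by split; [exact: Hd.2|exact: Hd.1].
move=> t; have := linear_ode y' t; rewrite /y => ->; congr (_ * _).
by under eq_Rintegral do rewrite mul0r; rewrite Rint_cst.
Qed.

Lemma normal_cos s t : 0 < s ->
  \int[normal_prob (0 : R) s]_x cos (t * x) = expR (- (s ^+ 2 * t ^+ 2 / 2)).
Proof.
move=> s0; rewrite (@normal_fourier s cos (fun x => - sin x))// ?cos0 ?mul1r//.
- by move=> x; exact: cos_max.
- by move=> x; rewrite normrN sin_max.
Qed.

Lemma normal_sin s t : 0 < s -> \int[normal_prob (0 : R) s]_x sin (t * x) = 0.
Proof.
move=> s0; rewrite (@normal_fourier s sin cos)// ?sin0 ?mul0r//.
- by move=> x; exact: sin_max.
- by move=> x; exact: cos_max.
Qed.

End normal_stein.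

(** * Fubini for real-valued integrals *)

Section real_fubini.
Context d1 d2 (T1 : measurableType d1) (T2 : measurableType d2) (R : realType).
Variables (m1 : {sigma_finite_measure set T1 -> \bar R}).
Variables (m2 : {sigma_finite_measure set T2 -> \bar R}).
Variable f : T1 * T2 -> R.
Hypothesis fi : (m1 \x m2)%E.-integrable setT (EFin \o f).

Let finite_section1 :
  {ae m1, forall x, setT x -> (\int[m2]_y (f (x, y))%:E)%E = (\int[m2]_y f (x, y))%:E}.
Proof.
apply: filterS (ae_integrable1 fi) => x ix _.
by rewrite EFin_Rint.
Qed.

Let finite_section2 :
  {ae m2, forall y, setT y -> (\int[m1]_x (f (x, y))%:E)%E = (\int[m1]_x f (x, y))%:E}.
Proof.
apply: filterS (ae_integrable2 fi) => x ix _.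
by rewrite EFin_Rint.
Qed.

Lemma measurable_Rint1 : measurable_fun setT (fun x => \int[m2]_y f (x, y)).
Proof. exact: measurableT_comp (measurable_fubini_F fi). Qed.

Lemma measurable_Rint2 : measurable_fun setT (fun y => \int[m1]_x f (x, y)).
Proof. exact: measurableT_comp (measurable_fubini_G fi). Qed.

Lemma integrable_Rint1 : m1.-integrable setT (EFin \o (fun x => \int[m2]_y f (x, y))).
Proof.
have mf := measurable_Rint1; apply/integrableP; split; first exact/measurable_EFinP.
have /integrableP[mF] := integrable_fubini_F fi; apply: le_lt_trans.
rewrite le_eqVlt; apply/orP; left; apply/eqP/ae_eq_integral => //.
- by apply: measurableT_comp => //; exact/measurable_EFinP.
- exact: measurableT_comp.
- by apply: filterS finite_section1 => x /= fx _; rewrite /fubini_F fx.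
Qed.

Lemma integrable_Rint2 : m2.-integrable setT (EFin \o (fun y => \int[m1]_x f (x, y))).
Proof.
have mf := measurable_Rint2; apply/integrableP; split; first exact/measurable_EFinP.
have : m2.-integrable setT (fubini_G m1 (EFin \o f)).
  apply/integrableP; split; first exact: (measurable_fubini_G fi).
  have /(integrable21ltyP _ _ (measurable_int _ fi)) := fi; apply: le_lt_trans.
  apply: ge0_le_integral => //.
  - by apply: measurableT_comp => //; exact: (measurable_fubini_G fi).
  - apply: (measurable_fun_fubini_tonelli_G (abse \o (EFin \o f))) => [|z]; last exact: abse_ge0.
    by apply: measurableT_comp => //; exact: measurable_int fi.
  - move=> y _; apply: le_abse_integral => //.
    apply: (measurableT_comp (measurable_int _ fi)).
    exact: measurable_pair2.
move=> /integrableP[mF]; apply: le_lt_trans.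
rewrite le_eqVlt; apply/orP; left; apply/eqP/ae_eq_integral => //.
- by apply: measurableT_comp => //; exact/measurable_EFinP.
- exact: measurableT_comp.
- by apply: filterS finite_section2 => x /= fx _; rewrite /fubini_G fx.
Qed.

Lemma Rint_prod1 : \int[m1]_x \int[m2]_y f (x, y) = \int[(m1 \x m2)%E]_z f z.
Proof.
rewrite /Rintegral -integral12_prod_meas1//; congr fine.
apply: ae_eq_integral => //.
- exact/measurable_EFinP/measurable_Rint1.
- exact: (measurable_fubini_F fi).
- by apply: filterS finite_section1 => x fx _; rewrite /= -/(Rintegral _ _ _) -fx.
Qed.

Lemma Rint_prod2 : \int[m2]_y \int[m1]_x f (x, y) = \int[(m1 \x m2)%E]_z f z.
Proof.
rewrite /Rintegral -integral21_prod_meas1//; congr fine.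
apply: ae_eq_integral => //.
- exact/measurable_EFinP/measurable_Rint2.
- exact: (measurable_fubini_G fi).
- by apply: filterS finite_section2 => x fx _; rewrite /= -/(Rintegral _ _ _) -fx.
Qed.

Lemma Rint_Fubini : \int[m1]_x \int[m2]_y f (x, y) = \int[m2]_y \int[m1]_x f (x, y).
Proof. by rewrite Rint_prod1 Rint_prod2. Qed.

End real_fubini.

Lemma integrable_prod_le d1 d2 (T1 : measurableType d1) (T2 : measurableType d2)
    (R : realType) (P : probability T1 R) (m : {sigma_finite_measure set T2 -> \bar R})
    (f : T1 * T2 -> R) (g : T2 -> R) :
  measurable_fun setT f -> m.-integrable setT (EFin \o g) ->
  (forall z, `|f z| <= g z.2) -> (P \x m)%E.-integrable setT (EFin \o f).
Proof.
move=> mf gi fg.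
apply/integrable12ltyP; first exact/measurable_EFinP.
have gi' : (\int[m]_y `|(g y)%:E| < +oo)%E by case/integrableP: gi.
apply: le_lt_trans gi'.
have -> : (\int[m]_y `|(g y)%:E| = \int[P]_x \int[m]_y `|(g y)%:E|)%E.
  by rewrite integral_cst//= probability_setT mule1.
apply: ge0_le_integral => //.
- by move=> x _; exact: integral_ge0.
- apply: (measurable_fun_fubini_tonelli_F (abse \o (EFin \o f))) => [|z]; last exact: abse_ge0.
  by apply: measurableT_comp => //; exact/measurable_EFinP.
- move=> x _; apply: ge0_le_integral => //.
  + apply: measurableT_comp => //; apply/measurable_EFinP.
    by apply: (measurableT_comp mf); exact: measurable_pair1.
  + by apply: measurableT_comp => //; exact: measurable_int gi.
  + by move=> y _; rewrite /= lee_fin (le_trans (fg (x, y)))// ler_norm.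
Qed.

(** * Fourier transforms determine weighted laws *)

Section gaussian_smoothing.
Context {R : realType}.
Notation lebesgue := (@lebesgue_measure R).

(** The normal density is a Fourier transform: averages of e^{it(y-u)} over a
    centered normal t of inverse variance. *)
Lemma normal_pdf_fourier (e u y : R) : 0 < e ->
  normal_pdf u e y =
  normal_peak e * \int[normal_prob (0 : R) e^-1]_t cos (t * (y - u)).
Proof.
move=> e0; under eq_Rintegral do rewrite mulrC.
rewrite normal_cos ?invr_gt0// normal_pdfE ?gt_eqF//; congr (_ * _).
by rewrite /normal_fun; congr expR; field; rewrite gt_eqF.
Qed.

Section smoothing_law.
Context d (Omega : measurableType d) (P : probability Omega R).
Variables (M : R) (C U : Omega -> R).
Hypotheses (mC : measurable_fun setT C) (mU : measurable_fun setT U).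
Hypothesis CM : forall w, `|C w| <= M.

(** The law of U weighted by C and smoothed by a normal law of deviation e has a
    density that depends on (C, U) through the weighted Fourier transform only. *)
Lemma fourier_smoothing (e y : R) : 0 < e ->
  \int[P]_w (C w * normal_pdf (U w) e y) =
  normal_peak e * \int[normal_prob (0 : R) e^-1]_t
    (cos (t * y) * (\int[P]_w (C w * cos (t * U w))) +
     sin (t * y) * (\int[P]_w (C w * sin (t * U w)))).
Proof.
move=> e0; pose N : probability _ R := normal_prob 0 e^-1.
pose f (z : Omega * R) := C z.1 * cos (z.2 * (y - U z.1)).
have mcos : measurable_fun setT (@cos R).
  by apply: continuous_measurable_fun; exact: continuous_cos.
have msin : measurable_fun setT (@sin R).
  by apply: continuous_measurable_fun; exact: continuous_sin.
have mf : measurable_fun setT f.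
  apply: measurable_funM; first exact: measurableT_comp.
  apply: measurableT_comp => //; apply: measurable_funM => //.
  by apply: measurable_funB => //; exact: measurableT_comp.
have fi : (P \x N)%E.-integrable setT (EFin \o f).
  apply: (@integrable_prod_le _ _ _ _ _ P N f (fun=> M)) => //.
  - apply: (@integrable_bounded _ _ _ N `|M|) => //.
  - by move=> z; rewrite normrM -[leRHS]mulr1 ler_pM// cos_max.
have Ci (t : R) (tr : R -> R) : measurable_fun setT tr -> (forall x, `|tr x| <= 1) ->
    P.-integrable setT (EFin \o (fun w => C w * tr (t * U w))).
  move=> mtr tr1; apply: (@integrable_bounded _ _ _ P M) => [|w].
    apply: measurable_funM => //; apply: measurableT_comp => //.
    exact: measurable_funM.
  by rewrite normrM -[leRHS]mulr1 ler_pM.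
have fiw w : N.-integrable setT (EFin \o (fun t => cos (t * (y - U w)))).
  apply: (@integrable_bounded _ _ _ N 1) => [|t]; last exact: cos_max.
  by apply: measurableT_comp => //; exact: measurable_funM.
transitivity (\int[P]_w (normal_peak e * \int[N]_t f (w, t))).
  apply: eq_Rintegral => w _; rewrite normal_pdf_fourier//.
  by rewrite /f /= RintZ// mulrCA.
rewrite RintZ//; last exact: (integrable_Rint1 fi).
congr (_ * _); rewrite (Rint_Fubini fi); apply: eq_Rintegral => t _.
rewrite -RintZ//; last by apply: Ci => // x; exact: cos_max.
rewrite -RintZ//; last by apply: Ci => // x; exact: sin_max.
rewrite -RintD//.
- by apply: eq_Rintegral => w _; rewrite /f /= mulrBr cosB; ring.
- by apply: integrableRZ => //; apply: Ci => // x; exact: cos_max.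
- by apply: integrableRZ => //; apply: Ci => // x; exact: sin_max.
Qed.

Variables (L B : R) (f : R -> R).
Hypotheses (fi : lebesgue.-integrable setT (EFin \o f)).
Hypothesis fL : forall x y, `|f x - f y| <= L * `|x - y|.
Hypothesis fB : forall x, `|f x| <= B.

Let L0 : 0 <= L.
Proof. by have := fL 1 0; rewrite subr0 normr1 mulr1; exact: le_trans. Qed.

Let mf : measurable_fun setT f. Proof. exact: integrable_meas fi. Qed.

Let fpdf_i (e u : R) : 0 < e ->
  lebesgue.-integrable setT (EFin \o (fun y => f y * normal_pdf u e y)).
Proof.
move=> e0; apply: (@integrableRM_bounded _ _ _ lebesgue setT _ B) => //.
exact: integrable_normal_pdf.
Qed.

(** The first absolute moment of the normal law is of order e, hence an error of
    order e, uniform in u, for a Lipschitz function. *)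
Lemma smoothing_error (e u : R) : 0 < e ->
  `|\int[lebesgue]_y (f y * normal_pdf u e y) - f u| <= L * (2 * e * Num.sqrt 2).
Proof.
move=> e0; have pi := @integrable_normal_pdf R u e.
have p'i := @integrable_normal_pdf R u (Num.sqrt 2 * e).
have I1 s : \int[lebesgue]_y normal_pdf u s y = 1.
  by rewrite /Rintegral integral_normal_pdf.
have -> : f u = \int[lebesgue]_y (f u * normal_pdf u e y).
  by rewrite RintZ// I1 mulr1.
have ci : lebesgue.-integrable setT (EFin \o (fun y => f u * normal_pdf u e y)).
  exact: integrableRZ.
rewrite -RintB//; last exact: fpdf_i.
have di := integrableRB measurableT (fpdf_i u e0) ci.
rewrite (le_trans (le_normr_Rintegral _ di))//.
apply: (@le_trans _ _ (\int[lebesgue]_y (L * (2 * e * Num.sqrt 2) *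
  normal_pdf u (Num.sqrt 2 * e) y))); last by rewrite RintZ// I1 mulr1.
apply: le_Rintegral => //; first exact: integrableR_abs.
  exact: integrableRZ.
move=> y _; rewrite -mulrBl normrM (ger0_norm (normal_pdf_ge0 _ _ _)).
apply: (@le_trans _ _ (L * (`|y - u| * normal_pdf u e y))).
  by rewrite mulrA ler_wpM2r ?normal_pdf_ge0.
by rewrite -[leRHS]mulrA ler_wpM2l// le_normal_pdf1.
Qed.

Lemma smoothing_Fubini (e : R) : 0 < e ->
  \int[P]_w (C w * \int[lebesgue]_y (f y * normal_pdf (U w) e y)) =
  \int[lebesgue]_y (f y * \int[P]_w (C w * normal_pdf (U w) e y)).
Proof.
move=> e0; pose h (z : Omega * R) := C z.1 * (f z.2 * normal_pdf (U z.1) e z.2).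
have mpdf : measurable_fun setT (fun z : Omega * R => normal_pdf (U z.1) e z.2).
  under eq_fun do rewrite normal_pdfE ?gt_eqF//.
  apply: measurable_funM => //; rewrite /normal_fun.
  apply: measurableT_comp => //; apply: measurable_funM => //.
  apply: measurableT_comp => //; apply: measurable_funX.
  by apply: measurable_funB => //; exact: measurableT_comp.
have mh : measurable_fun setT h.
  apply: measurable_funM; first exact: measurableT_comp.
  by apply: measurable_funM => //; exact: measurableT_comp.
have hi : (P \x lebesgue)%E.-integrable setT (EFin \o h).
  apply: (@integrable_prod_le _ _ _ _ _ P lebesgue h
    (fun y => (M * normal_peak e) * `|f y|)) => //.
    by apply: integrableRZ => //; exact: integrableR_abs.
  move=> z; rewrite /h !normrM (ger0_norm (normal_pdf_ge0 _ _ _)).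
  rewrite [leRHS]mulrAC -mulrA; apply: ler_pM => //.
    by rewrite mulr_ge0 ?normal_pdf_ge0.
  by rewrite ler_wpM2l// normal_pdf_ub// gt_eqF.
transitivity (\int[P]_w \int[lebesgue]_y h (w, y)).
  by apply: eq_Rintegral => w _; rewrite -RintZ//; exact: fpdf_i.
rewrite (Rint_Fubini hi); apply: eq_Rintegral => y _.
rewrite -RintZ//; first by apply: eq_Rintegral => w _; rewrite /h /=; ring.
apply: (@integrable_bounded _ _ _ P (M * normal_peak e)) => [|w].
  apply: measurable_funM => //.
  exact: (measurableT_comp mpdf (measurable_pair2 y)).
rewrite normrM ler_pM//.
by rewrite (ger0_norm (normal_pdf_ge0 _ _ _)) normal_pdf_ub// gt_eqF.
Qed.

Lemma smoothing_law_error (e : R) : 0 < e ->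
  `|\int[P]_w (C w * f (U w)) -
    \int[lebesgue]_y (f y * \int[P]_w (C w * normal_pdf (U w) e y))| <=
  M * (L * (2 * e * Num.sqrt 2)).
Proof.
move=> e0; rewrite -smoothing_Fubini//.
have i1 : P.-integrable setT (EFin \o (fun w => C w * f (U w))).
  apply: (@integrable_bounded _ _ _ P (M * B)) => [|w].
    by apply: measurable_funM => //; exact: measurableT_comp.
  by rewrite normrM ler_pM.
pose g u := \int[lebesgue]_y (f y * normal_pdf u e y).
have mg : measurable_fun setT (fun w => g (U w)).
  pose h (z : Omega * R) := f z.2 * normal_pdf (U z.1) e z.2.
  have mpdf : measurable_fun setT (fun z : Omega * R => normal_pdf (U z.1) e z.2).
    under eq_fun do rewrite normal_pdfE ?gt_eqF//.
    apply: measurable_funM => //; rewrite /normal_fun.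
    apply: measurableT_comp => //; apply: measurable_funM => //.
    apply: measurableT_comp => //; apply: measurable_funX.
    by apply: measurable_funB => //; exact: measurableT_comp.
  have hi : (P \x lebesgue)%E.-integrable setT (EFin \o h).
    apply: (@integrable_prod_le _ _ _ _ _ P lebesgue h
      (fun y => (normal_peak e) * `|f y|)) => //.
    - by apply: measurable_funM => //; exact: measurableT_comp.
    - by apply: integrableRZ => //; exact: integrableR_abs.
    - move=> z; rewrite /h !normrM (ger0_norm (normal_pdf_ge0 _ _ _)) mulrC.
      by rewrite ler_wpM2r// normal_pdf_ub// gt_eqF.
  exact: (measurable_Rint1 hi).
have i2 : P.-integrable setT (EFin \o (fun w => C w * g (U w))).
  apply: (@integrable_bounded _ _ _ P (M * (L * (2 * e * Num.sqrt 2) + B))) => [|w].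
    exact: measurable_funM.
  rewrite normrM ler_pM// -[g _](subrK (f (U w))) (le_trans (ler_normD _ _))//.
  by rewrite lerD// smoothing_error.
rewrite -RintB//; have i3 := integrableRB measurableT i1 i2.
rewrite (le_trans (le_normr_Rintegral _ i3))//.
rewrite -[leRHS](Rint_cst P); apply: le_Rintegral => //.
- exact: integrableR_abs.
- exact: finite_measure_integrable_cst.
- move=> w _; rewrite -mulrBr normrM distrC ler_pM//.
  exact: smoothing_error.
Qed.

End smoothing_law.

Section uniqueness.
Context d (Omega : measurableType d) (P : probability Omega R).
Context d' (Omega' : measurableType d') (P' : probability Omega' R).
Variables (M : R) (C U : Omega -> R) (C' U' : Omega' -> R).
Hypotheses (mC : measurable_fun setT C) (mU : measurable_fun setT U).
Hypotheses (mC' : measurable_fun setT C') (mU' : measurable_fun setT U').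
Hypotheses (CM : forall w, `|C w| <= M) (CM' : forall w, `|C' w| <= M).
Hypothesis eq_cos : forall t,
  \int[P]_w (C w * cos (t * U w)) = \int[P']_w (C' w * cos (t * U' w)).
Hypothesis eq_sin : forall t,
  \int[P]_w (C w * sin (t * U w)) = \int[P']_w (C' w * sin (t * U' w)).

(** Both sides are within O(e) of their smoothed versions, which agree. *)
Lemma fourier_unique_lipschitz (L B : R) (f : R -> R) :
  lebesgue.-integrable setT (EFin \o f) ->
  (forall x y, `|f x - f y| <= L * `|x - y|) -> (forall x, `|f x| <= B) ->
  \int[P]_w (C w * f (U w)) = \int[P']_w (C' w * f (U' w)).
Proof.
move=> fi fL fB.
set a := LHS; set b := RHS.
have M0 : 0 <= M by apply: le_trans (CM point).
have L0 : 0 <= L by have := fL 1 0; rewrite subr0 normr1 mulr1; exact: le_trans.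
have ab (e : R) : 0 < e -> `|a - b| <= (M * L * 4 * Num.sqrt 2) * e.
  move=> e0; have h1 := @smoothing_law_error _ _ P M C U mC mU CM L B f fi fL fB e e0.
  have h2 := @smoothing_law_error _ _ P' M C' U' mC' mU' CM' L B f fi fL fB e e0.
  rewrite distrC in h2.
  set s := \int[lebesgue]_y _ in h1; set s' := \int[lebesgue]_y _ in h2.
  have ss' : s = s'.
    apply: eq_Rintegral => y _; congr (_ * _).
    rewrite (@fourier_smoothing _ _ P M)// (@fourier_smoothing _ _ P' M)//.
    congr (_ * _); apply: eq_Rintegral => t _.
    by rewrite eq_cos eq_sin.
  rewrite -/a in h1; rewrite -/b -ss' in h2.
  rewrite (le_trans (ler_distD s _ _))//.
  by rewrite (le_trans (lerD h1 h2))// le_eqVlt; apply/orP; left; apply/eqP; ring.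
apply/eqP; rewrite -subr_eq0 -normr_le0; apply/ler_addgt0Pl => e e0.
rewrite addr0; set K := M * L * 4 * Num.sqrt 2 in ab.
have K0 : 0 <= K by rewrite /K !mulr_ge0 ?sqrtr_ge0.
have K1 : 0 < K + 1 by rewrite ltr_wpDl.
have := ab (e / (K + 1)) (divr_gt0 e0 K1) => /le_trans; apply.
rewrite mulrCA ler_piMr ?(ltW e0)// ler_pdivrMr// mul1r lerDl.
exact: ler01.
Qed.

End uniqueness.

End gaussian_smoothing.

Section interval_cells.
Context {R : realType}.
Notation lebesgue := (@lebesgue_measure R).
Implicit Types a b x y : R.

(** The indicator of [a, b[, in a form for which sums over adjacent cells telescope. *)
Definition cell a b x : R := (a <= x)%R%:R - (b <= x)%R%:R.

Lemma measurable_cell a b : measurable_fun setT (cell a b).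
Proof.
have h c : measurable_fun setT (fun x : R => (c <= x)%R%:R : R).
  rewrite (_ : (fun x => _) = \1_`[c, +oo[).
    by apply: measurable_indic; exact: measurable_itv.
  by apply/funext => x; rewrite indicE mem_setE in_itv/= andbT.
exact: measurable_funB.
Qed.

Lemma cell_bounded a b x : `|cell a b x| <= 1.
Proof.
rewrite /cell; case: (a <= x); case: (b <= x);
  by rewrite ?subrr ?subr0 ?sub0r ?normrN ?normr0 ?normr1.
Qed.

Let minr_lip x x' y y' : `|Num.min x x' - Num.min y y'| <= Num.max `|x - y| `|x' - y'|.
Proof.
have h (u v u' v' : R) : Num.min u u' <= Num.min v v' + Num.max `|u - v| `|u' - v'|.
  rewrite {2}/Num.min; case: ifPn => _.
    rewrite -lerBlDl; apply: (@le_trans _ _ `|u - v|); last by rewrite le_max lexx.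
    by apply: le_trans (ler_norm _); rewrite lerB// ge_min lexx.
  rewrite -lerBlDl; apply: (@le_trans _ _ `|u' - v'|); last by rewrite le_max lexx orbT.
  by apply: le_trans (ler_norm _); rewrite lerB// ge_min lexx orbT.
rewrite ler_norml lerNl opprB !lerBlDl h andbT.
by rewrite [X in Num.max X _]distrC [X in Num.max _ X]distrC h.
Qed.

(* Lipschitz approximations of the indicator of [a, b[: the slope at a lies outside
   the interval, the one at b inside, so that the limit is 1 at a and 0 at b *)
Let trapezoid a b (k : nat) x : R :=
  Num.max 0 (Num.min (Num.min 1 (k%:R * (x - a) + 1)) (k%:R * (b - x))).

Let trapezoid_lip a b k x y :
  `|trapezoid a b k x - trapezoid a b k y| <= k%:R * `|x - y|.
Proof.
have maxE (u : R) : Num.max 0 u = - Num.min 0 (- u) by rewrite oppr_min oppr0 opprK.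
rewrite /trapezoid !maxE -opprB opprK addrC -opprB opprK.
have D0 : 0 <= k%:R * `|x - y| by rewrite mulr_ge0.
rewrite (le_trans (minr_lip _ _ _ _))// ge_max subrr normr0 D0 /=.
rewrite opprK addrC distrC (le_trans (minr_lip _ _ _ _))// ge_max; apply/andP; split.
  rewrite (le_trans (minr_lip _ _ _ _))// ge_max subrr normr0 D0 /=.
  have -> : k%:R * (y - a) + 1 - (k%:R * (x - a) + 1) = k%:R * - (x - y) by ring.
  by rewrite normrM normrN ger0_norm.
have -> : k%:R * (b - y) - k%:R * (b - x) = k%:R * (x - y) by ring.
by rewrite normrM ger0_norm.
Qed.

Let trapezoid_bounded a b k x : `|trapezoid a b k x| <= 1.
Proof.
rewrite ger0_norm /trapezoid; last by rewrite le_max lexx.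
by rewrite ge_max ler01 !ge_min lexx.
Qed.

Let trapezoid_integrable a b k : (0 < k)%N ->
  lebesgue.-integrable setT (EFin \o trapezoid a b k).
Proof.
move=> k0.
have ct : continuous (trapezoid a b k).
  move=> x; apply/cvgrPdist_le => e e0; near=> y.
  rewrite (le_trans (trapezoid_lip _ _ _ _ _))// -ler_pdivlMl ?ltr0n//.
  near: y; apply: cvgr_dist_le; first exact: cvg_id.
  by rewrite mulr_gt0// invr_gt0 ltr0n.
apply: (@integrable_le _ _ _ lebesgue setT measurableT _ (\1_`[a - 1, b])) => //.
- exact: continuous_measurable_fun.
- exact: integrable_indic_itv.
move=> x _; rewrite indicE mem_setE in_itv/=.
have [/andP[_ _]|] := boolP ((a - 1 <= x) && (x <= b)); first exact: trapezoid_bounded.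
rewrite negb_and -!ltNge => xab; rewrite /= normr_le0 /trapezoid.
apply/eqP/max_idPl; rewrite !ge_min.
have k1 : (1 : R) <= k%:R by rewrite ler1n.
case/orP: xab => h; apply/orP; [left; apply/orP; right|right]; nra.
Unshelve. all: end_near. Qed.

Let trapezoid_cvg a b x : a < b -> trapezoid a b k x @[k --> \oo] --> cell a b x.
Proof.
move=> ab; apply: cvg_near_cst; rewrite /cell.
have [xa|ax] := ltP x a.
  rewrite leNgt (lt_trans xa ab) /= subrr; near=> k.
  apply/max_idPl; rewrite !ge_min; apply/orP; left; apply/orP; right.
  have h : 1 <= k%:R * (a - x).
    rewrite -ler_pdivrMr ?subr_gt0// mul1r.
    by near: k; exact: nbhs_infty_ger.
  by rewrite -(opprB a x) mulrN addrC subr_le0.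
have [xb|bx] := ltP x b; last first.
  rewrite /= subrr; near=> k.
  apply/max_idPl; rewrite !ge_min; apply/orP; right.
  by rewrite mulr_ge0_le0// subr_le0.
rewrite /= subr0; near=> k.
have h1 : 1 <= k%:R * (b - x).
  rewrite -ler_pdivrMr ?subr_gt0// mul1r.
  by near: k; exact: nbhs_infty_ger.
have h2 : 1 <= k%:R * (x - a) + 1 :> R by rewrite lerDr mulr_ge0// subr_ge0.
by rewrite /trapezoid (min_idPl h2) (min_idPl h1) (max_idPr _)// ler01.
Unshelve. all: end_near. Qed.

(** Intervals are all that is needed of the law of U: they discretise functions
    of U. *)
Lemma fourier_unique_cell d (Omega : measurableType d) (P : probability Omega R)
    d' (Omega' : measurableType d') (P' : probability Omega' R)
    (M : R) (C U : Omega -> R) (C' U' : Omega' -> R) a b :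
  measurable_fun setT C -> measurable_fun setT U ->
  measurable_fun setT C' -> measurable_fun setT U' ->
  (forall w, `|C w| <= M) -> (forall w, `|C' w| <= M) ->
  (forall t, \int[P]_w (C w * cos (t * U w)) = \int[P']_w (C' w * cos (t * U' w))) ->
  (forall t, \int[P]_w (C w * sin (t * U w)) = \int[P']_w (C' w * sin (t * U' w))) ->
  a < b ->
  \int[P]_w (C w * cell a b (U w)) = \int[P']_w (C' w * cell a b (U' w)).
Proof.
move=> mC mU mC' mU' CM CM' ec es ab.
have mtr k : measurable_fun setT (trapezoid a b k.+1).
  exact: integrable_meas (trapezoid_integrable _ _ _).
have lim d0 (O : measurableType d0) (Q : probability O R) (D V : O -> R) :
    measurable_fun setT D -> measurable_fun setT V -> (forall w, `|D w| <= M) ->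
    (fun k => \int[Q]_w (D w * trapezoid a b k.+1 (V w))) @ \oo -->
    \int[Q]_w (D w * cell a b (V w)).
  move=> mD mV DM.
  have e1 k : measurable_fun setT (fun w => D w * trapezoid a b k.+1 (V w)).
    by apply: measurable_funM => //; exact: measurableT_comp.
  have e2 : measurable_fun setT (fun w => D w * cell a b (V w)).
    by apply: measurable_funM => //; apply: measurableT_comp => //; exact: measurable_cell.
  have e3 : Q.-integrable setT (EFin \o (fun=> M)).
    exact: finite_measure_integrable_cst.
  have e4 k w : setT w -> `|D w * trapezoid a b k.+1 (V w)| <= M.
    by move=> _; rewrite normrM -[leRHS]mulr1 ler_pM.
  have e5 : {ae Q, forall w, setT w ->
      D w * trapezoid a b k.+1 (V w) @[k --> \oo] --> D w * cell a b (V w)}.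
    apply: aeW => w _; apply: cvgM; first exact: cvg_cst.
    by have := @trapezoid_cvg a b (V w) ab; rewrite -(cvg_shiftS).
  by have [] := @Rint_dominated _ _ _ Q setT measurableT _ _ _ e1 e2 e3 e4 e5.
have E : (fun k => \int[P]_w (C w * trapezoid a b k.+1 (U w))) =
    (fun k => \int[P']_w (C' w * trapezoid a b k.+1 (U' w))).
  apply/funext => k.
  exact: (@fourier_unique_lipschitz _ _ _ _ _ _ _ M _ _ _ _ mC mU mC' mU' CM CM' ec es
    k.+1%:R 1 _ (trapezoid_integrable _ _ _) (trapezoid_lip _ _ _)).
have l1 := lim _ _ P _ _ mC mU CM; have l2 := lim _ _ P' _ _ mC' mU' CM'.
by rewrite E in l1; exact: cvg_unique l1 l2.
Qed.

(** Level k of the discretisation uses the cells of length 1/K between -K and K,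
    where K = k + 1 is never 0. *)
Definition node (k j : nat) : R := (j%:R - (k.+1 ^ 2)%:R) / k.+1%:R.

Definition nodes (k : nat) : nat := (2 * k.+1 ^ 2)%N.

Definition round_down (k : nat) x : R := (Num.floor (k.+1%:R * x))%:~R / k.+1%:R.

Lemma node_lt k j : node k j < node k j.+1.
Proof. by rewrite /node ltr_pM2r ?invr_gt0// ltrD2r ltr_nat. Qed.

Lemma node_round_down k j x : node k j <= x < node k j.+1 -> round_down k x = node k j.
Proof.
rewrite /node /round_down ler_pdivrMr// ltr_pdivlMr// => /andP[h1 h2].
congr (_ / _); rewrite (@floor_def _ _ (j%:Z - (k.+1 ^ 2)%:Z)).
  by rewrite intrB.
rewrite !(rmorphD, rmorphN) /= mulrC h1 /= (lt_le_trans h2)//.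
by rewrite -natr1 addrAC.
Qed.

Lemma round_down_cvg x : round_down k x @[k --> \oo] --> x.
Proof.
apply/cvgrPdist_le => e e0; near=> k.
have k1 : (0 : R) < k.+1%:R by rewrite ltr0n.
have /andP[h1 h2] := floor_itv (k.+1%:R * x).
have h3 : e^-1 <= k.+1%:R.
  rewrite (@le_trans _ _ k%:R) ?ler_nat//.
  by near: k; exact: nbhs_infty_ger.
have h4 : 1 <= k.+1%:R * e by rewrite -ler_pdivrMr// mul1r.
have E : k.+1%:R * round_down k x = (Num.floor (k.+1%:R * x))%:~R.
  by rewrite /round_down mulrC divfK// gt_eqF.
rewrite ler_norml -(ler_pM2l k1) -[X in _ && X](ler_pM2l k1) mulrN !mulrBr E.
by apply/andP; split; lra.
Unshelve. all: end_near. Qed.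

Lemma sum_cells k (phi : R -> R) x :
  \sum_(j < nodes k) phi (node k j) * cell (node k j) (node k j.+1) x =
  phi (round_down k x) * cell (- k.+1%:R) k.+1%:R x.
Proof.
transitivity (\sum_(j < nodes k)
    phi (round_down k x) * cell (node k j) (node k j.+1) x).
  apply: eq_bigr => j _; rewrite /cell.
  have [jx|xj] := leP (node k j) x; last first.
    by rewrite (lt_geF (lt_trans xj (node_lt _ _))) subrr !mulr0.
  have [|xj] := leP (node k j.+1) x; first by rewrite subrr !mulr0.
  by rewrite (node_round_down (j := j)) ?jx.
rewrite -mulr_sumr; congr (_ * _).
rewrite -(big_mkord xpredT (fun j => cell (node k j) (node k j.+1) x)) /cell.
under eq_bigr do rewrite -opprB.
rewrite sumrN telescope_sumr// opprB.
have k1 : k.+1%:R != 0 :> R by rewrite pnatr_eq0.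
congr ((_ <= x)%R%:R - (_ <= x)%R%:R); rewrite /node /nodes ?natrM ?natrX; field.
all: by rewrite ?k1.
Qed.

Lemma sum_cells_cvg (phi : R -> R) x :
  phi (round_down k x) @[k --> \oo] --> phi x ->
  \sum_(j < nodes k) phi (node k j) * cell (node k j) (node k j.+1) x @[k --> \oo]
    --> phi x.
Proof.
move=> cphi; under eq_fun do rewrite sum_cells.
rewrite -(mulr1 (phi x)); apply: cvgM => //.
apply: cvg_near_cst; near=> k.
have : `|x| < k.+1%:R.
  rewrite (@le_lt_trans _ _ k%:R) ?ltr_nat//.
  by near: k; exact: nbhs_infty_ger.
by rewrite ltr_norml /cell => /andP[/ltW -> /lt_geF ->]; rewrite subr0.
Unshelve. all: end_near. Qed.

Lemma sum_cells_bounded (B : R) k (phi : R -> R) x : (forall y, `|phi y| <= B) ->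
  `|\sum_(j < nodes k) phi (node k j) * cell (node k j) (node k j.+1) x| <= B.
Proof.
by move=> pB; rewrite sum_cells normrM -[leRHS]mulr1 ler_pM// cell_bounded.
Qed.

End interval_cells.

(** * Functions of finitely many coordinates and the Cramer-Wold theorem *)

Section functions_of_sequences.
Context {R : realType}.
Implicit Types (Phi : (nat -> R) -> R) (x : nat -> R) (n m : nat).

Definition depends_on n Phi :=
  forall x y, (forall i, (i < n)%N -> x i = y i) -> Phi x = Phi y.

(** Coordinatewise sequential continuity: exactly what dominated convergence asks
    for, and stable under products whatever the number of coordinates. *)
Definition seq_continuous Phi :=
  forall (xs : nat -> nat -> R) x,
    (forall i, xs k i @[k --> \oo] --> x i) -> Phi (xs k) @[k --> \oo] --> Phi x.

Definition upd x m (v : R) : nat -> R := fun i => if i == m then v else x i.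

Lemma upd_id x m : upd x m (x m) = x.
Proof. by apply/funext => i; rewrite /upd; case: eqP => // ->. Qed.

Lemma depends_upd m Phi v : depends_on m.+1 Phi ->
  depends_on m (fun x => Phi (upd x m v)).
Proof.
move=> dP x y xy; apply: dP => i; rewrite ltnS leq_eqVlt /upd.
by case: eqP => //= _ /xy.
Qed.

Lemma seq_continuous_upd m Phi v : seq_continuous Phi ->
  seq_continuous (fun x => Phi (upd x m v)).
Proof.
move=> cP xs x xsx; apply: cP => i; rewrite /upd.
by case: eqP => // _; exact: cvg_cst.
Qed.

Lemma seq_continuous_upd_arg m Phi x (vs : nat -> R) v : seq_continuous Phi ->
  vs @ \oo --> v -> Phi (upd x m (vs k)) @[k --> \oo] --> Phi (upd x m v).
Proof.
move=> cP vsv; apply: cP => i; rewrite /upd.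
by case: eqP => // _; exact: cvg_cst.
Qed.

(** Discretising the m-th variable only: each summand is a function of the other
    variables times an indicator of the m-th, which allows inductions on the number
    of variables. *)
Definition step_approx Phi m k x : R :=
  \sum_(j < nodes k) Phi (upd x m (node k j)) * cell (node k j) (node k j.+1) (x m).

Lemma step_approx_cvg Phi m x : seq_continuous Phi ->
  step_approx Phi m k x @[k --> \oo] --> Phi x.
Proof.
move=> cP; rewrite -[in X in _ --> X](upd_id x m).
apply: (@sum_cells_cvg _ (fun v => Phi (upd x m v))).
by apply: seq_continuous_upd_arg => //; exact: round_down_cvg.
Qed.

Lemma step_approx_bounded Phi m k x (B : R) : (forall x, `|Phi x| <= B) ->
  `|step_approx Phi m k x| <= B.
Proof.
by move=> PB; exact: (@sum_cells_bounded _ _ _ (fun v => Phi (upd x m v))).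
Qed.

Lemma measurable_seq_continuous d (Omega : measurableType d) n Phi
    (U : nat -> Omega -> R) : (forall i, measurable_fun setT (U i)) ->
  depends_on n Phi -> seq_continuous Phi ->
  measurable_fun setT (fun w => Phi (fun i => U i w)).
Proof.
move=> mU; elim: n Phi => [|m IH] Phi dP cP.
  rewrite (_ : (fun w => _) = (fun=> Phi (fun=> 0))) //.
  by apply/funext => w; exact: dP.
apply: (@measurable_fun_cvg _ _ _ _ (fun k w => step_approx Phi m k (fun i => U i w))).
  move=> k; rewrite /step_approx.
  apply: measurable_sum => j; apply: measurable_funM; last first.
    by apply: measurableT_comp => //; exact: measurable_cell.
  apply: (IH (fun x => Phi (upd x m (node k j)))); first exact: depends_upd.
  exact: seq_continuous_upd.
by move=> w _; exact: step_approx_cvg.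
Qed.

End functions_of_sequences.

Section Cramer_Wold.
Context {R : realType}.
Context d (Omega : measurableType d) (P : probability Omega R).
Context d' (Omega' : measurableType d') (P' : probability Omega' R).
Variables (U : nat -> Omega -> R) (U' : nat -> Omega' -> R) (n : nat).
Hypotheses (mU : forall i, measurable_fun setT (U i)).
Hypotheses (mU' : forall i, measurable_fun setT (U' i)).

Let lin (t : nat -> R) m w := \sum_(m <= i < n) t i * U i w.
Let lin' (t : nat -> R) m w := \sum_(m <= i < n) t i * U' i w.

Hypothesis eq_cos : forall t, \int[P]_w cos (lin t 0%N w) = \int[P']_w cos (lin' t 0%N w).
Hypothesis eq_sin : forall t, \int[P]_w sin (lin t 0%N w) = \int[P']_w sin (lin' t 0%N w).

Let Psi (Phi : (nat -> R) -> R) w := Phi (fun i => U i w).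
Let Psi' (Phi : (nat -> R) -> R) w := Phi (fun i => U' i w).

(* the induction statement: coordinates below m enter through Phi, the others
   through a linear form *)
Let good m := forall Phi (B : R), depends_on m Phi -> seq_continuous Phi ->
  (forall x, `|Phi x| <= B) -> forall t,
  \int[P]_w (Psi Phi w * cos (lin t m w)) = \int[P']_w (Psi' Phi w * cos (lin' t m w)) /\
  \int[P]_w (Psi Phi w * sin (lin t m w)) = \int[P']_w (Psi' Phi w * sin (lin' t m w)).

Let mcos : measurable_fun setT (@cos R).
Proof. by apply: continuous_measurable_fun; exact: continuous_cos. Qed.

Let msin : measurable_fun setT (@sin R).
Proof. by apply: continuous_measurable_fun; exact: continuous_sin. Qed.

Let mlin t m : measurable_fun setT (lin t m).
Proof. by apply: measurable_sum => i; exact: measurable_funM. Qed.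

Let mlin' t m : measurable_fun setT (lin' t m).
Proof. by apply: measurable_sum => i; exact: measurable_funM. Qed.

Let linS m t s w : (m < n)%N -> lin (upd t m s) m w = s * U m w + lin t m.+1 w.
Proof.
move=> mn; rewrite /lin big_ltn// /upd eqxx; congr (_ + _).
rewrite !big_nat; apply: eq_bigr => i /andP[mi _].
by rewrite gtn_eqF.
Qed.

Let linS' m t s w : (m < n)%N -> lin' (upd t m s) m w = s * U' m w + lin' t m.+1 w.
Proof.
move=> mn; rewrite /lin' big_ltn// /upd eqxx; congr (_ + _).
rewrite !big_nat; apply: eq_bigr => i /andP[mi _].
by rewrite gtn_eqF.
Qed.

Section half_sum.
Context d0 (O : measurableType d0) (Q : probability O R).
Variables (C : O -> R) (B : R).
Hypotheses (mC : measurable_fun setT C) (CB : forall w, `|C w| <= B).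

Let bi (tr : R -> R) (V : O -> R) : measurable_fun setT tr -> measurable_fun setT V ->
  (forall x, `|tr x| <= 1) -> Q.-integrable setT (EFin \o (fun w => C w * tr (V w))).
Proof.
move=> mtr mV tr1; apply: (@integrable_bounded _ _ _ Q B) => [|w].
  by apply: measurable_funM => //; exact: measurableT_comp.
by rewrite normrM -[leRHS]mulr1 ler_pM.
Qed.

Lemma half_sum (a b : R) (tr1 tr2 : R -> R) (V1 V2 : O -> R) (F : O -> R) :
  measurable_fun setT tr1 -> measurable_fun setT tr2 ->
  measurable_fun setT V1 -> measurable_fun setT V2 ->
  (forall x, `|tr1 x| <= 1) -> (forall x, `|tr2 x| <= 1) ->
  (forall w, F w = a * (C w * tr1 (V1 w)) + b * (C w * tr2 (V2 w))) ->
  \int[Q]_w F w = a * (\int[Q]_w (C w * tr1 (V1 w))) + b * (\int[Q]_w (C w * tr2 (V2 w))).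
Proof.
move=> m1 m2 mV1 mV2 b1 b2 FE; rewrite -!RintZ ?bi// -RintD//.
- by apply: eq_Rintegral => w _.
- by apply: integrableRZ => //; exact: bi.
- by apply: integrableRZ => //; exact: bi.
Qed.

End half_sum.

(* Product-to-sum formulas: the transform in the m-th coordinate at frequency s is
   a combination of the transforms of the linear forms with coefficients s and -s. *)
Let prod_to_sum m t : (m < n)%N -> good m ->
  forall Phi (B : R), depends_on m Phi -> seq_continuous Phi ->
  (forall x, `|Phi x| <= B) -> forall s,
  [/\ \int[P]_w (Psi Phi w * cos (lin t m.+1 w) * cos (s * U m w)) =
      \int[P']_w (Psi' Phi w * cos (lin' t m.+1 w) * cos (s * U' m w)),
      \int[P]_w (Psi Phi w * cos (lin t m.+1 w) * sin (s * U m w)) =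
      \int[P']_w (Psi' Phi w * cos (lin' t m.+1 w) * sin (s * U' m w)),
      \int[P]_w (Psi Phi w * sin (lin t m.+1 w) * cos (s * U m w)) =
      \int[P']_w (Psi' Phi w * sin (lin' t m.+1 w) * cos (s * U' m w)) &
      \int[P]_w (Psi Phi w * sin (lin t m.+1 w) * sin (s * U m w)) =
      \int[P']_w (Psi' Phi w * sin (lin' t m.+1 w) * sin (s * U' m w))].
Proof.
move=> mn IH Phi B dP cP PB s.
have mP : measurable_fun setT (Psi Phi) by exact: measurable_seq_continuous dP cP.
have mP' : measurable_fun setT (Psi' Phi) by exact: measurable_seq_continuous dP cP.
have [c1 s1] := IH Phi B dP cP PB (upd t m s).
have [c2 s2] := IH Phi B dP cP PB (upd t m (- s)).
have hs := @half_sum _ _ P (Psi Phi) B mP (fun w => PB _).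
have hs' := @half_sum _ _ P' (Psi' Phi) B mP' (fun w => PB _).
split.
- rewrite (hs (1/2) (1/2) cos cos (lin (upd t m s) m) (lin (upd t m (- s)) m))//;
    try exact: cos_max; last first.
    by move=> w; rewrite !linS// (mulNr s) !cosD cosN sinN; field.
  rewrite (hs' (1/2) (1/2) cos cos (lin' (upd t m s) m) (lin' (upd t m (- s)) m))//;
    try exact: cos_max; last first.
    by move=> w; rewrite !linS'// (mulNr s) !cosD cosN sinN; field.
  by rewrite c1 c2.
- rewrite (hs (1/2) (- (1/2)) sin sin (lin (upd t m s) m) (lin (upd t m (- s)) m))//;
    try exact: sin_max; last first.
    by move=> w; rewrite !linS// (mulNr s) !sinD cosN sinN; field.
  rewrite (hs' (1/2) (- (1/2)) sin sin (lin' (upd t m s) m) (lin' (upd t m (- s)) m))//;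
    try exact: sin_max; last first.
    by move=> w; rewrite !linS'// (mulNr s) !sinD cosN sinN; field.
  by rewrite s1 s2.
- rewrite (hs (1/2) (1/2) sin sin (lin (upd t m s) m) (lin (upd t m (- s)) m))//;
    try exact: sin_max; last first.
    by move=> w; rewrite !linS// (mulNr s) !sinD cosN sinN; field.
  rewrite (hs' (1/2) (1/2) sin sin (lin' (upd t m s) m) (lin' (upd t m (- s)) m))//;
    try exact: sin_max; last first.
    by move=> w; rewrite !linS'// (mulNr s) !sinD cosN sinN; field.
  by rewrite s1 s2.
- rewrite (hs (- (1/2)) (1/2) cos cos (lin (upd t m s) m) (lin (upd t m (- s)) m))//;
    try exact: cos_max; last first.
    by move=> w; rewrite !linS// (mulNr s) !cosD cosN sinN; field.
  rewrite (hs' (- (1/2)) (1/2) cos cos (lin' (upd t m s) m) (lin' (upd t m (- s)) m))//;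
    try exact: cos_max; last first.
    by move=> w; rewrite !linS'// (mulNr s) !cosD cosN sinN; field.
  by rewrite c1 c2.
Qed.

Let step_cvg d0 (O : measurableType d0) (Q : probability O R) (V : nat -> O -> R)
    m Phi (B : R) (c : O -> R) :
  (forall i, measurable_fun setT (V i)) -> measurable_fun setT c ->
  (forall w, `|c w| <= 1) -> depends_on m.+1 Phi -> seq_continuous Phi ->
  (forall x, `|Phi x| <= B) ->
  (fun k => \sum_(j < nodes k) \int[Q]_w
     (Phi (upd (fun i => V i w) m (node k j)) * c w *
      cell (node k j) (node k j.+1) (V m w))) @ \oo -->
  \int[Q]_w (Phi (fun i => V i w) * c w).
Proof.
move=> mV mc c1 dP cP PB.
have mPv v : measurable_fun setT (fun w => Phi (upd (fun i => V i w) m v)).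
  apply: (@measurable_seq_continuous _ _ _ m (fun x => Phi (upd x m v))) => //.
    exact: depends_upd.
  exact: seq_continuous_upd.
have mcell a b : measurable_fun setT (fun w => cell a b (V m w)).
  by apply: measurableT_comp => //; exact: measurable_cell.
have e1 k : measurable_fun setT (fun w => step_approx Phi m k (fun i => V i w) * c w).
  apply: measurable_funM => //; apply: measurable_sum => j.
  exact: measurable_funM.
have e2 : measurable_fun setT (fun w => Phi (fun i => V i w) * c w).
  by apply: measurable_funM => //; exact: measurable_seq_continuous dP cP.
have e3 : Q.-integrable setT (EFin \o (fun=> B)).
  exact: finite_measure_integrable_cst.
have e4 k w : setT w -> `|step_approx Phi m k (fun i => V i w) * c w| <= B.
  by move=> _; rewrite normrM -[leRHS]mulr1 ler_pM// step_approx_bounded.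
have e5 : {ae Q, forall w, setT w ->
    step_approx Phi m k (fun i => V i w) * c w @[k --> \oo] -->
    Phi (fun i => V i w) * c w}.
  apply: aeW => w _; apply: cvgM; last exact: cvg_cst.
  exact: step_approx_cvg.
have [_] := @Rint_dominated _ _ _ Q setT measurableT _ _ _ e1 e2 e3 e4 e5.
suff -> : (fun k => \int[Q]_w (step_approx Phi m k (fun i => V i w) * c w)) =
  (fun k => \sum_(j < nodes k) \int[Q]_w
     (Phi (upd (fun i => V i w) m (node k j)) * c w *
      cell (node k j) (node k j.+1) (V m w))) by [].
apply/funext => k.
have ti j : Q.-integrable setT (EFin \o (fun w =>
    Phi (upd (fun i => V i w) m (node k j)) * c w * cell (node k j) (node k j.+1) (V m w))).
  apply: (@integrable_bounded _ _ _ Q (B * 1 * 1)) => [|w].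
    by apply: measurable_funM => //; exact: measurable_funM.
  by rewrite !normrM !ler_pM ?cell_bounded// mulr_ge0.
rewrite /step_approx.
transitivity (\int[Q]_w \sum_(j < nodes k)
    Phi (upd (fun i => V i w) m (node k j)) * c w *
      cell (node k j) (node k j.+1) (V m w)).
  apply: eq_Rintegral => w _; rewrite mulr_suml; apply: eq_bigr => j _.
  by rewrite mulrAC.
exact: (Rint_sum measurableT _ (fun j : 'I_(nodes k) => ti j)).2.
Qed.

Let good_step m : (m < n)%N -> good m -> good m.+1.
Proof.
move=> mn IH Phi B dP cP PB t.
have mL := mlin t m.+1; have mL' := mlin' t m.+1.
have key (tr : R -> R) :
    measurable_fun setT tr -> (forall x, `|tr x| <= 1) ->
    (forall v s, \int[P]_w (Psi (fun x => Phi (upd x m v)) w * tr (lin t m.+1 w) * cos (s * U m w)) =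
      \int[P']_w (Psi' (fun x => Phi (upd x m v)) w * tr (lin' t m.+1 w) * cos (s * U' m w))) ->
    (forall v s, \int[P]_w (Psi (fun x => Phi (upd x m v)) w * tr (lin t m.+1 w) * sin (s * U m w)) =
      \int[P']_w (Psi' (fun x => Phi (upd x m v)) w * tr (lin' t m.+1 w) * sin (s * U' m w))) ->
    \int[P]_w (Psi Phi w * tr (lin t m.+1 w)) = \int[P']_w (Psi' Phi w * tr (lin' t m.+1 w)).
  move=> mtr tr1 ec es.
  have mc : measurable_fun setT (fun w => tr (lin t m.+1 w)) by exact: measurableT_comp.
  have mc' : measurable_fun setT (fun w => tr (lin' t m.+1 w)) by exact: measurableT_comp.
  have l1 := @step_cvg _ _ P U m Phi B _ mU mc (fun w => tr1 _) dP cP PB.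
  have l2 := @step_cvg _ _ P' U' m Phi B _ mU' mc' (fun w => tr1 _) dP cP PB.
  apply: (cvg_unique _ l1) => //=; move: l2; apply: cvg_trans; apply: near_eq_cvg.
  apply: nearW => k; apply: eq_bigr => j _.
  have mv v := measurable_seq_continuous mU (@depends_upd _ m Phi v dP) (@seq_continuous_upd _ m Phi v cP).
  have mv' v := measurable_seq_continuous mU' (@depends_upd _ m Phi v dP) (@seq_continuous_upd _ m Phi v cP).
  apply/esym.
  apply: (@fourier_unique_cell _ _ _ P _ _ P' (B * 1)) => //.
  - exact: measurable_funM.
  - exact: measurable_funM.
  - by move=> w; rewrite normrM ler_pM.
  - by move=> w; rewrite normrM ler_pM.
  - exact: ec.
  - exact: es.
  - exact: node_lt.
have pts v := @prod_to_sum m t mn IH (fun x => Phi (upd x m v)) B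
  (@depends_upd _ m Phi v dP) (@seq_continuous_upd _ m Phi v cP) (fun x => PB _).
split.
- apply: key => //; first exact: cos_max.
    by move=> v s; have [-> _ _ _] := pts v s.
  by move=> v s; have [_ -> _ _] := pts v s.
- apply: key => //; first exact: sin_max.
    by move=> v s; have [_ _ -> _] := pts v s.
  by move=> v s; have [_ _ _ ->] := pts v s.
Qed.

(** A random vector is determined in law by its one-dimensional projections. The
    Fourier transform is inverted one coordinate at a time, so that only the
    uniqueness theorem on the line is used. *)
Lemma Cramer_Wold Phi (B : R) : depends_on n Phi -> seq_continuous Phi ->
  (forall x, `|Phi x| <= B) ->
  \int[P]_w Phi (fun i => U i w) = \int[P']_w Phi (fun i => U' i w).
Proof.
move=> dP cP PB.
have H : forall m, (m <= n)%N -> good m.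
  elim=> [_|m IH mn]; last by apply: good_step => //; exact/IH/ltnW.
  move=> Phi0 B0 dP0 cP0 PB0 t.
  have E w : Psi Phi0 w = Phi0 (fun=> 0) by exact: dP0.
  have E' w : Psi' Phi0 w = Phi0 (fun=> 0) by exact: dP0.
  have ib d0 (O : measurableType d0) (Q : probability O R) (V : O -> R) (tr : R -> R) :
      measurable_fun setT V -> measurable_fun setT tr -> (forall x, `|tr x| <= 1) ->
      Q.-integrable setT (EFin \o (fun w => tr (V w))).
    move=> mV mtr tr1; apply: (@integrable_bounded _ _ _ Q 1) => //.
    exact: measurableT_comp.
  split; under eq_Rintegral do rewrite E; under [RHS]eq_Rintegral do rewrite E'.
  - rewrite !RintZ ?eq_cos//; apply: ib => // x; exact: cos_max.
  - rewrite !RintZ ?eq_sin//; apply: ib => // x; exact: sin_max.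
have [+ _] := H n (leqnn n) Phi B dP cP PB (fun=> 0).
rewrite /lin /lin'; under eq_Rintegral do rewrite big_geq// cos0 mulr1.
by under [X in _ = X -> _]eq_Rintegral do rewrite big_geq// cos0 mulr1.
Qed.

End Cramer_Wold.

(** * Gaussian integration by parts *)

Section gaussian_rv.
Context {R : realType} d (Omega : measurableType d) (P : probability Omega R).
Variables (Y : Omega -> R) (s : R).
Hypotheses (mY : measurable_fun setT Y) (s0 : 0 < s).
Hypothesis lawY : forall B : set R, measurable B -> P (Y @^-1` B) = normal_prob 0 s B.

Lemma Rint_law (f : R -> R) (M : R) : measurable_fun setT f ->
  (forall x, `|f x| <= M) ->
  \int[P]_w f (Y w) = \int[normal_prob (0 : R) s]_x f x.
Proof.
move=> mf fM; congr fine.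
have mfY : measurable_fun setT (fun w => f (Y w)) by exact: measurableT_comp.
have := @integral_pushforward _ _ _ (measurableTypeR R) R Y mY P setT (EFin \o f).
move=> <- //; last 2 first.
- exact/measurable_EFinP.
- apply: (@integrable_bounded _ _ _ P M) => //.
apply: eq_measure_integral => A mA _; rewrite /= /pushforward.
exact: lawY.
Qed.

Lemma integral_sqr_law :
  (\int[P]_w (Y w ^+ 2)%:E = (s ^+ 2)%:E)%E.
Proof.
have := @ge0_integral_pushforward _ _ _ (measurableTypeR R) R Y mY P setT (fun x => (x ^+ 2)%:E).
move=> <- //; last 2 first.
- by apply/measurable_EFinP; exact: measurable_funX.
- by move=> x _; rewrite lee_fin sqr_ge0.
rewrite -(variance_normal s0) EFin_Rint//.
  apply: eq_measure_integral => A mA _; rewrite /= /pushforward.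
  exact: lawY.
by have [] := sq_integrable_normal s0.
Qed.

End gaussian_rv.

Section hilbert_product_theory.
Context {R : realType} (H : completeNormedModType R) (ip : H -> H -> R).
Hypothesis hp : hilbert_product ip.

Lemma ipC g h : ip g h = ip h g. Proof. by case: hp. Qed.

Lemma ipDl f g h : ip (f + g) h = ip f h + ip g h.
Proof. by case: hp => _ l _; rewrite -[f]scale1r l mul1r scale1r. Qed.

Lemma ip0l h : ip 0 h = 0.
Proof. by apply: (addrI (ip 0 h)); rewrite -ipDl !addr0. Qed.

Lemma ipZl a g h : ip (a *: g) h = a * ip g h.
Proof. by case: hp => _ l _; rewrite -[a *: g]addr0 l ip0l addr0. Qed.

Lemma ipDr f g h : ip h (f + g) = ip h f + ip h g.
Proof. by rewrite ipC ipDl !(ipC h). Qed.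

Lemma ipZr a g h : ip h (a *: g) = a * ip h g.
Proof. by rewrite ipC ipZl (ipC h). Qed.

Lemma ipBr f g h : ip h (f - g) = ip h f - ip h g.
Proof. by rewrite ipDr -scaleN1r ipZr mulN1r. Qed.

Lemma ip_norm h : ip h h = `|h| ^+ 2. Proof. by case: hp. Qed.

Lemma ip_suml (I : Type) (s : seq I) (Q : pred I) (f : I -> H) h :
  ip (\sum_(i <- s | Q i) f i) h = \sum_(i <- s | Q i) ip (f i) h.
Proof. by apply: (big_morph (ip^~ h)); [exact: (fun f g => ipDl f g h)|exact: ip0l]. Qed.

Lemma ip_sumr (I : Type) (s : seq I) (Q : pred I) (f : I -> H) h :
  ip h (\sum_(i <- s | Q i) f i) = \sum_(i <- s | Q i) ip h (f i).
Proof. by rewrite ipC ip_suml; apply: eq_bigr => i _; rewrite ipC. Qed.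

Lemma ip_CS g h : `|ip g h| <= `|g| * `|h|.
Proof.
have P t : 0 <= `|g| ^+ 2 + 2 * t * ip g h + t ^+ 2 * `|h| ^+ 2.
  have -> : `|g| ^+ 2 + 2 * t * ip g h + t ^+ 2 * `|h| ^+ 2 = `|g + t *: h| ^+ 2.
    by rewrite -!ip_norm !(ipDl, ipDr, ipZl, ipZr) (ipC h g); ring.
  exact: sqr_ge0.
have [->|h0] := eqVneq h 0; first by rewrite ipC ip0l normr0 mulr_ge0.
have hp0 : 0 < `|h| ^+ 2 by rewrite exprn_gt0// normr_gt0.
rewrite -(ler_pXn2r (n := 2))//= ?nnegrE ?mulr_ge0// exprMn real_normK ?num_real//.
have := P (- ip g h / `|h| ^+ 2).
have -> : `|g| ^+ 2 + 2 * (- ip g h / `|h| ^+ 2) * ip g h +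
    (- ip g h / `|h| ^+ 2) ^+ 2 * `|h| ^+ 2 = `|g| ^+ 2 - ip g h ^+ 2 / `|h| ^+ 2.
  by field; rewrite gt_eqF// normr_gt0.
by rewrite subr_ge0 ler_pdivrMr.
Qed.

Lemma ip_continuous g : continuous (ip g).
Proof.
move=> h; apply/cvgrPdist_le => e e0; near=> h'.
rewrite -ipBr (le_trans (ip_CS _ _))//.
apply: (@le_trans _ _ ((`|g| + 1) * `|h - h'|)).
  by rewrite ler_wpM2r// lerDl.
have g1 : 0 < `|g| + 1 by rewrite ltr_wpDl.
rewrite -ler_pdivlMl//; near: h'; apply: cvgr_dist_le; first exact: cvg_id.
by rewrite mulr_gt0// invr_gt0.
Unshelve. all: end_near. Qed.

End hilbert_product_theory.

Section isonormal_theory.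
Context {R : realType} d (Omega : measurableType d) (P : probability Omega R).
Context (H : completeNormedModType R) (ip : H -> H -> R) (W : H -> Omega -> R).
Hypotheses (hp : hilbert_product ip) (iso : isonormal P ip W).

Lemma isonormal_measurable h : measurable_fun setT (W h).
Proof. by have [/(_ h)[]] := iso. Qed.

Let integral_sqr h : (\int[P]_w (W h w ^+ 2)%:E = (ip h h)%:E)%E.
Proof.
have [_ _ /(_ h h)] := iso; rewrite unlock => <-.
by apply: eq_integral => w _; rewrite expr2.
Qed.

Lemma isonormal_sq_integrable h : sq_integrable P setT (W h).
Proof.
have mW := isonormal_measurable h; split => //.
apply/integrableP; split; first by apply/measurable_EFinP; exact: measurable_funX.
under eq_integral do rewrite /= ger0_norm ?sqr_ge0//.
by rewrite integral_sqr ltry.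
Qed.

Lemma isonormal_ae0 h : ip h h = 0 -> {ae P, forall w, setT w -> W h w = 0}.
Proof.
move=> h0; have mW := isonormal_measurable h.
have : ae_eq P setT (fun w => (W h w ^+ 2)%:E) (cst 0%E).
  apply/ae_eq_integral_abs => //.
    by apply/measurable_EFinP; exact: measurable_funX.
  under eq_integral do rewrite gee0_abs ?lee_fin ?sqr_ge0//.
  by rewrite integral_sqr h0.
apply: filterS => w + _ => /(_ I) [] /eqP.
by rewrite sqrf_eq0 => /eqP.
Qed.

Lemma isonormal_lin (k : nat -> H) (t : nat -> R) n :
  {ae P, forall w, W (\sum_(0 <= i < n) t i *: k i) w =
                   \sum_(0 <= i < n) t i * W (k i) w}.
Proof.
elim: n => [|n IH].
  have := isonormal_ae0 (ip0l hp 0); apply: filterS => w /(_ I) E.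
  by rewrite !big_geq.
have [_ /(_ (t n) (k n) (\sum_(0 <= i < n) t i *: k i)) L _] := iso.
apply: filterS2 IH L => w E; rewrite !big_nat_recr//= [in X in X -> _]addrC => ->.
by rewrite E addrC.
Qed.

(** The parameter s of the law is identified through the second moment; the
    degenerate case s = 0 has to be treated apart. *)
Lemma isonormal_fourier h : \int[P]_w cos (W h w) = expR (- (ip h h / 2)) /\
  \int[P]_w sin (W h w) = 0.
Proof.
have mcos : measurable_fun setT (@cos R).
  by apply: continuous_measurable_fun; exact: continuous_cos.
have msin : measurable_fun setT (@sin R).
  by apply: continuous_measurable_fun; exact: continuous_sin.
have mW := isonormal_measurable h.
have [/(_ h)[_ [W0|[s s0 lawW]]] _ _] := iso; last first.
  have E : ip h h = s ^+ 2.
    have := integral_sqr h.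
    by rewrite (integral_sqr_law mW s0 lawW) => -[].
  rewrite (Rint_law mW lawW mcos (fun x => cos_max x)).
  rewrite (Rint_law mW lawW msin (fun x => sin_max x)).
  split.
    have := normal_cos 1 s0; under eq_Rintegral do rewrite mul1r.
    by move=> ->; rewrite expr1n mulr1 E.
  have := normal_sin 1 s0; under eq_Rintegral do rewrite mul1r.
  by [].
have E : ip h h = 0.
  have := integral_sqr h.
  rewrite (ae_eq_integral (cst 0%E))//.
  - by rewrite integral0 => -[].
  - by apply/measurable_EFinP; exact: measurable_funX.
  - by apply: filterS W0 => w -> _; rewrite expr0n.
split.
  rewrite E mul0r oppr0 expR0 -[RHS](Rint_cst P).
  apply: Rint_ae_eq => //; first exact: measurableT_comp.
  by apply: filterS W0 => w -> _; rewrite cos0.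
rewrite -[RHS](Rint_cst P).
apply: Rint_ae_eq => //; first exact: measurableT_comp.
by apply: filterS W0 => w -> _; rewrite sin0.
Qed.

End isonormal_theory.

Section gaussian_ibp.
Context {R : realType} d (Omega : measurableType d) (P : probability Omega R).
Context (H : completeNormedModType R) (ip : H -> H -> R) (W : H -> Omega -> R).
Hypotheses (hp : hilbert_product ip) (iso : isonormal P ip W).

Let mW h : measurable_fun setT (W h). Proof. exact: isonormal_measurable iso h. Qed.

Section decoupling.
Variables (g : H) (k : nat -> H) (s : R).
Hypotheses (s0 : 0 < s) (gs : ip g g = s ^+ 2).

Let N : probability _ R := normal_prob 0 s.
Let Q : probability _ R := (P \x N)%E.
Let b i := ip g (k i) / s ^+ 2.

(* W(k i) with its projection on W(g) replaced by an independent copy *)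
Let V' i (z : Omega * measurableTypeR R) : R := W (k i) z.1 - b i * W g z.1 + b i * z.2.

Let mV' i : measurable_fun setT (V' i).
Proof.
apply: measurable_funD; last exact: measurable_funM.
apply: measurable_funB; first exact: (measurableT_comp (mW _)).
by apply: measurable_funM => //; exact: (measurableT_comp (mW _)).
Qed.

(* A linear combination of the W(k i) is W(tau g + kap) with kap orthogonal to g;
   the decoupled one is W(kap) + tau z, of the same variance. *)
Let lin_decoupled (t : nat -> R) n :
  let tau := \sum_(0 <= i < n) t i * b i in
  let kap := \sum_(0 <= i < n) t i *: k i - tau *: g in
  [/\ {ae P, forall w, \sum_(0 <= i < n) t i * W (k i) w = W (tau *: g + kap) w},
      ip (tau *: g + kap) (tau *: g + kap) = s ^+ 2 * tau ^+ 2 + ip kap kap &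
      {ae P, forall w, forall z, \sum_(0 <= i < n) t i * V' i (w, z) =
         W kap w + tau * z}].
Proof.
move=> tau kap.
have L := isonormal_lin hp iso k t n.
have gk : ip g kap = 0.
  rewrite /kap ipBr// ipZr// ip_sumr// gs /tau mulr_suml -sumrB big1// => i _.
  by rewrite ipZr// /b; field; rewrite gt_eqF.
split.
- by apply: filterS L => w <-; rewrite /kap addrC subrK.
- clear L; clearbody kap; by rewrite !(ipDl hp, ipDr hp, ipZl hp, ipZr hp) (ipC hp kap g) gk gs; ring.
- have [_ /(_ (- tau) g (\sum_(0 <= i < n) t i *: k i)) L' _] := iso.
  apply: filterS2 L L' => w L L' z.
  have -> : kap = - tau *: g + \sum_(0 <= i < n) t i *: k i.
    by rewrite /kap addrC scaleNr.
  rewrite L' L /tau mulNr !mulr_suml -sumrN -!big_split/=; apply: eq_bigr => i _.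
  by rewrite /V'/=; ring.
Qed.

Let bounded_lin_prod (tr tr' : R -> R) (kap : H) (tau : R) :
  measurable_fun setT tr -> measurable_fun setT tr' ->
  (forall x, `|tr x| <= 1) -> (forall x, `|tr' x| <= 1) ->
  Q.-integrable setT (EFin \o (fun z : Omega * measurableTypeR R =>
    tr (W kap z.1) * tr' (tau * z.2))) /\
  \int[Q]_z (tr (W kap z.1) * tr' (tau * z.2)) =
  (\int[P]_w tr (W kap w)) * \int[N]_x tr' (tau * x).
Proof.
move=> mtr mtr' tr1 tr1'.
have mf : measurable_fun setT (fun z : Omega * measurableTypeR R =>
    tr (W kap z.1) * tr' (tau * z.2)).
  apply: measurable_funM; apply: measurableT_comp => //.
    exact: (measurableT_comp (mW _)).
  exact: measurable_funM.
have fi : Q.-integrable setT (EFin \o (fun z : Omega * measurableTypeR R =>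
    tr (W kap z.1) * tr' (tau * z.2))).
  apply: (@integrable_bounded _ _ _ Q 1) => // z.
  by rewrite normrM -[leRHS]mulr1 ler_pM.
split => //; rewrite -(Rint_prod1 fi) /=.
have mt : measurable_fun setT (fun x => tr' (tau * x)).
  by apply: measurableT_comp => //; exact: mulrl_measurable.
have Ni : N.-integrable setT (EFin \o (fun x => tr' (tau * x))).
  exact: (@integrable_bounded _ _ _ N 1).
have Pi : P.-integrable setT (EFin \o (fun w => tr (W kap w))).
  apply: (@integrable_bounded _ _ _ P 1) => //; exact: measurableT_comp.
transitivity (\int[P]_w ((\int[N]_x tr' (tau * x)) * tr (W kap w))).
  by apply: eq_Rintegral => w _; rewrite RintZ// mulrC.
by rewrite RintZ// mulrC.
Qed.

Let mcos : measurable_fun setT (@cos R).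
Proof. by apply: continuous_measurable_fun; exact: continuous_cos. Qed.

Let msin : measurable_fun setT (@sin R).
Proof. by apply: continuous_measurable_fun; exact: continuous_sin. Qed.

Let fourier_decoupled (t : nat -> R) n :
  \int[P]_w cos (\sum_(0 <= i < n) t i * W (k i) w) =
  \int[Q]_z cos (\sum_(0 <= i < n) t i * V' i z) /\
  \int[P]_w sin (\sum_(0 <= i < n) t i * W (k i) w) =
  \int[Q]_z sin (\sum_(0 <= i < n) t i * V' i z).
Proof.
have [] := lin_decoupled t n.
set tau := \sum_(0 <= i < n) t i * b i.
set kap := _ - tau *: g => L1 ipE L2.
have mL : measurable_fun setT (fun w => \sum_(0 <= i < n) t i * W (k i) w).
  by apply: measurable_sum => i; exact: measurable_funM.
have mL' : measurable_fun setT (fun z => \sum_(0 <= i < n) t i * V' i z).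
  by apply: measurable_sum => i; exact: measurable_funM.
have mM' : measurable_fun setT (fun z : Omega * measurableTypeR R => W kap z.1 + tau * z.2).
  apply: measurable_funD; first exact: (measurableT_comp (mW _)).
  exact: measurable_funM.
have [cW sW] := isonormal_fourier iso (tau *: g + kap).
have [ck sk] := isonormal_fourier iso kap.
have left (tr : R -> R) : measurable_fun setT tr ->
    \int[P]_w tr (\sum_(0 <= i < n) t i * W (k i) w) = \int[P]_w tr (W (tau *: g + kap) w).
  move=> mtr; apply: Rint_ae_eq => //; try exact: measurableT_comp.
  by apply: filterS L1 => w ->.
have right (tr : R -> R) : measurable_fun setT tr -> (forall x, `|tr x| <= 1) ->
    \int[Q]_z tr (\sum_(0 <= i < n) t i * V' i z) = \int[Q]_z tr (W kap z.1 + tau * z.2).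
  move=> mtr tr1.
  have bi (f : Omega * measurableTypeR R -> R) : measurable_fun setT f ->
      (P \x N)%E.-integrable setT (EFin \o (fun z => tr (f z))).
    move=> mf; apply: (@integrable_bounded _ _ _ Q 1) => //.
    exact: measurableT_comp.
  rewrite -(Rint_prod1 (bi _ mL')) -(Rint_prod1 (bi _ mM')).
  apply: Rint_ae_eq => //.
  - exact: (measurable_Rint1 (bi _ mL')).
  - exact: (measurable_Rint1 (bi _ mM')).
  - by apply: filterS L2 => w E _; apply: eq_Rintegral => z _; rewrite E.
rewrite !left// !right//; [|exact: sin_max|exact: cos_max].
have [cci ccE] := bounded_lin_prod kap tau mcos mcos (@cos_max R) (@cos_max R).
have [ssi ssE] := bounded_lin_prod kap tau msin msin (@sin_max R) (@sin_max R).
have [csi csE] := bounded_lin_prod kap tau mcos msin (@cos_max R) (@sin_max R).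
have [sci scE] := bounded_lin_prod kap tau msin mcos (@sin_max R) (@cos_max R).
split.
- under [RHS]eq_Rintegral do rewrite cosD.
  rewrite RintB// ccE ssE normal_sin// mulr0 subr0 normal_cos// ck cW ipE -expRD.
  by congr expR; field.
- under [RHS]eq_Rintegral do rewrite sinD.
  by rewrite RintD// scE csE normal_sin// mulr0 sk mul0r addr0 sW.
Qed.

(** Both sequences have the same one-dimensional projections, since the residues
    W(k i) - b i W(g) are uncorrelated with W(g). This is the independence of
    uncorrelated Gaussian families, in the form needed to integrate W(g) out. *)
Lemma decoupling n Phi (B : R) : depends_on n Phi -> seq_continuous Phi ->
  (forall x, `|Phi x| <= B) ->
  \int[P]_w Phi (fun i => W (k i) w) =
  \int[Q]_z Phi (fun i => V' i z).
Proof.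
apply: Cramer_Wold => //.
- by move=> t; have [] := fourier_decoupled t n.
- by move=> t; have [] := fourier_decoupled t n.
Qed.

End decoupling.

(** After decoupling, and with the residues frozen, f is a function of a single
    normal variable z, whose derivative is df divided by the variance of W(g): the
    identity is Stein's. *)
Lemma gaussian_ibp (g : H) (k : nat -> H) n (f df : (nat -> R) -> R) (B : R) :
  depends_on n f -> depends_on n df -> seq_continuous f -> seq_continuous df ->
  (forall x, `|f x| <= B) -> (forall x, `|df x| <= B) ->
  (forall x, is_derive (0 : R) 1 (fun z => f (fun i => x i + z * ip g (k i))) (df x)) ->
  \int[P]_w (W g w * f (fun i => W (k i) w)) = \int[P]_w df (fun i => W (k i) w).
Proof.
move=> df_n ddf_n cf cdf fB dfB f'.
have mf : measurable_fun setT (fun w => f (fun i => W (k i) w)).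
  by apply: measurable_seq_continuous df_n cf => i; exact: mW.
(* if g = 0, both W(g) and the direction of derivation vanish *)
have [g0|gn0] := eqVneq (ip g g) 0.
  have k0 i : ip g (k i) = 0.
    move: g0; rewrite ip_norm// => /eqP; rewrite sqrf_eq0 normr_eq0 => /eqP ->.
    exact: ip0l.
  have df0 x : df x = 0.
    have [_ <-] := f' x; under eq_fun do under eq_fun do rewrite k0 mulr0.
    exact: derive_cst.
  under [RHS]eq_Rintegral do rewrite df0.
  apply: Rint_ae_eq => //; first exact: measurable_funM.
  apply: filterS (isonormal_ae0 iso g0) => w W0 _.
  by rewrite W0// mul0r.
pose s := `|g|.
have gs : ip g g = s ^+ 2 by rewrite ip_norm.
have s0 : 0 < s by rewrite lt_neqAle normr_ge0 andbT eq_sym -sqrf_eq0 -gs.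
pose N : probability _ R := normal_prob 0 s.
pose Q : probability _ R := (P \x N)%E.
pose k' i := if i is j.+1 then k j else g.
pose b i := ip g (k' i) / s ^+ 2.
pose V' i (z : Omega * measurableTypeR R) : R := W (k' i) z.1 - b i * W g z.1 + b i * z.2.
have b0 : b 0%N = 1 by rewrite /b /= gs divff// sqrf_eq0 gt_eqF.
have V'0 z : V' 0%N z = z.2 by rewrite /V' b0 /=; ring.
have mV' i : measurable_fun setT (V' i).
  apply: measurable_funD; last exact: measurable_funM.
  apply: measurable_funB; first exact: (measurableT_comp (mW _)).
  by apply: measurable_funM => //; exact: (measurableT_comp (mW _)).
have B0 : 0 <= B by apply: le_trans (fB (fun=> 0)).
pose shift (x : nat -> R) i := x i.+1.
have c_shift F : seq_continuous F -> seq_continuous (fun x => F (shift x)).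
  by move=> cF xs x xsx; apply: cF => i; exact: xsx.
have d_shift F : depends_on n F -> depends_on n.+1 (fun x => F (shift x)).
  by move=> dF x y xy; apply: dF => i ni; apply: xy.
have mfV : measurable_fun setT (fun z => f (fun i => V' i.+1 z)).
  by apply: (measurable_seq_continuous _ df_n cf) => i; exact: mV'.
have mdfV : measurable_fun setT (fun z => df (fun i => V' i.+1 z)).
  by apply: (measurable_seq_continuous _ ddf_n cdf) => i; exact: mV'.
(* W(g) is unbounded: it is reached through truncations *)
pose clamp (m : nat) (y : R) : R := Num.max (- m%:R) (Num.min y m%:R).
have clampB m y : `|clamp m y| <= m%:R.
  by rewrite ler_norml /clamp le_max lexx /= ge_max ge_min lexx orbT andbT ge0_cp.
have clamp_le m y : `|clamp m y| <= `|y|.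
  have m0 : 0 <= m%:R :> R by [].
  have Nm0 : - m%:R <= 0 :> R by rewrite oppr_le0.
  rewrite /clamp; have [ym|my] := leP y m%:R.
    have [my'|//] := leP y (- m%:R).
    by rewrite normrN ger0_norm// ler_normr; apply/orP; right; rewrite lerNr.
  rewrite (max_idPr _) ?(le_trans Nm0)// ger0_norm//.
  by rewrite (le_trans (ltW my))// ler_norm.
have clamp_cvg y : clamp m y @[m --> \oo] --> y.
  apply: cvg_near_cst; near=> m; have : `|y| <= m%:R.
    by near: m; exact: nbhs_infty_ger.
  by rewrite ler_norml /clamp => /andP[h1 /min_idPl ->]; exact/max_idPr.
have mclamp m : measurable_fun setT (clamp m).
  by apply: measurable_maxr => //; exact: measurable_minr.
have cclamp m : continuous (clamp m).
  move=> y; have h1 : {for y, continuous (fun=> - m%:R : R^o)} by exact: cvg_cst.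
  have h2 : {for y, continuous ((fun y : R => y : R^o) \min (fun=> m%:R : R^o))}.
    by apply: continuous_min; [exact: cvg_id|exact: cvg_cst].
  exact: (continuous_max h1 h2).
have trunc m : \int[P]_w (clamp m (W g w) * f (fun i => W (k i) w)) =
    \int[Q]_z (clamp m z.2 * f (fun i => V' i.+1 z)).
  have := @decoupling g k' s s0 gs n.+1 (fun x => clamp m (x 0%N) * f (shift x))
    (m%:R * B) _ _ _.
  rewrite -/b; have -> : \int[Q]_z (clamp m z.2 * f (fun i => V' i.+1 z)) =
    \int[Q]_z (clamp m (V' 0%N z) * f (fun i => V' i.+1 z)).
    by apply: eq_Rintegral => z _; rewrite V'0.
  apply.
  - move=> x y xy; congr (clamp m _ * _); first exact: xy.
    by apply: d_shift xy.
  - move=> xs x xsx; apply: cvgM; last exact: c_shift.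
    by apply: (cvg_comp _ _ (xsx 0%N)); exact: cclamp.
  - by move=> x; rewrite normrM ler_pM.
have zi : Q.-integrable setT (EFin \o (fun z : Omega * measurableTypeR R => B * `|z.2|)).
  apply: (@integrable_prod_le _ _ _ _ _ P N _ (fun x => B * `|x|)) => //.
  - by apply: measurable_funM => //; exact: measurableT_comp.
  - apply: integrableRZ => //; apply: integrableR_abs => //.
    by apply: sq_integrable_integrable; exact: sq_integrable_normal.
  - by move=> z; rewrite ger0_norm// mulr_ge0.
have Wi : P.-integrable setT (EFin \o (fun w => B * `|W g w|)).
  apply: integrableRZ => //; apply: integrableR_abs => //.
  by apply: sq_integrable_integrable; exact: isonormal_sq_integrable iso g.
have lim1 : (fun m => \int[P]_w (clamp m (W g w) * f (fun i => W (k i) w))) @ \oo -->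
    \int[P]_w (W g w * f (fun i => W (k i) w)).
  have e1 m : measurable_fun setT (fun w => clamp m (W g w) * f (fun i => W (k i) w)).
    by apply: measurable_funM => //; exact: measurableT_comp.
  have e2 : measurable_fun setT (fun w => W g w * f (fun i => W (k i) w)).
    exact: measurable_funM.
  have e4 m w : setT w -> `|clamp m (W g w) * f (fun i => W (k i) w)| <= B * `|W g w|.
    by move=> _; rewrite normrM mulrC ler_pM.
  have e5 : {ae P, forall w, setT w ->
     clamp m (W g w) * f (fun i => W (k i) w) @[m --> \oo] -->
     W g w * f (fun i => W (k i) w)}.
    by apply: aeW => w _; apply: cvgM; [exact: clamp_cvg|exact: cvg_cst].
  by have [] := @Rint_dominated _ _ _ P setT measurableT _ _ _ e1 e2 Wi e4 e5.
have m2 : measurable_fun setT (fun z : Omega * measurableTypeR R => z.2 * f (fun i => V' i.+1 z)).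
  exact: measurable_funM.
have [ziV lim2] : Q.-integrable setT (EFin \o (fun z => z.2 * f (fun i => V' i.+1 z))) /\
    (fun m => \int[Q]_z (clamp m z.2 * f (fun i => V' i.+1 z))) @ \oo -->
    \int[Q]_z (z.2 * f (fun i => V' i.+1 z)).
  have e1 m : measurable_fun setT (fun z : Omega * measurableTypeR R =>
      clamp m z.2 * f (fun i => V' i.+1 z)).
    by apply: measurable_funM => //; exact: (measurableT_comp (mclamp m) measurable_snd).
  have e4 m z : setT z -> `|clamp m z.2 * f (fun i => V' i.+1 z)| <= B * `|z.2|.
    by move=> _; rewrite normrM mulrC ler_pM.
  have e5 : {ae Q, forall z, setT z ->
     clamp m z.2 * f (fun i => V' i.+1 z) @[m --> \oo] -->
     z.2 * f (fun i => V' i.+1 z)}.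
    by apply: aeW => z _; apply: cvgM; [exact: clamp_cvg|exact: cvg_cst].
  exact: (@Rint_dominated _ _ _ Q setT measurableT _ _ _ e1 m2 zi e4 e5).
transitivity (\int[Q]_z (z.2 * f (fun i => V' i.+1 z))).
  apply: (cvg_unique _ lim1) => //=; move: lim2; apply: cvg_trans.
  by apply: near_eq_cvg; apply: nearW => m; rewrite trunc.
have dfi : Q.-integrable setT (EFin \o (fun z => df (fun i => V' i.+1 z))).
  exact: (@integrable_bounded _ _ _ Q B).
transitivity (\int[Q]_z df (fun i => V' i.+1 z)); last first.
  apply/esym.
  exact: (@decoupling g k' s s0 gs n.+1 (fun x => df (shift x)) B (d_shift _ ddf_n)
    (c_shift _ cdf) (fun x => dfB _)).
rewrite -(Rint_prod1 ziV) -(Rint_prod1 dfi) /=.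
apply: eq_Rintegral => w _.
pose y i := W (k i) w - b i.+1 * W g w.
pose F z := f (fun i => y i + b i.+1 * z).
pose dF z := df (fun i => y i + b i.+1 * z) / s ^+ 2.
have ss0 : s ^+ 2 != 0 by rewrite sqrf_eq0 gt_eqF.
have F' z : is_derive (z : R) 1 F (dF z).
  have h1 : is_derive z 1 (fun u : R => (u - z) / s ^+ 2) (s ^- 2).
    by apply: is_derive_eq; rewrite /GRing.scale /=; ring.
  have h2 := f' (fun i => y i + b i.+1 * z).
  have := @is_derive1_comp _ (fun u => f (fun i => y i + b i.+1 * z + u * ip g (k i)))
     (fun u : R => (u - z) / s ^+ 2) z _ _ _ h1.
  rewrite subrr mul0r => /(_ _ h2); rewrite -/(dF z).
  rewrite (_ : _ \o _ = F)//; apply/funext => u; rewrite /F /=.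
  congr f; apply/funext => i; rewrite /b /=; field.
  by rewrite gt_eqF.
have cdF : continuous dF.
  move=> z; apply: cvgM; last exact: cvg_cst.
  apply/(@cvg_nbhsP R^o R^o) => u uz; apply: cdf => i.
  apply: cvgD; first exact: cvg_cst.
  by apply: cvgM => //; exact: cvg_cst.
have BC : B <= B + B / s ^+ 2 by rewrite lerDl divr_ge0// sqr_ge0.
have FB z : `|F z| <= (B + B / s ^+ 2) * (1 + `|z|).
  rewrite (le_trans (fB _))// (le_trans BC)// ler_peMr ?lerDl//.
  by rewrite addr_ge0// divr_ge0// sqr_ge0.
have dFB z : `|dF z| <= B + B / s ^+ 2.
  rewrite normrM normfV (ger0_norm (sqr_ge0 s)) (@le_trans _ _ (B / s ^+ 2)) ?lerDr//.
  by rewrite ler_wpM2r// invr_ge0 sqr_ge0.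
have := stein_normal s0 F' cdF FB dFB; rewrite -/N => E.
transitivity (\int[N]_x (x * F x)) => //.
rewrite E -RintZ//.
  by apply: eq_Rintegral => x _; rewrite /dF mulrC divfK.
apply: (@integrable_bounded _ _ _ N (B + B / s ^+ 2)) => //.
exact: continuous_measurable_fun.
Unshelve. all: end_near. Qed.

End gaussian_ibp.

(** * Smooth functionals of the isonormal process *)

Section tame_functions.
Context {R : realType}.
Implicit Types (c x : nat -> R) (F dF : (nat -> R) -> R).

(** Smooth functions of finitely many coordinates with their derivative along c.
    They are functions of whole sequences so that functions of different numbers of
    coordinates can be multiplied as they are. *)
Definition tame c F dF := exists n (B : R),
  [/\ depends_on n F, depends_on n dF, seq_continuous F & seq_continuous dF] /\
  [/\ forall x, `|F x| <= B, forall x, `|dF x| <= B &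
      forall x, is_derive (0 : R) 1 (fun z => F (fun i => x i + z * c i)) (dF x)].

Definition row_of n x : 'rV[R]_n.+1 := \row_i x i.

Lemma row_of_cvg n (xs : nat -> nat -> R) x :
  (forall i, xs k i @[k --> \oo] --> x i) -> row_of n (xs k) @[k --> \oo] --> row_of n x.
Proof.
move=> xsx; apply/cvg_ballP => e e0.
have H (i : 'I_1) (j : 'I_n.+1) : \forall k \near \oo,
    ball (row_of n x i j) e (row_of n (xs k) i j).
  rewrite !mxE; near=> k; rewrite mxE.
  by near: k; have /cvg_ballP := xsx j; exact.
have : \forall k \near \oo, forall i j, ball (row_of n x i j) e (row_of n (xs k) i j).
  by apply: filter_forall => i; apply: filter_forall => j; exact: H.
by apply: filterS => k Hk.
Unshelve. all: end_near. Qed.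

Lemma derive_line n (f : 'rV[R]_n.+1 -> R^o) (a v : 'rV[R]_n.+1) :
  differentiable f a ->
  is_derive (0 : R) 1 (fun z : R => f (a + z *: v)) ('D_v f a).
Proof.
move=> df; have dv := diff_derivable (v := v) df.
have E : (fun h : R => h^-1 *: (((fun z : R => f (a + z *: v)) \o shift 0) (h *: (1 : R^o)) -
    f (a + 0 *: v))) = (fun h : R => h^-1 *: ((f \o shift a) (h *: v) - f a)).
  apply/funext => h /=; rewrite !addr0 scale0r addr0 -/(h *: 1) scaler1.
  by rewrite [a + _]addrC.
by split; [rewrite /derivable E|rewrite /derive E].
Qed.

Lemma derive_row n (f : 'rV[R]_n.+1 -> R^o) (a v : 'rV[R]_n.+1) :
  differentiable f a -> 'D_v f a = \sum_(i < n.+1) partial i f a * v 0 i.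
Proof.
move=> df; rewrite deriveE// [in LHS](row_sum_delta v) linear_sum.
apply: eq_bigr => i _; rewrite linearZ /= /partial deriveE//.
by rewrite mulrC.
Qed.

Lemma cvgn_sum (I : Type) (r : seq I) (u : nat -> I -> R) (l : I -> R) :
  (forall i, u k i @[k --> \oo] --> l i) ->
  \sum_(i <- r) u k i @[k --> \oo] --> \sum_(i <- r) l i.
Proof.
move=> ul; elim: r => [|i r IH].
  by rewrite big_nil; under eq_fun do rewrite big_nil; exact: cvg_cst.
by rewrite big_cons; under eq_fun do rewrite big_cons; exact: cvgD.
Qed.

Lemma tame_schwartz n (f : 'rV[R]_n.+1 -> R^o) c : schwartz f ->
  tame c (fun x => f (row_of n x))
         (fun x => \sum_(i < n.+1) partial i f (row_of n x) * c i).
Proof.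
move=> sf.
have bnd s : exists C, forall y, `|partials s f y| <= C.
  have [_ /(_ 0%N)[C HC]] := sf s; exists C => y.
  by have := HC y; rewrite expr0 mul1r.
have cont s : continuous (partials s f).
  by move=> y; apply: differentiable_continuous; have [+ _] := sf s; exact.
have df y : differentiable f y by have [/(_ y)] := sf [::].
have [C HC] := bnd [::].
have /choice[D HD] : forall i : 'I_n.+1, exists C, forall y, `|partial i f y| <= C.
  by move=> i; exact: (bnd [:: i]).
have dep : forall x y, (forall i, (i < n.+1)%N -> x i = y i) -> row_of n x = row_of n y.
  by move=> x y xy; apply/rowP => i; rewrite !mxE xy.
have C0 : 0 <= C by apply: le_trans (HC 0).
have D0 i : 0 <= D i by apply: le_trans (HD i 0).
have S0 : 0 <= \sum_(i < n.+1) D i * `|c i|.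
  by apply: sumr_ge0 => i _; rewrite mulr_ge0.
exists n.+1, (C + \sum_(i < n.+1) D i * `|c i|); split; split.
- by move=> x y /dep ->.
- by move=> x y /dep ->.
- move=> xs x xsx; apply: (cvg_comp _ _ (row_of_cvg xsx)).
  exact: (cont [::]).
- move=> xs x xsx; apply: cvgn_sum => i; apply: cvgM; last exact: cvg_cst.
  apply: (cvg_comp _ _ (row_of_cvg xsx)).
  exact: (cont [:: i]).
- by move=> x; rewrite (le_trans (HC _))// lerDl.
- move=> x; rewrite (le_trans (ler_norm_sum _ _ _))//.
  rewrite (@le_trans _ _ (\sum_(i < n.+1) D i * `|c i|))// ?lerDr//.
  by apply: ler_sum => i _; rewrite normrM ler_wpM2r.
- move=> x; have := derive_line (row_of n c) (df (row_of n x)).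
  rewrite derive_row// (eq_bigr (fun i : 'I_n.+1 => partial i f (row_of n x) * c i)); last first.
    by move=> i _; rewrite mxE.
  rewrite (_ : (fun z => f (row_of n x + z *: row_of n c)) =
    (fun z => f (row_of n (fun i => x i + z * c i))))//.
  apply/funext => z; congr f; apply/rowP => i.
  by rewrite !mxE.
Qed.

(** Unlike Schwartz functions, this class contains F phi(G) for functions F and G
    of different numbers of variables. *)
Lemma tame_mul_comp c F dF G dG (phi dphi : R -> R) (M : R) :
  tame c F dF -> tame c G dG ->
  (forall y : R, is_derive y 1 phi (dphi y)) -> continuous dphi ->
  (forall y, `|phi y| <= M) -> (forall y, `|dphi y| <= M) ->
  tame c (fun x => F x * phi (G x))
         (fun x => dF x * phi (G x) + F x * (dphi (G x) * dG x)).
Proof.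
move=> [n [B [[F1 F2 F3 F4] [F5 F6 F7]]]] [m [B' [[G1 G2 G3 G4] [G5 G6 G7]]]] phi' cdphi Mphi Mdphi.
have cphi := is_derive_continuous phi'.
have weak k l (E : (nat -> R) -> R) : (k <= l)%N -> depends_on k E -> depends_on l E.
  by move=> kl dE x y xy; apply: dE => i ik; apply: xy; exact: leq_trans kl.
have M0 : 0 <= M by apply: le_trans (Mphi 0).
have B0 : 0 <= B by apply: le_trans (F5 (fun=> 0)).
have B'0 : 0 <= B' by apply: le_trans (G5 (fun=> 0)).
have nl : (n <= maxn n m)%N by exact: leq_maxl.
have ml : (m <= maxn n m)%N by exact: leq_maxr.
exists (maxn n m), (B * M + (B * M + B * (M * B'))); split; split.
- by move=> x y xy; rewrite (weak _ _ _ nl F1 _ _ xy) (weak _ _ _ ml G1 _ _ xy).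
- move=> x y xy; rewrite (weak _ _ _ nl F1 _ _ xy) (weak _ _ _ ml G1 _ _ xy).
  by rewrite (weak _ _ _ nl F2 _ _ xy) (weak _ _ _ ml G2 _ _ xy).
- move=> xs x xsx; apply: cvgM; first exact: F3.
  by apply: (cvg_comp _ _ (G3 _ _ xsx)); exact: cphi.
- move=> xs x xsx; apply: cvgD.
    apply: cvgM; first exact: F4.
    by apply: (cvg_comp _ _ (G3 _ _ xsx)); exact: cphi.
  apply: cvgM; first exact: F3.
  apply: cvgM; last exact: G4.
  by apply: (cvg_comp _ _ (G3 _ _ xsx)); exact: cdphi.
- move=> x; rewrite normrM (@le_trans _ _ (B * M)) ?ler_pM//.
  by rewrite lerDl addr_ge0// !mulr_ge0.
- move=> x; rewrite (le_trans (ler_normD _ _))// !normrM.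
  rewrite (@le_trans _ _ (B * M + B * (M * B'))) ?lerDr ?mulr_ge0//.
  by rewrite lerD// ler_pM// ?mulr_ge0// ler_pM.
- move=> x.
  have E y : (fun i => y i + 0 * c i) = y.
    by apply/funext => i; rewrite mul0r addr0.
  have h1 := F7 x.
  have h2 := @is_derive1_comp _ phi (fun z => G (fun i => x i + z * c i)) 0 _ _ (phi' _) (G7 x).
  apply: (is_derive_eq (is_deriveM h1 h2)).
  by rewrite /GRing.scale /= !E; ring.
Qed.

End tame_functions.

(** * Integration by parts on the domain of the Malliavin derivative *)

Section borel_valued_theory.
Context {R : realType} d (Omega : measurableType d).
Context (H : completeNormedModType R).

Lemma borel_valued_comp (G : Omega -> H) (phi : H -> R) :
  borel_valued G -> continuous phi -> measurable_fun setT (fun w => phi (G w)).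
Proof.
move=> bG cphi.
apply: (measurability _ (RGenOInfty.measurableE R)) => //.
move=> _ [_ [x ->] <-]; rewrite setTI.
apply: (bG (phi @^-1` `]x, +oo[)).
apply: open_comp; first by move=> y _; exact: cphi.
by rewrite set_itvE; exact: open_gt.
Qed.

End borel_valued_theory.

Lemma cvgn_add_unique (R : realType) (a b c : nat -> R) (la lb lc : R) :
  a @ \oo --> la -> b @ \oo --> lb -> c @ \oo --> lc ->
  (forall k, a k = b k + c k) -> la = lb + lc.
Proof.
move=> al bl cl /funext E; rewrite E in al.
exact: (cvg_unique _ al (cvgD bl cl)).
Qed.

Section malliavin_calculus.
Context {R : realType} d (Omega : measurableType d) (P : probability Omega R).
Context (H : completeNormedModType R) (ip : H -> H -> R) (W : H -> Omega -> R).
Context (h : nat -> H).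
Hypotheses (hp : hilbert_product ip) (iso : isonormal P ip W).

Let V w i := W (h i) w.

Let mV i : measurable_fun setT (fun w => V w i).
Proof. exact: isonormal_measurable iso (h i). Qed.

Lemma tame_ibp g F dF : tame (fun i => ip g (h i)) F dF ->
  \int[P]_w (W g w * F (V w)) = \int[P]_w dF (V w).
Proof.
move=> [n [B [[F1 F2 F3 F4] [F5 F6 F7]]]].
exact: (gaussian_ibp hp iso F1 F2 F3 F4 F5 F6 F7).
Qed.

Lemma tame_meas c F dF : tame c F dF ->
  exists B, [/\ measurable_fun setT (fun w => F (V w)),
    measurable_fun setT (fun w => dF (V w)),
    forall w, `|F (V w)| <= B & forall w, `|dF (V w)| <= B].
Proof.
move=> [n [B [[F1 F2 F3 F4] [F5 F6 F7]]]]; exists B; split => //.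
  exact: (measurable_seq_continuous mV F1 F3).
exact: (measurable_seq_continuous mV F2 F4).
Qed.

(** Pairing the gradient with g differentiates along the direction whose
    coordinates are the products of g with the h i. *)
Lemma cylindrical_tame g F G : cylindrical W h F G ->
  exists Phi dPhi, [/\ tame (fun i => ip g (h i)) Phi dPhi,
    F = (fun w => Phi (V w)) & forall w, ip g (G w) = dPhi (V w)].
Proof.
move=> [n [f [sf -> ->]]].
exists (fun x => f (row_of n x)),
  (fun x => \sum_(i < n.+1) partial i f (row_of n x) * ip g (h i)).
split => //; first exact: tame_schwartz.
by move=> w; rewrite ip_sumr//; apply: eq_bigr => i _; rewrite ipZr.
Qed.

(* The norm of G - G' is expanded into scalar products with the h i, since sums of
   two measurable H-valued maps need not be measurable a priori. *)
Let cylindrical_dist F G G' : cylindrical W h F G -> borel_valued G' ->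
  measurable_fun setT (fun w => `|G w - G' w| ^+ 2).
Proof.
move=> cFG bG'.
have m1 v : measurable_fun setT (fun w => ip v (G w)).
  have [Phi [dPhi [tP _ E]]] := cylindrical_tame v cFG.
  have [B [_ m2 _ _]] := tame_meas tP.
  by under eq_fun do rewrite E.
have m2 v : measurable_fun setT (fun w => ip v (G' w)).
  by apply: borel_valued_comp => //; exact: ip_continuous.
have m3 : measurable_fun setT (fun w => `|G' w|).
  by apply: borel_valued_comp => // x; exact: norm_continuous.
have [n [f [sf _ EG]]] := cFG.
have mp i : measurable_fun setT (fun w => partial i f (coords W h n w)).
  have [n2 [B [[_ F2 _ F4] _]]] := tame_schwartz (fun j => (j == i :> nat)%:R) sf.
  have := measurable_seq_continuous mV F2 F4.
  congr (measurable_fun _ _); apply/funext => w.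
  rewrite (bigD1 i)//= eqxx mulr1 big1 ?addr0// => j ji.
  by rewrite (negbTE (_ : (j : nat) != i)) ?mulr0.
have E (K : Omega -> H) w : ip (G w) (K w) =
    \sum_(i < n.+1) partial i f (coords W h n w) * ip (h i) (K w).
  by rewrite EG ip_suml//; apply: eq_bigr => i _; rewrite ipZl.
have -> : (fun w => `|G w - G' w| ^+ 2) =
    (fun w => ip (G w) (G w) - 2 * ip (G w) (G' w) + `|G' w| ^+ 2).
  apply/funext => w; rewrite -!(ip_norm hp) (ipBr hp) -scaleN1r !(ipDl hp, ipZl hp).
  by rewrite (ipC hp (G' w) (G w)); ring.
apply: measurable_funD; last exact: measurable_funX.
apply: measurable_funB; last apply: measurable_funM => //.
  under eq_fun do rewrite E.
  by apply: measurable_sum => i; exact: measurable_funM.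
under eq_fun do rewrite E.
by apply: measurable_sum => i; exact: measurable_funM.
Qed.

(* A tail integral is finite, and one square-integrable function at finite
   distance from f0 is enough. *)
Let cvg_sq (f : nat -> Omega -> R) (f0 : Omega -> R) :
  (forall n, sq_integrable P setT (f n)) -> measurable_fun setT f0 ->
  (fun n => \int[P]_w ((f n w - f0 w) ^+ 2)%:E)%E @ \oo --> 0%E ->
  sq_integrable P setT f0 /\
  (fun n => \int[P]_w ((f n w - f0 w) ^+ 2)) @ \oo --> (0 : R).
Proof.
move=> sf mf0 cf; split; last exact: (fine_cvg cf).
have /fine_cvgP[[N _ fin] _] := cf.
have mfn n : measurable_fun setT (f n) by case: (sf n).
have sd : sq_integrable P setT (fun w => f N w - f0 w).
  split; first exact: measurable_funB.
  apply/integrableP; split.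
    by apply/measurable_EFinP; apply: measurable_funX; exact: measurable_funB.
  under eq_integral do rewrite /= ger0_norm ?sqr_ge0//.
  by have := fin N (leqnn N); rewrite fin_numElt => /andP[].
have := sq_integrableB measurableT (sf N) sd.
by under eq_fun do rewrite subKr.
Qed.

Let approximation g F G : gradient P W h F G ->
  exists (Phi dPhi : nat -> (nat -> R) -> R),
  [/\ forall k, tame (fun i => ip g (h i)) (Phi k) (dPhi k),
      sq_integrable P setT F /\ sq_integrable P setT (fun w => ip g (G w)),
      (fun k => \int[P]_w ((Phi k (V w) - F w) ^+ 2)) @ \oo --> (0 : R) &
      (fun k => \int[P]_w ((dPhi k (V w) - ip g (G w)) ^+ 2)) @ \oo --> (0 : R)].
Proof.
move=> [mF bG [Fn [Gn [cyl cF cG]]]].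
have /choice[Phi] := fun k => cylindrical_tame g (cyl k).
move=> /choice[dPhi E]; exists Phi, dPhi.
have t k : tame (fun i => ip g (h i)) (Phi k) (dPhi k) by case: (E k).
have sP k : sq_integrable P setT (fun w => Phi k (V w)).
  have [B [m1 _ b1 _]] := tame_meas (t k).
  exact: (@sq_integrable_bounded _ _ _ P B).
have sdP k : sq_integrable P setT (fun w => dPhi k (V w)).
  have [B [_ m1 _ b1]] := tame_meas (t k).
  exact: (@sq_integrable_bounded _ _ _ P B).
have mG : measurable_fun setT (fun w => ip g (G w)).
  by apply: borel_valued_comp => //; exact: ip_continuous.
have cF' : (fun k => \int[P]_w ((Phi k (V w) - F w) ^+ 2)%:E)%E @ \oo --> 0%E.
  move: cF; apply: cvg_trans; apply: near_eq_cvg; apply: nearW => k.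
  by apply: eq_integral => w _; case: (E k) => _ -> _.
have cG' : (fun k => \int[P]_w ((dPhi k (V w) - ip g (G w)) ^+ 2)%:E)%E @ \oo --> 0%E.
  have cG2 : (fun k => (`|g| ^+ 2)%:E * \int[P]_w (`|Gn k w - G w| ^+ 2)%:E)%E @ \oo --> 0%E.
    by rewrite -(mule0 (`|g| ^+ 2)%:E); apply: cvgeZl.
  apply: (squeeze_cvge _ (cvg_cst 0%E) cG2); apply: nearW => k; apply/andP; split.
    by apply: integral_ge0 => w _; rewrite lee_fin sqr_ge0.
  have mD := cylindrical_dist (cyl k) bG.
  have md : measurable_fun setT (fun w => dPhi k (V w)) by case: (sdP k).
  rewrite -ge0_integralZl//; last exact/measurable_EFinP.
  apply: ge0_le_integral => //.
  - by move=> w _; rewrite lee_fin sqr_ge0.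
  - by apply/measurable_EFinP; apply: measurable_funX; exact: measurable_funB.
  - by apply/measurable_EFinP; exact: measurable_funM.
  - move=> w _; rewrite lee_fin; case: (E k) => _ _ <-.
    rewrite -ipBr// -exprMn -(real_normK (num_real (ip _ _))).
    by rewrite lerXn2r ?nnegrE// ?mulr_ge0// ip_CS.
have [s1 c1] := cvg_sq sP mF cF'.
have [s2 c2] := cvg_sq sdP mG cG'.
by split.
Qed.

Lemma gradient_sq_integrable g F G : gradient P W h F G ->
  sq_integrable P setT F /\ sq_integrable P setT (fun w => ip g (G w)).
Proof. by move=> /(approximation g)[Phi [dPhi []]]. Qed.

Section product_rule.
Variables (g : H) (A B : Omega -> R) (GA GB : Omega -> H).
Hypotheses (gA : gradient P W h A GA) (gB : gradient P W h B GB).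
Variables (phi dphi : R -> R) (M L : R).
Hypotheses (phi' : forall y : R, is_derive y 1 phi (dphi y)).
Hypotheses (phiM : forall y, `|phi y| <= M) (dphiM : forall y, `|dphi y| <= M).
Hypotheses (phiL : forall x y, `|phi x - phi y| <= L * `|x - y|).
Hypotheses (dphiL : forall x y, `|dphi x - dphi y| <= L * `|x - y|).

Let L0 : 0 <= L.
Proof. by have := phiL 1 0; rewrite subr0 normr1 mulr1; exact: le_trans. Qed.

Let lip_continuous (f : R -> R) : (forall x y, `|f x - f y| <= L * `|x - y|) ->
  continuous f.
Proof.
move=> fL x; apply/cvgrPdist_le => e e0.
have L1 : 0 < L + 1 by rewrite ltr_wpDl.
near=> y.
rewrite (le_trans (fL _ _))// (@le_trans _ _ ((L + 1) * `|x - y|))//.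
  by rewrite ler_wpM2r// lerDl.
rewrite -ler_pdivlMl//; near: y; apply: cvgr_dist_le; first exact: cvg_id.
by rewrite mulr_gt0// invr_gt0.
Unshelve. all: end_near. Qed.

Let mphi : measurable_fun setT phi.
Proof. exact: continuous_measurable_fun (lip_continuous phiL). Qed.

Let mdphi : measurable_fun setT dphi.
Proof. exact: continuous_measurable_fun (lip_continuous dphiL). Qed.

Let lip_cvg (f : R -> R) (M' : R) (Bn : nat -> Omega -> R) : measurable_fun setT f ->
  (forall y, `|f y| <= M') ->
  (forall x y, `|f x - f y| <= L * `|x - y|) ->
  (forall n, sq_integrable P setT (Bn n)) -> sq_integrable P setT B ->
  (fun n => \int[P]_w ((Bn n w - B w) ^+ 2)) @ \oo --> (0 : R) ->
  (fun n => \int[P]_w ((f (Bn n w) - f (B w)) ^+ 2)) @ \oo --> (0 : R).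
Proof.
move=> mf fM fL sBn sB cB.
have cL : (fun n => L ^+ 2 * \int[P]_w ((Bn n w - B w) ^+ 2)) @ \oo --> (0 : R).
  by rewrite -(mulr0 (L ^+ 2)); apply: cvgM => //; exact: cvg_cst.
apply: (squeeze_cvgr _ (cvg_cst 0) cL); apply: nearW => n; apply/andP; split.
  by apply: Rintegral_ge0 => w _; exact: sqr_ge0.
have sd := sq_integrableB measurableT (sBn n) sB.
have sf (X : Omega -> R) : sq_integrable P setT X -> sq_integrable P setT (fun w => f (X w)).
  by move=> [mX _]; apply: (@sq_integrable_bounded _ _ _ P M') => //; exact: measurableT_comp.
have [_ i1] := sq_integrableB measurableT (sf _ (sBn n)) (sf _ sB).
case: sd => md id; rewrite -RintZ//; apply: le_Rintegral => //.
  exact: integrableRZ.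
move=> w _; rewrite -exprMn -(real_normK (num_real (f _ - f _))).
rewrite -(real_normK (num_real (L * _))) lerXn2r ?nnegrE//.
by rewrite normrM (ger0_norm L0).
Qed.

Let sq1 : sq_integrable P setT (fun=> 1 : R).
Proof. by apply: (@sq_integrable_bounded _ _ _ P 1) => // x; rewrite normr1. Qed.

Let cst_cvg (f : Omega -> R) :
  (fun n : nat => \int[P]_w ((f w - f w) ^+ 2)) @ \oo --> (0 : R).
Proof.
under eq_fun do under eq_Rintegral do rewrite subrr expr0n /=.
by under eq_fun do rewrite Rint_cst; exact: cvg_cst.
Qed.

(** Integration by parts with the product and chain rules built in. The closure
    is taken in B first, with A smooth and bounded, and then in A, with phi(B)
    bounded: each step only passes to the limit in products of two functions
    converging in L^2, although the product A phi(B) need not be in the domain. *)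
Lemma malliavin_ibp :
  \int[P]_w (W g w * (A w * phi (B w))) =
  \int[P]_w (phi (B w) * ip g (GA w)) +
  \int[P]_w (dphi (B w) * A w * ip g (GB w)).
Proof.
have [An [dAn [tA [sA sdA] cA cdA]]] := approximation g gA.
have [Bn [dBn [tB [sB sdB] cB cdB]]] := approximation g gB.
have cdphi := lip_continuous dphiL.
have M0 : 0 <= M by apply: le_trans (phiM 0).
have sW := isonormal_sq_integrable iso g.
have bA k := tame_meas (tA k); have bB k := tame_meas (tB k).
have sAn k : sq_integrable P setT (fun w => An k (V w)).
  by have [C [m1 _ b1 _]] := bA k; exact: (@sq_integrable_bounded _ _ _ P C).
have sdAn k : sq_integrable P setT (fun w => dAn k (V w)).
  by have [C [_ m1 _ b1]] := bA k; exact: (@sq_integrable_bounded _ _ _ P C).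
have sBn k : sq_integrable P setT (fun w => Bn k (V w)).
  by have [C [m1 _ b1 _]] := bB k; exact: (@sq_integrable_bounded _ _ _ P C).
have sdBn k : sq_integrable P setT (fun w => dBn k (V w)).
  by have [C [_ m1 _ b1]] := bB k; exact: (@sq_integrable_bounded _ _ _ P C).
have sf (f : R -> R) (X : Omega -> R) : measurable_fun setT f -> (forall y, `|f y| <= M) ->
    sq_integrable P setT X -> sq_integrable P setT (fun w => f (X w)).
  move=> mf fM [mX _]; apply: (@sq_integrable_bounded _ _ _ P M) => //.
  exact: measurableT_comp.
have mphiB : measurable_fun setT (fun w => phi (B w)).
  by apply: measurableT_comp => //; case: sB.
have mdphiB : measurable_fun setT (fun w => dphi (B w)).
  by apply: measurableT_comp => //; case: sB.
have step1 k : \int[P]_w (An k (V w) * W g w * phi (B w)) =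
    \int[P]_w (dAn k (V w) * 1 * phi (B w)) +
    \int[P]_w (An k (V w) * dphi (B w) * ip g (GB w)).
  have [C [mAk mdAk bAk bdAk]] := bA k.
  have l0 := Rint_cvg_prod measurableT (m := P) mAk (fun w _ => bAk w) (fun=> sW) sW
    (fun l => sf _ _ mphi phiM (sBn l)) (sf _ _ mphi phiM sB) (cst_cvg _)
    (lip_cvg mphi phiM phiL sBn sB cB).
  have l1 := Rint_cvg_prod measurableT (m := P) mdAk (fun w _ => bdAk w) (fun=> sq1) sq1
    (fun l => sf _ _ mphi phiM (sBn l)) (sf _ _ mphi phiM sB) (cst_cvg _)
    (lip_cvg mphi phiM phiL sBn sB cB).
  have l2 := Rint_cvg_prod measurableT (m := P) mAk (fun w _ => bAk w)
    (fun l => sf _ _ mdphi dphiM (sBn l)) (sf _ _ mdphi dphiM sB) sdBn sdB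
    (lip_cvg mdphi dphiM dphiL sBn sB cB) cdB.
  apply: (cvgn_add_unique l0 l1 l2) => l /=.
  have tAB := tame_mul_comp (tA k) (tB l) phi' cdphi phiM dphiM.
  have [_ m1] := sf _ _ mphi phiM (sBn l).
  have i1 : P.-integrable setT (EFin \o (fun w => dAn k (V w) * 1 * phi (Bn l (V w)))).
    under eq_fun do rewrite mulr1.
    exact: (sq_integrableM measurableT (sdAn k) (sf _ _ mphi phiM (sBn l))).
  have i2 : P.-integrable setT (EFin \o (fun w => An k (V w) * dphi (Bn l (V w)) * dBn l (V w))).
    apply: (sq_integrableM measurableT _ (sdBn l)).
    exact: (sq_integrableM_bounded measurableT mAk (fun w _ => bAk w) (sf _ _ mdphi dphiM (sBn l))).
  rewrite -RintD//; transitivity (\int[P]_w (W g w * (An k (V w) * phi (Bn l (V w))))).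
    by apply: eq_Rintegral => w _; ring.
  by rewrite (tame_ibp tAB); apply: eq_Rintegral => w _; ring.
have l0 := Rint_cvg_prod measurableT (m := P) mphiB (fun w _ => phiM _) (fun=> sW) sW
  sAn sA (cst_cvg _) cA.
have l1 := Rint_cvg_prod measurableT (m := P) mphiB (fun w _ => phiM _) (fun=> sq1) sq1
  sdAn sdA (cst_cvg _) cdA.
have l2 := Rint_cvg_prod measurableT (m := P) mdphiB (fun w _ => dphiM _) sAn sA
  (fun=> sdB) sdB cA (cst_cvg _).
transitivity (\int[P]_w (phi (B w) * W g w * A w)).
  by apply: eq_Rintegral => w _; ring.
transitivity (\int[P]_w (phi (B w) * 1 * ip g (GA w)) +
  \int[P]_w (dphi (B w) * A w * ip g (GB w))); last first.
  by congr (_ + _); apply: eq_Rintegral => w _; ring.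
apply: (cvgn_add_unique l0 l1 l2) => k /=.
transitivity (\int[P]_w (An k (V w) * W g w * phi (B w))).
  by apply: eq_Rintegral => w _; ring.
rewrite step1.
by congr (_ + _); apply: eq_Rintegral => w _; ring.
Qed.

End product_rule.

(** The case phi = 1 of the previous lemma. *)
Lemma malliavin_ibp1 g F G : gradient P W h F G ->
  \int[P]_w (W g w * F w) = \int[P]_w ip g (G w).
Proof.
move=> gF.
have h1 (y : R) : is_derive y 1 (fun=> 1 : R) 0 by exact: is_derive_cst.
have h2 (y : R) : `|1 : R| <= 1 by rewrite normr1.
have h3 (y : R) : `|0 : R| <= 1 by rewrite normr0.
have h4 (c x y : R) : `|c - c| <= 1 * `|x - y| by rewrite subrr normr0 mulr_ge0.
have := malliavin_ibp g gF gF h1 h2 h3 (h4 1) (h4 0).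
under eq_Rintegral do rewrite mulr1; move=> ->.
under eq_Rintegral do rewrite mul1r.
rewrite (_ : \int[P]_w (0 * F w * ip g (G w)) = 0) ?addr0//.
by under eq_Rintegral do rewrite !mul0r; rewrite Rint_cst.
Qed.

End malliavin_calculus.

(** * Integrals over the strip *)

Section partial_integrals.
Context d1 d2 (T1 : measurableType d1) (T2 : measurableType d2) (R : realType).
Variable m : {sigma_finite_measure set T2 -> \bar R}.

(** Positive and negative parts are integrated separately by Tonelli's theorem; their
    difference is then measurable even where both are infinite. *)
Lemma measurable_partial_integral (g : T1 * T2 -> R) : measurable_fun setT g ->
  measurable_fun setT (fun x => \int[m]_y g (x, y)).
Proof.
move=> mg; rewrite /Rintegral; apply: measurableT_comp => //.
pose G := EFin \o g; have mG : measurable_fun setT G by exact/measurable_EFinP.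
rewrite (_ : (fun x => _) = (fun x => fubini_F m G^\+ x - fubini_F m G^\- x)%E); last first.
  apply/funext => x; rewrite /fubini_F integralE /=.
  by congr (_ - _)%E; apply: eq_integral => y _; rewrite unlock.
apply: emeasurable_funB.
- apply: measurable_fun_fubini_tonelli_F; first exact: measurable_funepos.
  exact: funepos_ge0.
- apply: measurable_fun_fubini_tonelli_F; first exact: measurable_funeneg.
  exact: funeneg_ge0.
Qed.

End partial_integrals.

Section strip_integrals.
Context d (Omega : measurableType d) {R : realType} (P : probability Omega R).
Variables (mu : {finite_measure set (measurableTypeR R) -> \bar R}) (T : R).

Let I : set (measurableTypeR R) := [set` `[0, T]].

Let mI : measurable I. Proof. exact: measurable_itv. Qed.

Lemma measurable_strip : measurable (strip T : set (Omega * measurableTypeR R)).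
Proof. exact: measurableX. Qed.

Let mS := measurable_strip.

Implicit Types f : Omega * measurableTypeR R -> R.

Let patch_in f w t : I t -> (f \_ (strip T)) (w, t) = f (w, t).
Proof. by move=> It; rewrite patchE mem_set. Qed.

Let patch_out f w t : ~ I t -> (f \_ (strip T)) (w, t) = 0.
Proof. by move=> It; rewrite patchE memNset// => -[]. Qed.

Let measurable_patch f : measurable_fun (strip T) f -> measurable_fun setT (f \_ (strip T)).
Proof. by move=> mf; apply/(measurable_restrictT _ mS). Qed.

Let section_patch f w : (fun t => (f \_ (strip T)) (w, t)) = (fun t => f (w, t)) \_ I.
Proof.
apply/funext => t; rewrite !patchE; congr (if _ then _ else _).
by apply/idP/idP; rewrite !inE /strip /=; [case|].
Qed.

Lemma measurable_strip_section f t : measurable_fun (strip T) f -> t \in `[0, T] ->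
  measurable_fun setT (fun w => f (w, t)).
Proof.
move=> /measurable_patch mf It.
have := measurableT_comp mf (measurable_pair2 (t : measurableTypeR R)).
by congr (measurable_fun _ _); apply/funext => w /=; rewrite patch_in.
Qed.

Lemma measurable_strip_Rint f : measurable_fun (strip T) f ->
  measurable_fun setT (fun w => \int[mu]_(t in `[0, T]) f (w, t)).
Proof.
move=> /measurable_patch mf; have := measurable_partial_integral mu mf.
congr (measurable_fun _ _); apply/funext => w.
by rewrite section_patch -Rintegral_mkcond.
Qed.

Lemma strip_Tonelli1 f : measurable_fun (strip T) f -> (forall z, 0 <= f z) ->
  (\int[(P \x mu)%E]_(z in strip T) (f z)%:E =
   \int[P]_w \int[mu]_(t in `[0%R, T]) (f (w, t))%:E)%E.
Proof.
move=> /measurable_patch mf f0.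
rewrite integral_mkcond restrict_EFin.
rewrite (fubini_tonelli1 (EFin \o (f \_ (strip T)))).
- apply: eq_integral => w _; rewrite /fubini_F /=.
  rewrite [RHS]integral_mkcond restrict_EFin; apply: eq_integral => t _ /=.
  by have /(congr1 (fun F => F t)) /= -> := section_patch f w.
- exact/measurable_EFinP.
- by move=> z; rewrite /= lee_fin patchE; case: ifP.
Qed.

Lemma strip_Tonelli2 f : measurable_fun (strip T) f -> (forall z, 0 <= f z) ->
  (\int[(P \x mu)%E]_(z in strip T) (f z)%:E =
   \int[mu]_(t in `[0%R, T]) \int[P]_w (f (w, t))%:E)%E.
Proof.
move=> /measurable_patch mf f0.
rewrite integral_mkcond restrict_EFin.
rewrite (fubini_tonelli2 (EFin \o (f \_ (strip T)))).
- rewrite [RHS]integral_mkcond; apply: eq_integral => t _.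
  rewrite /fubini_G patchE; case: ifPn => [/set_mem It|/negP nIt].
    by apply: eq_integral => w _ /=; rewrite patch_in.
  rewrite (eq_integral (cst 0%E)) ?integral0// => w _ /=.
  by rewrite patch_out// => It; apply: nIt; exact/mem_set.
- exact/measurable_EFinP.
- by move=> z; rewrite /= lee_fin patchE; case: ifP.
Qed.

Section strip_Fubini.
Variable f : Omega * measurableTypeR R -> R.
Hypothesis fi : (P \x mu)%E.-integrable (strip T) (EFin \o f).

Let fi' : (P \x mu)%E.-integrable setT (EFin \o (f \_ (strip T))).
Proof. by rewrite -restrict_EFin; apply/(integrable_mkcond _ mS). Qed.

Lemma strip_Rint1 : \int[P]_w \int[mu]_(t in `[0, T]) f (w, t) =
  \int[(P \x mu)%E]_(z in strip T) f z.
Proof.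
rewrite [RHS]Rintegral_mkcond -(Rint_prod1 fi'); apply: eq_Rintegral => w _.
by rewrite section_patch -Rintegral_mkcond.
Qed.

Lemma strip_integrable1 :
  P.-integrable setT (EFin \o (fun w => \int[mu]_(t in `[0, T]) f (w, t))).
Proof.
have := integrable_Rint1 fi'; congr (integrable _ _ (EFin \o _)).
by apply/funext => w; rewrite section_patch -Rintegral_mkcond.
Qed.

Lemma strip_integrable_section :
  {ae P, forall w, mu.-integrable `[0, T] (EFin \o (fun t => f (w, t)))}.
Proof.
apply: filterS (ae_integrable1 fi') => w /=.
rewrite (_ : (fun y => _) = EFin \o ((fun t => f (w, t)) \_ I)).
  by rewrite -restrict_EFin => /(integrable_mkcond _ mI).
by apply/funext => t /=; have /(congr1 (fun F => F t)) /= -> := section_patch f w.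
Qed.

Lemma strip_integral1 :
  (\int[P]_w \int[mu]_(t in `[0%R, T]) (f (w, t))%:E =
   (\int[(P \x mu)%E]_(z in strip T) f z)%:E)%E.
Proof.
rewrite EFin_Rint//.
rewrite [RHS]integral_mkcond restrict_EFin -(integral12_prod_meas1 fi').
apply: eq_integral => w _; rewrite /fubini_F.
rewrite [LHS]integral_mkcond restrict_EFin; apply: eq_integral => t _ /=.
by have /(congr1 (fun F => F t)) /= -> := section_patch f w.
Qed.

Lemma strip_Rint2 : \int[(P \x mu)%E]_(z in strip T) f z =
  \int[mu]_(t in `[0, T]) \int[P]_w f (w, t).
Proof.
rewrite Rintegral_mkcond -(Rint_prod2 fi') [RHS]Rintegral_mkcond.
apply: eq_Rintegral => t _; rewrite patchE; case: ifPn => [/set_mem It|/negP nIt].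
  by apply: eq_Rintegral => w _ /=; rewrite patch_in.
rewrite -[RHS](Rint_cst P); apply: eq_Rintegral => w _.
by rewrite patch_out// => It; apply: nIt; exact/mem_set.
Qed.

Lemma strip_integrable2 :
  mu.-integrable `[0, T] (EFin \o (fun t => \int[P]_w f (w, t))).
Proof.
apply/(integrable_mkcond _ mI); rewrite restrict_EFin.
have := integrable_Rint2 fi'; congr (integrable _ _ (EFin \o _)).
apply/funext => t; rewrite patchE; case: ifPn => [/set_mem It|/negP nIt].
  by apply: eq_Rintegral => w _ /=; rewrite patch_in.
rewrite -[RHS](Rint_cst P); apply: eq_Rintegral => w _.
by rewrite patch_out// => It; apply: nIt; exact/mem_set.
Qed.

End strip_Fubini.

(** The noise N may have infinite norm, as the risk may be infinite; both sides are
    then infinite, since xi has finite norm. *)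
Lemma sqr_norm_expansion (N xi : Omega * measurableTypeR R -> R) (c : R) :
  measurable_fun (strip T) N -> sq_integrable (P \x mu)%E (strip T) xi ->
  (sq_integrable (P \x mu)%E (strip T) N ->
     \int[(P \x mu)%E]_(z in strip T) (N z * xi z) = c) ->
  (\int[(P \x mu)%E]_(z in strip T) ((N z + xi z) ^+ 2)%:E =
   \int[(P \x mu)%E]_(z in strip T) (N z ^+ 2)%:E +
   \int[(P \x mu)%E]_(z in strip T) (xi z ^+ 2)%:E + (2 * c)%:E)%E.
Proof.
move=> mN sxi cE.
have sqP (f : Omega * measurableTypeR R -> R) : measurable_fun (strip T) f ->
    (\int[(P \x mu)%E]_(z in strip T) (f z ^+ 2)%:E < +oo)%E ->
    sq_integrable (P \x mu)%E (strip T) f.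
  move=> mf fy; split => //; apply/integrableP; split.
    by apply/measurable_EFinP; exact: measurable_funX.
  by under eq_integral do rewrite /= ger0_norm ?sqr_ge0//.
have infty (f : Omega * measurableTypeR R -> R) : measurable_fun (strip T) f ->
    ~ sq_integrable (P \x mu)%E (strip T) f ->
    (\int[(P \x mu)%E]_(z in strip T) (f z ^+ 2)%:E = +oo)%E.
  move=> mf nf; apply/eqP; rewrite -leye_eq leNgt; apply/negP => fy.
  exact/nf/sqP.
have [mxi ixi] := sxi.
rewrite -[X in (_ = _ + X + _)%E]EFin_Rint//.
have [sN|nsN] := pselect (sq_integrable (P \x mu)%E (strip T) N).
  have [_ iN] := sN; have iNx := sq_integrableM mS sN sxi.
  rewrite -!EFin_Rint//; last by case: (sq_integrableD mS sN sxi).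
  rewrite -!EFinD; congr EFin; rewrite -(cE sN).
  rewrite -RintZ// -!RintD//.
  - by apply: eq_Rintegral => z _; ring.
  - exact: integrableRD.
  - exact: integrableRZ.
have nsNx : ~ sq_integrable (P \x mu)%E (strip T) (fun z => N z + xi z).
  move=> sNx; apply: nsN; have := sq_integrableB mS sNx sxi.
  by under eq_fun do rewrite addrK.
rewrite (infty _ mN nsN) (infty _ _ nsNx) //.
exact: measurable_funD.
Qed.

End strip_integrals.

Section drift_measurability.
Context d (Omega : measurableType d) {R : realType} (T : R).

(** The drift is the partial integral in s of du(s, w) 1_{s <= t}. *)
Lemma measurable_drift (du : R -> Omega -> R) :
  measurable_fun (strip T) (joint du) -> measurable_fun (strip T) (joint (drift du)).
Proof.
move=> mdu.
have mS : measurable (strip T : set (Omega * measurableTypeR R)) by exact: measurable_strip.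
have mdu' : measurable_fun setT (joint du \_ (strip T)).
  exact/(measurable_restrictT _ mS).
pose g (z : (Omega * measurableTypeR R) * measurableTypeR R) : R :=
  (joint du \_ (strip T)) (z.1.1, z.2) * (z.2 <= z.1.2)%R%:R.
have mg : measurable_fun setT g.
  apply: measurable_funM.
    apply: (measurableT_comp mdu'); apply/measurable_fun_pairP; split => /=.
      exact: (measurableT_comp measurable_fst measurable_fst).
    exact: measurable_snd.
  rewrite (_ : (fun z => _) = (fun z => (\1_[set b : bool | b] (z.2 <= z.1.2)%R : R))).
    apply: measurableT_comp; first exact: measurable_indic.
    apply: measurable_fun_ler; first exact: measurable_snd.
    exact: (measurableT_comp measurable_snd measurable_fst).
  by apply/funext => z; rewrite indicE mem_setE; case: (_ <= _)%R.
have := measurable_partial_integral (@lebesgue_measure R) mg.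
move=> /(@measurable_funTS _ _ _ _ (strip T)).
apply: eq_measurable_fun => -[w t] /set_mem[_ /=]; rewrite in_itv/= => /andP[t0 tT].
rewrite /joint /drift /=; rewrite [RHS]Rintegral_mkcond.
apply: eq_Rintegral => s _; rewrite /g /= !patchE /=.
have [st|ts] := leP s t; last first.
  rewrite mulr0 memNset//= in_itv/= => /andP[_].
  by rewrite leNgt ts.
rewrite mulr1; congr (if _ then _ else _); apply/idP/idP.
  by move=> /set_mem[_ /=]; rewrite !in_itv/= inE/= in_itv/= st => /andP[->].
move=> /set_mem /=; rewrite in_itv/= => /andP[s0 _]; apply/mem_set; split => //=.
by rewrite in_itv/= s0 (le_trans st).
Qed.

End drift_measurability.

(** * The regularised reciprocal *)

Section regularised_inverse.
Context {R : realType}.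
Variable e : R.
Hypothesis e0 : 0 < e.

(** A smooth bounded substitute for 1/x. Its product with x, and that of its
    derivative with x^2, are bounded by 1 uniformly in e: this is what dominated
    convergence needs as e goes to 0. *)
Definition reg_inv (x : R) := x / (x ^+ 2 + e).

Definition dreg_inv (x : R) := (e - x ^+ 2) / (x ^+ 2 + e) ^+ 2.

Let r (x : R) := (x ^+ 2 + e)^-1.

Let den_gt0 (x : R) : 0 < x ^+ 2 + e.
Proof. by rewrite ltr_wpDl// sqr_ge0. Qed.

Let den_neq0 (x : R) : x ^+ 2 + e != 0. Proof. by rewrite gt_eqF. Qed.

Let r_ge0 (x : R) : 0 <= r x. Proof. by rewrite invr_ge0 ltW. Qed.

Let rE (x : R) : r x * (x ^+ 2 + e) = 1. Proof. by rewrite mulVf. Qed.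

Let r_le (x : R) : r x <= e^-1.
Proof. by rewrite lef_pV2 ?posrE// lerDr sqr_ge0. Qed.

Let xr_le (x : R) : `|x| * r x <= 1 + e^-1.
Proof.
have h : `|x| <= 1 + x ^+ 2.
  by rewrite -(real_normK (num_real x)); have := sqr_ge0 (`|x| - 1);
     have := normr_ge0 x; nra.
rewrite (@le_trans _ _ ((1 + x ^+ 2) * r x))// ?ler_wpM2r//.
rewrite mulrDl mul1r addrC lerD ?r_le//.
by rewrite -(rE x) mulrC ler_wpM2l// lerDl ltW.
Qed.

Lemma is_derive_reg_inv (x : R) : is_derive x 1 reg_inv (dreg_inv x).
Proof.
have h1 : is_derive x 1 (fun y : R => y ^+ 2 + e) (2 * x).
  by apply: is_derive_eq; rewrite /GRing.scale /=; ring.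
have h2 := @is_deriveV _ (fun y : R => y ^+ 2 + e) x _ 1 (den_neq0 x) h1.
apply: (is_derive_eq (is_deriveM (is_derive_id x 1) h2)).
by rewrite /dreg_inv /GRing.scale /=; field.
Qed.

Let M : R := 1 + e^-1.
Let L : R := 10 * M ^+ 3.

Let M1 : 1 <= M. Proof. by rewrite lerDl invr_ge0 ltW. Qed.

Lemma reg_inv_bounded (x : R) : `|reg_inv x| <= 1 + e^-1.
Proof. by rewrite normrM (ger0_norm (r_ge0 x)) xr_le. Qed.

Let dreg_invE (x : R) : dreg_inv x = 2 * e * r x ^+ 2 - r x.
Proof. by rewrite /dreg_inv /r; field. Qed.

Let er_le1 (x : R) : e * r x <= 1.
Proof. by rewrite -(rE x) mulrC ler_wpM2l// lerDr sqr_ge0. Qed.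

Let er_ge0 (x : R) : 0 <= e * r x. Proof. by rewrite mulr_ge0 ?r_ge0// ltW. Qed.

Lemma dreg_inv_bounded (x : R) : `|dreg_inv x| <= 1 + e^-1.
Proof.
have -> : dreg_inv x = (2 * (e * r x) - 1) * r x by rewrite dreg_invE; ring.
rewrite normrM (ger0_norm (r_ge0 x)) -[leRHS]mul1r ler_pM//.
  by have := er_le1 x; have := er_ge0 x; rewrite ler_norml => ? ?; apply/andP; split; lra.
by rewrite (le_trans (r_le x))// lerDr.
Qed.

Let rM (x : R) : r x <= M. Proof. by rewrite (le_trans (r_le x))// lerDr. Qed.

Let r_lip (x y : R) : `|r x - r y| <= 2 * M ^+ 2 * `|x - y|.
Proof.
have -> : r x - r y = (y - x) * (x * r x * r y + y * r y * r x).
  by rewrite /r; field; rewrite !den_neq0.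
rewrite normrM distrC mulrC ler_wpM2r// (le_trans (ler_normD _ _))// !normrM.
rewrite !(ger0_norm (r_ge0 _)).
have h1 : `|x| * r x * r y <= M * M by rewrite ler_pM ?mulr_ge0.
have h2 : `|y| * r y * r x <= M * M by rewrite ler_pM ?mulr_ge0.
by rewrite (le_trans (lerD h1 h2))// expr2; lra.
Qed.

Lemma reg_inv_lip (x y : R) : `|reg_inv x - reg_inv y| <= 10 * (1 + e^-1) ^+ 3 * `|x - y|.
Proof.
have -> : reg_inv x - reg_inv y = (x - y) * (e * r x * r y - (x * r x) * (y * r y)).
  by rewrite /reg_inv /r; field; rewrite !den_neq0.
rewrite normrM mulrC ler_wpM2r// (le_trans (ler_normB _ _))// !normrM.
rewrite !(ger0_norm (r_ge0 _)) (gtr0_norm e0).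
have h1 : e * r x * r y <= 1 * M by rewrite ler_pM.
have h2 : `|x| * r x * (`|y| * r y) <= M * M by rewrite ler_pM ?mulr_ge0.
rewrite (le_trans (lerD h1 h2))// -/M.
have M2 : M <= M ^+ 2 by rewrite expr2 ler_peMl// (le_trans _ M1).
have M3 : M ^+ 2 <= M ^+ 3 by rewrite exprS ler_peMl ?sqr_ge0.
by have := M1; rewrite -expr2; lra.
Qed.

Lemma dreg_inv_lip (x y : R) : `|dreg_inv x - dreg_inv y| <= 10 * (1 + e^-1) ^+ 3 * `|x - y|.
Proof.
have -> : dreg_inv x - dreg_inv y = (r x - r y) * (2 * (e * r x) + 2 * (e * r y) - 1).
  by rewrite !dreg_invE; ring.
rewrite normrM (@le_trans _ _ (2 * M ^+ 2 * `|x - y| * 3))//.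
  rewrite ler_pM ?r_lip// ler_norml.
  have := er_le1 x; have := er_ge0 x; have := er_le1 y; have := er_ge0 y => ? ? ? ?.
  by apply/andP; split; lra.
rewrite mulrAC ler_wpM2r// -/M.
have M3 : M ^+ 2 <= M ^+ 3 by rewrite exprS ler_peMl ?sqr_ge0.
by have := sqr_ge0 M; lra.
Qed.

Let sqr_r_le1 (x : R) : `|x ^+ 2 * r x| <= 1.
Proof.
have p : 0 <= x ^+ 2 * r x by rewrite mulr_ge0 ?sqr_ge0.
by rewrite ger0_norm// -(rE x) mulrC ler_wpM2l// lerDl ltW.
Qed.

Lemma reg_inv_mul_bounded (x : R) : `|x * reg_inv x| <= 1.
Proof.
have -> : x * reg_inv x = x ^+ 2 * r x by rewrite /reg_inv /r; ring.
exact: sqr_r_le1.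
Qed.

Lemma dreg_inv_mul_bounded (x : R) : `|x ^+ 2 * dreg_inv x| <= 1.
Proof.
have -> : x ^+ 2 * dreg_inv x = (x ^+ 2 * r x) * (2 * (e * r x) - 1).
  by rewrite dreg_invE; ring.
rewrite normrM -[leRHS]mulr1 ler_pM//.
by have := er_le1 x; have := er_ge0 x; rewrite ler_norml => ? ?; apply/andP; split; lra.
Qed.

End regularised_inverse.

Section regularised_inverse_limit.
Context {R : realType}.
Implicit Types x : R.

Let cvg_den x : x ^+ 2 + k.+1%:R^-1 @[k --> \oo] --> x ^+ 2.
Proof.
rewrite -[X in _ --> X]addr0; apply: cvgD; first exact: cvg_cst.
exact: cvg_harmonic.
Qed.

Lemma reg_inv_mul_cvg x : x != 0 -> x * reg_inv k.+1%:R^-1 x @[k --> \oo] --> (1 : R).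
Proof.
move=> x0; have E : x * (x / x ^+ 2) = 1 by field.
rewrite -[X in _ --> X]E; apply: cvgM; first exact: cvg_cst.
apply: cvgM; first exact: cvg_cst.
by apply: cvgV; [rewrite sqrf_eq0|exact: cvg_den].
Qed.

Lemma dreg_inv_mul_cvg x : x != 0 ->
  x ^+ 2 * dreg_inv k.+1%:R^-1 x @[k --> \oo] --> (-1 : R).
Proof.
move=> x0; have E : x ^+ 2 * ((0 - x ^+ 2) / (x ^+ 2) ^+ 2) = -1 by field.
rewrite -[X in _ --> X]E; apply: cvgM; first exact: cvg_cst.
apply: cvgM.
  by apply: cvgB; [exact: cvg_harmonic|exact: cvg_cst].
apply: cvgV; first by rewrite !sqrf_eq0.
under eq_fun do rewrite expr2; rewrite expr2.
by apply: cvgM; exact: cvg_den.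
Qed.

Lemma measurable_reg_inv (e : R) : 0 < e -> measurable_fun setT (reg_inv e).
Proof.
move=> e0; apply: continuous_measurable_fun.
exact: is_derive_continuous (is_derive_reg_inv e0).
Qed.

Lemma measurable_dreg_inv (e : R) : 0 < e -> measurable_fun setT (dreg_inv e).
Proof.
move=> e0; rewrite /dreg_inv; apply: measurable_funM.
  by apply: measurable_funB => //; exact: measurable_funX.
rewrite (_ : (fun x => _) = (fun x => ((x ^+ 2 + e)^-1) ^+ 2)); last first.
  by apply/funext => x; rewrite exprVn.
apply: measurable_funX; apply: continuous_measurable_fun => x.
apply: cvgV; first by rewrite gt_eqF// ltr_wpDl// sqr_ge0.
by apply: cvgD; [exact: exprn_continuous|exact: cvg_cst].
Qed.

End regularised_inverse_limit.

(** * Unbiased risk estimates *)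

Section risk_estimates.
Context d (Omega : measurableType d) {R : realType} (P : probability Omega R).
Context (mu : {finite_measure set (measurableTypeR R) -> \bar R}) (T : R).
Context (H : completeNormedModType R) (ip : H -> H -> R) (chi : R -> H).
Context (W : H -> Omega -> R) (h : nat -> H) (gamma : R -> R -> R).
Variable N : R -> Omega -> R.
Hypotheses (T0 : 0 < T) (hp : hilbert_product ip) (iso : isonormal P ip W).
Hypothesis mN : measurable_fun (strip T) (joint N).
Hypothesis N_chi : forall t, t \in `[0, T] -> {ae P, forall w, W (chi t) w = N t w}.
Hypothesis N_cov : forall t, t \in `[0, T] ->
  ('E_P[fun w => (N t w * N t w)%R])%E = (gamma t t)%:E.

Let M := (P \x mu)%E.

Let mS : measurable (strip T : set (Omega * measurableTypeR R)).
Proof. exact: measurable_strip. Qed.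

Let mI : measurable ([set` `[0, T]] : set (measurableTypeR R)).
Proof. exact: measurable_itv. Qed.

Let mNt t : t \in `[0, T] -> measurable_fun setT (N t).
Proof. exact: (measurable_strip_section mN). Qed.

Lemma risk_eq_noise :
  (risk mu T gamma = \int[M]_(z in strip T) (joint N z ^+ 2)%:E)%E.
Proof.
rewrite strip_Tonelli2//; last 2 first.
- exact: measurable_funX.
- by move=> z; exact: sqr_ge0.
apply: eq_integral => t It; rewrite -N_cov; last by rewrite inE in It.
by rewrite unlock; apply: eq_integral => w _; rewrite expr2.
Qed.

Lemma sqnorm_eq_strip (Y : R -> Omega -> R) : measurable_fun (strip T) (joint Y) ->
  (\int[P]_w sqnorm_L2 mu T (fun t => Y t w) =
   \int[M]_(z in strip T) (joint Y z ^+ 2)%:E)%E.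
Proof.
move=> mY; rewrite strip_Tonelli1//; first exact: measurable_funX.
by move=> z; exact: sqr_ge0.
Qed.

Lemma shifted_risk (xi : R -> Omega -> R) (c : R) :
  sq_integrable M (strip T) (joint xi) ->
  (sq_integrable M (strip T) (joint N) ->
     \int[M]_(z in strip T) (joint N z * joint xi z) = c) ->
  (\int[P]_w sqnorm_L2 mu T (fun t => N t w + xi t w)%R =
   risk mu T gamma + \int[M]_(z in strip T) (joint xi z ^+ 2)%:E + (2 * c)%:E)%E.
Proof.
move=> sxi cE; have [mxi _] := sxi.
rewrite (@sqnorm_eq_strip (fun t w => N t w + xi t w)); last exact: measurable_funD.
by rewrite risk_eq_noise -(sqr_norm_expansion mN sxi cE).
Qed.

Lemma noise_ibp t (Y Z : Omega -> R) : t \in `[0, T] ->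
  malliavin P ip chi W h t Y Z -> measurable_fun setT Z ->
  \int[P]_w (N t w * Y w) = \int[P]_w Z w.
Proof.
move=> It [G gG ZG] mZ.
have [sY sG] := gradient_sq_integrable hp iso (chi t) gG.
have [mY _] := sY; have [mG _] := sG.
have mW := isonormal_measurable iso (chi t).
transitivity (\int[P]_w (W (chi t) w * Y w)).
  apply: Rint_ae_eq => //; try exact: measurable_funM.
    by apply: measurable_funM => //; exact: mNt.
  by apply: filterS (N_chi It) => w ->.
rewrite (malliavin_ibp1 hp iso (chi t) gG); apply: Rint_ae_eq => //.
by apply: filterS ZG => w ->.
Qed.

(** The cross term is computed at each time t by integration by parts in the
    direction chi t, then integrated over t. *)
Lemma unbiased_risk_estimate (xi Dxi : R -> Omega -> R) :
  sq_integrable M (strip T) (joint xi) ->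
  (forall t, t \in `[0, T] -> malliavin P ip chi W h t (xi t) (Dxi t)) ->
  M.-integrable (strip T) (EFin \o joint Dxi) ->
  (\int[P]_w sqnorm_L2 mu T (fun t => N t w + xi t w)%R
   = risk mu T gamma + \int[M]_(z in strip T) ((joint xi z) ^+ 2)%:E
     + 2%:E * \int[P]_w \int[mu]_(t in `[0%R, T]) (Dxi t w)%:E)%E.
Proof.
move=> sxi mall iD.
rewrite (strip_integral1 iD) -EFinM; apply: shifted_risk => // sN.
have iNx := sq_integrableM mS sN sxi.
rewrite (strip_Rint2 iNx) (strip_Rint2 iD); apply: eq_Rintegral => t.
rewrite inE => It; apply: noise_ibp => //; first exact: mall.
exact: (measurable_strip_section (integrable_meas iD)).
Qed.

Lemma noise_ibp_quotient t e (F DFt DDFt : Omega -> R) : t \in `[0, T] -> 0 < e ->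
  malliavin P ip chi W h t F DFt -> malliavin P ip chi W h t DFt DDFt ->
  measurable_fun setT DDFt ->
  [/\ measurable_fun setT F, measurable_fun setT DFt &
  \int[P]_w (N t w * (DFt w * reg_inv e (F w))) =
  \int[P]_w (reg_inv e (F w) * DDFt w) +
  \int[P]_w (dreg_inv e (F w) * DFt w ^+ 2)].
Proof.
move=> It e0 [GF gF FG] [GD gD DG] mDD.
have [sF sGF] := gradient_sq_integrable hp iso (chi t) gF.
have [sD sGD] := gradient_sq_integrable hp iso (chi t) gD.
have [mF _] := sF; have [mD _] := sD; have [mGF _] := sGF; have [mGD _] := sGD.
have mW := isonormal_measurable iso (chi t).
have mr : measurable_fun setT (fun w => reg_inv e (F w)).
  by apply: measurableT_comp => //; exact: measurable_reg_inv.
have mdr : measurable_fun setT (fun w => dreg_inv e (F w)).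
  by apply: measurableT_comp => //; exact: measurable_dreg_inv.
split => //.
transitivity (\int[P]_w (W (chi t) w * (DFt w * reg_inv e (F w)))).
  apply: Rint_ae_eq => //.
  - by apply: measurable_funM; [exact: mNt|exact: measurable_funM].
  - by apply: measurable_funM => //; exact: measurable_funM.
  - by apply: filterS (N_chi It) => w ->.
rewrite (malliavin_ibp hp iso (chi t) gD gF (is_derive_reg_inv e0)
  (reg_inv_bounded e0) (dreg_inv_bounded e0) (reg_inv_lip e0) (dreg_inv_lip e0)).
congr (_ + _); apply: Rint_ae_eq => //.
- exact: measurable_funM.
- exact: measurable_funM.
- by apply: filterS DG => w ->.
- by apply: measurable_funM => //; exact: measurable_funM.
- by apply: measurable_funM => //; exact: measurable_funX.
- by apply: filterS FG => w <- _; rewrite expr2 mulrA.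
Qed.

Section stein_estimator.
Variables (F : Omega -> R) (DF DDF : R -> Omega -> R).
Hypothesis F_gt0 : {ae P, forall w, 0 < F w}.
Hypothesis DF_mall : forall t, t \in `[0, T] -> malliavin P ip chi W h t F (DF t).
Hypothesis DDF_mall : forall t, t \in `[0, T] ->
  malliavin P ip chi W h t (DF t) (DDF t).
Hypothesis iDDF : M.-integrable (strip T) (EFin \o joint DDF).
Hypothesis sDlog : sq_integrable M (strip T) (joint (Dlog F DF)).
Hypothesis iDelta :
  P.-integrable setT (EFin \o (fun w => laplacian mu T DDF w / F w)).

Let mF : measurable_fun setT F.
Proof.
have I0 : (0 : R) \in `[0, T] by rewrite in_itv/= lexx ltW.
by have [G [mF _ _] _] := DF_mall I0.
Qed.

Let mDDF : measurable_fun (strip T) (joint DDF). Proof. exact: integrable_meas iDDF. Qed.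

Let mDlog : measurable_fun (strip T) (joint (Dlog F DF)). Proof. by case: sDlog. Qed.

Let iDlog2 : M.-integrable (strip T) (EFin \o (fun z => joint (Dlog F DF) z ^+ 2)).
Proof. by case: sDlog. Qed.

Let mfF (f : R -> R) (D : set (Omega * measurableTypeR R)) : measurable_fun setT f ->
  measurable_fun D (fun z => f (F z.1)).
Proof.
move=> mf; apply: measurable_funTS.
by apply: (measurableT_comp mf); exact: measurableT_comp.
Qed.

Let e k : R := k.+1%:R^-1.

Let e0 k : 0 < e k. Proof. by rewrite /e invr_gt0. Qed.

Let Dlog0 w t : F w = 0 -> Dlog F DF t w = 0.
Proof. by move=> Fw; rewrite /Dlog Fw invr0 mulr0. Qed.

Let i1 k : M.-integrable (strip T) (EFin \o (fun z => reg_inv (e k) (F z.1) * joint DDF z)).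
Proof.
apply: (@integrableRM_bounded _ _ _ M (strip T) mS (1 + (e k)^-1)) => //.
  by apply: mfF; exact: measurable_reg_inv.
by move=> z _; exact: reg_inv_bounded.
Qed.

Let i2 k : M.-integrable (strip T)
  (EFin \o (fun z => (F z.1 ^+ 2 * dreg_inv (e k) (F z.1)) * joint (Dlog F DF) z ^+ 2)).
Proof.
apply: (@integrableRM_bounded _ _ _ M (strip T) mS 1) => //.
  apply: (mfF (f := fun x => x ^+ 2 * dreg_inv (e k) x)).
  by apply: measurable_funM; [exact: measurable_funX|exact: measurable_dreg_inv].
by move=> z _; exact: dreg_inv_mul_bounded.
Qed.

Let regularised k : sq_integrable M (strip T) (joint N) ->
  \int[M]_(z in strip T) (F z.1 * reg_inv (e k) (F z.1) *
     (joint N z * joint (Dlog F DF) z)) =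
  \int[M]_(z in strip T) (reg_inv (e k) (F z.1) * joint DDF z) +
  \int[M]_(z in strip T) ((F z.1 ^+ 2 * dreg_inv (e k) (F z.1)) *
     joint (Dlog F DF) z ^+ 2).
Proof.
move=> sN.
have i0 : M.-integrable (strip T) (EFin \o (fun z =>
    F z.1 * reg_inv (e k) (F z.1) * (joint N z * joint (Dlog F DF) z))).
  apply: (@integrableRM_bounded _ _ _ M (strip T) mS 1).
  - apply: (mfF (f := fun x => x * reg_inv (e k) x)).
    by apply: measurable_funM => //; exact: measurable_reg_inv.
  - by move=> z _; exact: reg_inv_mul_bounded.
  - exact: sq_integrableM.
rewrite (strip_Rint2 i0) (strip_Rint2 (i1 k)) (strip_Rint2 (i2 k)) -RintD//; last 2 first.
- exact: strip_integrable2 (i1 k).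
- exact: strip_integrable2 (i2 k).
apply: eq_Rintegral => t; rewrite inE => It.
have mDDt := measurable_strip_section mDDF It.
have mDlt := measurable_strip_section mDlog It.
have [_ mDt E] := noise_ibp_quotient It (e0 k) (DF_mall It) (DDF_mall It) mDDt.
have mr : measurable_fun setT (fun w => reg_inv (e k) (F w)).
  by apply: measurableT_comp => //; exact: measurable_reg_inv.
have mdr : measurable_fun setT (fun w => dreg_inv (e k) (F w)).
  by apply: measurableT_comp => //; exact: measurable_dreg_inv.
transitivity (\int[P]_w (N t w * (DF t w * reg_inv (e k) (F w)))).
  apply: Rint_ae_eq => //.
  - apply: measurable_funM; first exact: measurable_funM.
    by apply: measurable_funM => //; exact: mNt.
  - by apply: measurable_funM; [exact: mNt|exact: measurable_funM].
  - apply: filterS F_gt0 => w Fw _; rewrite /joint /Dlog /=; field.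
    by rewrite gt_eqF.
rewrite E; congr (_ + _); apply: Rint_ae_eq => //.
- by apply: measurable_funM => //; exact: measurable_funX.
- apply: measurable_funM; last exact: measurable_funX.
  by apply: measurable_funM => //; exact: measurable_funX.
- apply: filterS F_gt0 => w Fw _; rewrite /joint /Dlog /=; field.
  by rewrite gt_eqF.
Qed.

Let Delta_section k :
  \int[M]_(z in strip T) (reg_inv (e k) (F z.1) * joint DDF z) =
  \int[P]_w (F w * reg_inv (e k) (F w) * (laplacian mu T DDF w / F w)).
Proof.
rewrite -(strip_Rint1 (i1 k)); apply: Rint_ae_eq => //.
- exact: (measurable_strip_Rint mu (integrable_meas (i1 k))).
- apply: measurable_funM; last exact: integrable_meas iDelta.
  by apply: measurable_funM => //; apply: measurableT_comp => //; exact: measurable_reg_inv.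
- apply: filterS2 F_gt0 (strip_integrable_section iDDF) => w Fw iw _.
  rewrite [LHS](_ : _ = reg_inv (e k) (F w) * laplacian mu T DDF w).
    by field; rewrite gt_eqF.
  by rewrite /laplacian -RintZ.
Qed.

(** The quotient DF / F need not be in the domain, so 1/F is replaced by its
    regularisation, which is then removed by dominated convergence. The dominating
    functions are those whose integrability is assumed. Where F = 0 the logarithmic
    derivative vanishes by convention, so that convergence holds everywhere. *)
Lemma noise_Dlog : sq_integrable M (strip T) (joint N) ->
  \int[M]_(z in strip T) (joint N z * joint (Dlog F DF) z) =
  \int[P]_w (laplacian mu T DDF w / F w) -
  \int[M]_(z in strip T) (joint (Dlog F DF) z ^+ 2).
Proof.
move=> sN; have iND := sq_integrableM mS sN sDlog.
have [mNj _] := sN.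
have F0_cvg w : F w != 0 -> F w * reg_inv (e k) (F w) @[k --> \oo] --> (1 : R).
  exact: reg_inv_mul_cvg.
have mreg k (D : set (Omega * measurableTypeR R)) :
    measurable_fun D (fun z => F z.1 * reg_inv (e k) (F z.1)).
  apply: (mfF (f := fun x => x * reg_inv (e k) x)).
  by apply: measurable_funM => //; exact: measurable_reg_inv.
have la : (fun k => \int[M]_(z in strip T) (F z.1 * reg_inv (e k) (F z.1) *
     (joint N z * joint (Dlog F DF) z))) @ \oo -->
   \int[M]_(z in strip T) (joint N z * joint (Dlog F DF) z).
  have a1 k : measurable_fun (strip T) (fun z => F z.1 * reg_inv (e k) (F z.1) *
     (joint N z * joint (Dlog F DF) z)).
    by apply: measurable_funM => //; exact: measurable_funM.
  have a2 := measurable_funM mNj mDlog.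
  have a3 := integrableR_abs mS iND.
  have a4 k z : strip T z -> `|F z.1 * reg_inv (e k) (F z.1) *
     (joint N z * joint (Dlog F DF) z)| <= `|joint N z * joint (Dlog F DF) z|.
    by move=> _; rewrite normrM ler_piMl// reg_inv_mul_bounded.
  have a5 : {ae M, forall z, strip T z -> F z.1 * reg_inv (e k) (F z.1) *
     (joint N z * joint (Dlog F DF) z) @[k --> \oo] --> joint N z * joint (Dlog F DF) z}.
    apply: aeW => -[w t] _ /=; rewrite /joint /=.
    have [Fw|Fw] := eqVneq (F w) 0.
      by rewrite Dlog0// mulr0; under eq_fun do rewrite mulr0; exact: cvg_cst.
    rewrite -[X in _ --> X]mul1r; apply: cvgM; last exact: cvg_cst.
    exact: F0_cvg.
  by have [] := @Rint_dominated _ _ _ M (strip T) mS _ _ _ a1 a2 a3 a4 a5.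
have lb : (fun k => \int[P]_w (F w * reg_inv (e k) (F w) *
    (laplacian mu T DDF w / F w))) @ \oo --> \int[P]_w (laplacian mu T DDF w / F w).
  have mD := integrable_meas iDelta.
  have a1 k : measurable_fun setT (fun w => F w * reg_inv (e k) (F w) *
    (laplacian mu T DDF w / F w)).
    apply: measurable_funM => //; apply: measurable_funM => //.
    by apply: measurableT_comp => //; exact: measurable_reg_inv.
  have a3 := integrableR_abs measurableT iDelta.
  have a4 k w : setT w -> `|F w * reg_inv (e k) (F w) *
    (laplacian mu T DDF w / F w)| <= `|laplacian mu T DDF w / F w|.
    by move=> _; rewrite normrM ler_piMl// reg_inv_mul_bounded.
  have a5 : {ae P, forall w, setT w -> F w * reg_inv (e k) (F w) *
    (laplacian mu T DDF w / F w) @[k --> \oo] --> laplacian mu T DDF w / F w}.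
    apply: aeW => w _; have [Fw|Fw] := eqVneq (F w) 0.
      by rewrite Fw invr0 mulr0; under eq_fun do rewrite mulr0; exact: cvg_cst.
    rewrite -[X in _ --> X]mul1r; apply: cvgM; last exact: cvg_cst.
    exact: F0_cvg.
  by have [] := @Rint_dominated _ _ _ P setT measurableT _ _ _ a1 mD a3 a4 a5.
have lc : (fun k => \int[M]_(z in strip T) ((F z.1 ^+ 2 * dreg_inv (e k) (F z.1)) *
     joint (Dlog F DF) z ^+ 2)) @ \oo -->
    \int[M]_(z in strip T) (- joint (Dlog F DF) z ^+ 2).
  have a1 k := integrable_meas (i2 k).
  have a2 : measurable_fun (strip T) (fun z => - joint (Dlog F DF) z ^+ 2).
    by apply: measurable_funN; exact: measurable_funX.
  have a4 k z : strip T z -> `|(F z.1 ^+ 2 * dreg_inv (e k) (F z.1)) *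
     joint (Dlog F DF) z ^+ 2| <= joint (Dlog F DF) z ^+ 2.
    move=> _; rewrite normrM [X in _ * X]ger0_norm ?sqr_ge0//.
    by rewrite ler_piMl ?sqr_ge0// dreg_inv_mul_bounded.
  have a5 : {ae M, forall z, strip T z -> (F z.1 ^+ 2 * dreg_inv (e k) (F z.1)) *
     joint (Dlog F DF) z ^+ 2 @[k --> \oo] --> - joint (Dlog F DF) z ^+ 2}.
    apply: aeW => -[w t] _ /=; rewrite /joint /=.
    have [Fw|Fw] := eqVneq (F w) 0.
      rewrite Dlog0// expr0n oppr0 /=; under eq_fun do rewrite mulr0.
      exact: cvg_cst.
    rewrite -[X in _ --> X]mulN1r; apply: cvgM; last exact: cvg_cst.
    exact: dreg_inv_mul_cvg.
  by have [] := @Rint_dominated _ _ _ M (strip T) mS _ _ _ a1 a2 iDlog2 a4 a5.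
rewrite (cvgn_add_unique la lb lc); last by move=> k; rewrite regularised// Delta_section.
congr (_ + _); rewrite -mulN1r -RintZ//.
by apply: eq_Rintegral => z _; rewrite mulN1r.
Qed.

Let sqnorm_Dlog :
  (\int[P]_w sqnorm_L2 mu T (fun t => Dlog F DF t w) =
   (\int[M]_(z in strip T) (joint (Dlog F DF) z ^+ 2))%:E)%E.
Proof. by rewrite sqnorm_eq_strip// EFin_Rint. Qed.

(** The cross term contributes twice - ||D log F||^2, whence the change of sign. *)
Lemma stein_risk :
  (\int[P]_w sqnorm_L2 mu T (fun t => N t w + Dlog F DF t w)%R
   = risk mu T gamma - \int[P]_w sqnorm_L2 mu T (fun t => Dlog F DF t w)
     + 2%:E * 'E_P[fun w => (laplacian mu T DDF w / F w)%R])%E.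
Proof.
rewrite (shifted_risk sDlog noise_Dlog) sqnorm_Dlog unlock -!EFin_Rint//.
move: (risk mu T gamma) => r; rewrite -!addeA -EFinM -EFinN -!EFinD.
by congr (_ + _%:E)%E; ring.
Qed.

(* DF is jointly measurable only through DF / F, hence this form; at F = 0 both
   sides vanish because division by 0 gives 0 *)
Let DDsqrtE t w : DDsqrt F DF DDF t w =
  (2 * Num.sqrt (F w))^-1 * DDF t w -
  (F w ^+ 2 / (4 * F w `^ (3 / 2))) * Dlog F DF t w ^+ 2.
Proof.
rewrite /DDsqrt /Dlog mulrC; congr (_ - _).
have [->|Fw] := eqVneq (F w) 0.
  by rewrite powR0 ?mulr0 ?invr0 ?mulr0 ?mul0r// gt_eqF.
rewrite real_normK ?num_real//; set q := (4 * _)^-1.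
by field.
Qed.

Let laplacian_sqrt : {ae P, forall w, setT w ->
  laplacian mu T (DDsqrt F DF DDF) w / Num.sqrt (F w) =
  1 / 2 * (laplacian mu T DDF w / F w) -
  1 / 4 * \int[mu]_(t in `[0, T]) (Dlog F DF t w ^+ 2)}.
Proof.
apply: filterS3 F_gt0 (strip_integrable_section iDDF) (strip_integrable_section iDlog2).
move=> w Fw i1w i2w _; rewrite /laplacian.
under eq_Rintegral do rewrite DDsqrtE.
have j1 : mu.-integrable `[0, T] (EFin \o (fun t => (2 * Num.sqrt (F w))^-1 * DDF t w)).
  exact: integrableRZ.
have j2 : mu.-integrable `[0, T] (EFin \o (fun t =>
    F w ^+ 2 / (4 * F w `^ (3 / 2)) * Dlog F DF t w ^+ 2)).
  exact: integrableRZ.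
rewrite RintB// !RintZ// -/(laplacian mu T DDF w).
have s0 : 0 < Num.sqrt (F w) by rewrite sqrtr_gt0.
have -> : F w `^ (3 / 2) = F w * Num.sqrt (F w).
  rewrite -powR12_sqrt ?ltW// -{2}(powRr1 (ltW Fw)) -powRD; last by rewrite gt_eqF ?implybT.
  by congr (_ `^ _); field.
have E : F w = Num.sqrt (F w) ^+ 2 by rewrite sqr_sqrtr// ltW.
set s := Num.sqrt (F w) in s0 E *; rewrite E.
by field; rewrite gt_eqF.
Qed.

(** By the chain rule, Lap(sqrt F) / sqrt F = (Lap F) / (2 F) - ||D log F||^2 / 4. *)
Lemma stein_risk_sqrt :
  (risk mu T gamma - \int[P]_w sqnorm_L2 mu T (fun t => Dlog F DF t w)
     + 2%:E * 'E_P[fun w => (laplacian mu T DDF w / F w)%R]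
   = risk mu T gamma
     + 4%:E * 'E_P[fun w =>
         (laplacian mu T (DDsqrt F DF DDF) w / Num.sqrt (F w))%R])%E.
Proof.
have iS := strip_integrable1 iDlog2.
have msqrt : measurable_fun setT (@Num.sqrt R).
  by apply: continuous_measurable_fun; exact: sqrt_continuous.
have minv (f : R -> R) : (forall x, 0 <= f x) -> measurable_fun setT f ->
    measurable_fun setT (fun x => (f x)^-1).
  move=> f0 mf; rewrite (_ : (fun x => _) = (fun x => f x `^ (-1))).
    exact: (measurableT_comp (measurable_powR _) mf).
  by apply/funext => x; rewrite powR_inv1.
have mDDs : measurable_fun (strip T) (joint (DDsqrt F DF DDF)).
  rewrite (_ : joint _ = (fun z => (2 * Num.sqrt (F z.1))^-1 * joint DDF z -
    (F z.1 ^+ 2 / (4 * F z.1 `^ (3 / 2))) * joint (Dlog F DF) z ^+ 2)); last first.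
    by apply/funext => -[w t]; exact: DDsqrtE.
  apply: measurable_funB; apply: measurable_funM => //.
  - apply: (mfF (f := fun x => (2 * Num.sqrt x)^-1)).
    by apply: minv => [x|]; [rewrite mulr_ge0|exact: measurable_funM].
  - apply: (mfF (f := fun x => x ^+ 2 / (4 * x `^ (3 / 2)))).
    apply: measurable_funM; first exact: measurable_funX.
    apply: minv => [x|]; first by rewrite mulr_ge0 ?powR_ge0.
    by apply: measurable_funM => //; exact: measurable_powR.
  - exact: measurable_funX.
have mq : measurable_fun setT
    (fun w => laplacian mu T (DDsqrt F DF DDF) w / Num.sqrt (F w)).
  apply: measurable_funM; first exact: (measurable_strip_Rint mu mDDs).
  exact: (measurableT_comp (minv _ (@sqrtr_ge0 R) msqrt)).
have j1 := integrableRZ measurableT (1 / 2) iDelta.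
have j2 := integrableRZ measurableT (1 / 4) iS.
have j12 := integrableRB measurableT j1 j2.
have jq : P.-integrable setT (EFin \o
    (fun w => laplacian mu T (DDsqrt F DF DDF) w / Num.sqrt (F w))).
  apply: (integrable_ae_eq _ mq j12) => //.
  by apply: filterS laplacian_sqrt => w E Iw; rewrite E.
rewrite sqnorm_Dlog unlock -!EFin_Rint//.
move: (risk mu T gamma) => rk; rewrite -addeA -!EFinM -EFinN -EFinD.
congr (_ + _%:E)%E.
rewrite (Rint_ae_eq measurableT mq (integrable_meas j12) laplacian_sqrt).
by rewrite RintB// !RintZ// -(strip_Rint1 iDlog2); field.
Qed.

End stein_estimator.

End risk_estimates.

Theorem theorem3p6
  (R : realType) (T : R) (T_gt0 : 0 < T)
  (mu : {finite_measure set (measurableTypeR R) -> \bar R})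
  (K : R -> R -> R) (K_kernel : drift_kernel T K)
  (d : measure_display) (Omega : measurableType d)
  (P : probability Omega R) (X : R -> Omega -> R)
  (X_gaussian : centered_gaussian_process P T X (kernel_cov K))
  (X_generates : forall A : set Omega, measurable A <-> history X T A)
  (X_measurable : measurable_fun (strip T) (joint X))
  (du : R -> Omega -> R)
  (du_L2 : sq_integrable (P \x lebesgue_measure)%E (strip T) (joint du))
  (u_adapted : adapted T X (drift du))
  (Pu : probability Omega R)
  (Xu_gaussian : centered_gaussian_process Pu T
     (fun t w => X t w - drift du t w) (kernel_cov K))
  (H : completeNormedModType R) (ip : H -> H -> R) (chi : R -> H)
  (H_generated : generated_by T ip chi (kernel_cov K))
  (Xu : H -> Omega -> R) (Xu_isonormal : isonormal Pu ip Xu)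
  (Xu_chi : forall t : R, t \in `[0, T] ->
     {ae Pu, forall w, Xu (chi t) w = X t w - drift du t w})
  (h : nat -> H) (h_total : total_set (range h)) :
  (forall xi Dxi : R -> Omega -> R,
     sq_integrable (Pu \x mu)%E (strip T) (joint xi) ->
     (forall t : R, t \in `[0, T] ->
        malliavin Pu ip chi Xu h t (xi t) (Dxi t)) ->
     (Pu \x mu)%E.-integrable (strip T) (EFin \o joint Dxi) ->
     (\int[Pu]_w sqnorm_L2 mu T (fun t => (X t w + xi t w - drift du t w)%R)
      = risk mu T (kernel_cov K)
        + \int[(Pu \x mu)%E]_(z in strip T) ((joint xi z) ^+ 2)%:E
        + 2%:E * \int[Pu]_w \int[mu]_(t in `[0%R, T]) (Dxi t w)%:E)%E)
  /\
  (forall (F : Omega -> R) (DF DDF : R -> Omega -> R),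
     {ae Pu, forall w, 0 < F w} ->
     (forall t : R, t \in `[0, T] -> malliavin Pu ip chi Xu h t F (DF t)) ->
     (forall t : R, t \in `[0, T] ->
        malliavin Pu ip chi Xu h t (DF t) (DDF t)) ->
     (Pu \x mu)%E.-integrable (strip T) (EFin \o joint DDF) ->
     (* Both expectations on the right-hand side exist: this is not automatic,
        e.g. for F = Z ^ 2 with Z standard normal. *)
     sq_integrable (Pu \x mu)%E (strip T) (joint (Dlog F DF)) ->
     Pu.-integrable setT (EFin \o (fun w => laplacian mu T DDF w / F w)) ->
     (\int[Pu]_w sqnorm_L2 mu T
          (fun t => (X t w + Dlog F DF t w - drift du t w)%R)
      = risk mu T (kernel_cov K)
        - \int[Pu]_w sqnorm_L2 mu T (fun t => Dlog F DF t w)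
        + 2%:E * 'E_Pu[fun w => (laplacian mu T DDF w / F w)%R])%E
     /\
     (risk mu T (kernel_cov K)
        - \int[Pu]_w sqnorm_L2 mu T (fun t => Dlog F DF t w)
        + 2%:E * 'E_Pu[fun w => (laplacian mu T DDF w / F w)%R]
      = risk mu T (kernel_cov K)
        + 4%:E * 'E_Pu[fun w =>
            (laplacian mu T (DDsqrt F DF DDF) w / Num.sqrt (F w))%R])%E).
Proof.
pose N t w := X t w - drift du t w.
have hp : hilbert_product ip by case: H_generated.
have mN : measurable_fun (strip T) (joint N).
  by apply: measurable_funB => //; apply: measurable_drift; case: du_L2.
have N_cov t : t \in `[0, T] ->
    ('E_Pu[fun w => (N t w * N t w)%R])%E = (kernel_cov K t t)%:E.
  by move=> It; case: Xu_gaussian => _; exact.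
have shift (Y : R -> Omega -> R) :
    (\int[Pu]_w sqnorm_L2 mu T (fun t => (X t w + Y t w - drift du t w)%R) =
     \int[Pu]_w sqnorm_L2 mu T (fun t => (N t w + Y t w)%R))%E.
  apply: eq_integral => w _; congr sqnorm_L2; apply/funext => t.
  by rewrite /N addrAC.
split.
  move=> xi Dxi sxi mall iD; rewrite shift.
  exact: (unbiased_risk_estimate hp Xu_isonormal mN Xu_chi N_cov sxi mall iD).
move=> F DF DDF F0 mDF mDDF iDDF sDlog iDelta; rewrite shift; split.
  exact: (stein_risk T_gt0 hp Xu_isonormal mN Xu_chi N_cov F0 mDF mDDF iDDF
    sDlog iDelta).
exact: (stein_risk_sqrt _ T_gt0 F0 mDF iDDF sDlog iDelta).
Qed.
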